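(* (i) Let $\mathscr{C}$ be a strict semi-monoidal 2-category and let $(I,\alpha)$ be a weak unit in $\mathscr{C}$. Then the strict monoidal category $(\operatorname{End}(I),\#,\operatorname{id}_I)$, whose objects are the arrows $I\to I$ of $\mathscr{C}$ and whose arrows are the 2-cells between them, is a braided monoidal category, with braiding the 2-cells $\mathsf{T}_{f,g}: f\# g\Rightarrow g\# f$ described in the context. (ii) Every braided monoidal category arises in this way: for every braided monoidal category $\mathbb{B}$ there exist a strict semi-monoidal 2-category $\mathscr{C}$ and a weak unit $(I,\alpha)$ in $\mathscr{C}$ such that $\operatorname{End}(I)$, with the braiding $\mathsf{T}$, is equivalent to $\mathbb{B}$ as a braided monoidal category.
   Context: A strict semi-monoidal 2-category (an ''otherwise completely strict monoidal 2-category'', no unit being assumed) is a strict 2-category $\mathscr{C}$ with a strict 2-functor $\otimes:\mathscr{C}\times\mathscr{C}\to\mathscr{C}$ that is strictly associative. The tensor product is written by juxtaposition: $XY=X\otimes Y$; for an object $I$ and an arrow or 2-cell $u$, $Iu$ and $uI$ denote $\operatorname{id}_I\otimes u$ and $u\otimes\operatorname{id}_I$. Composition of arrows (and horizontal composition and whiskering of 2-cells) is denoted $\#$ and written left to right: $f\# g$ means first $f$, then $g$. Vertical composition of 2-cells is also written left to right, with a semicolon: $\mathsf{U};\mathsf{V}$ means first $\mathsf{U}$, then $\mathsf{V}$. An equi-arrow is an arrow admitting a quasi-inverse (an inverse up to invertible 2-cells). A weak unit in $\mathscr{C}$ is a pair $(I,\alpha)$ where $I$ is an object such that both 2-functors $X\mapsto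 IX$ and $X\mapsto XI$ are equivalences of 2-categories $\mathscr{C}\to\mathscr{C}$ (essentially surjective on objects up to equi-arrow, and inducing equivalences on hom categories), and $\alpha:II\to I$ is an equi-arrow. The 2-cell $\mathsf{A}$. Choose an arrow $\lambda_I:II\to I$ with an invertible 2-cell $\mathsf{l}:I\lambda_I\Rightarrow\alpha I$, and an arrow $\rho_I:II\to I$ with an invertible 2-cell $\mathsf{r}:I\alpha\Rightarrow\rho_I I$ (these exist because tensoring with $I$ is an equivalence). $\mathsf{A}:I\alpha\Rightarrow\alpha I$ is the unique (invertible) 2-cell such that $(I\alpha I)\#\mathsf{A}$ equals the composite $$(I\alpha I)\#(I\alpha)\Rightarrow (II\lambda_I)\#(\rho_I I)=(\rho_I II)\#(I\lambda_I)\Rightarrow (I\alpha I)\#(\alpha I)$$ where the first 2-cell is $(I\mathsf{l}^{-1})\#\mathsf{r}$ and the last is $(\mathsf{r}^{-1}I)\#\mathsf{l}$. It is independent of the choices. For $f:I\to I$ the invertible 2-cells $\mathsf{L}_f: If\#\alpha\Rightarrow\alpha\# f$ and $\mathsf{R}_f: fI\#\alpha\Rightarrow\alpha\# f$ are the unique ones with $$I\mathsf{L}_f=(IIf\#\mathsf{A});(\mathsf{A}^{-1}\# If),\qquad \mathsf{R}_fI=(fII\#\mathsf{A}^{-1});(\mathsf{A}\# fI),$$ using the identities $IIf\#\alpha I=\alpha I\# If$ and $fII\# I\alpha=I\alpha\# fI$. Let $\beta:I\to II$ be a right adjoint (quasi-inverse) to $\alpha$, with invertible counit $\mathsf{E}:\beta\#\alpha\Rightarrow\operatorname{id}_I$.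 Let $\mathsf{B}:\beta I\Rightarrow I\beta$ be the invertible 2-cell determined by $(\mathsf{B}\# I\alpha);I\mathsf{E}=(\beta I\#\mathsf{A});\mathsf{E}I$. The invertible 2-cells $\overline{\mathsf{L}}_f:\beta\# If\Rightarrow f\#\beta$ and $\overline{\mathsf{R}}_f:\beta\# fI\Rightarrow f\#\beta$ are the unique ones with $$I\overline{\mathsf{L}}_f=(\mathsf{B}^{-1}\# IIf);(If\#\mathsf{B}),\qquad \overline{\mathsf{R}}_fI=(\mathsf{B}\# fII);(fI\#\mathsf{B}^{-1}),$$ using $\beta I\# IIf=If\#\beta I$ and $I\beta\# fII=fI\# I\beta$. For $f,g:I\to I$, the 2-cell $\mathsf{T}_{f,g}:f\# g\Rightarrow g\# f$ is the composite $$f\# g\xRightarrow{\mathsf{E}^{-1}}f\#\beta\#\alpha\# g\xRightarrow{\overline{\mathsf{L}}_f^{-1}}\beta\# If\#\alpha\# g\xRightarrow{\mathsf{R}_g^{-1}}\beta\# If\# gI\#\alpha=\beta\# gI\# If\#\alpha\xRightarrow{\overline{\mathsf{R}}_g}g\#\beta\# If\#\alpha\xRightarrow{\mathsf{L}_f}g\#\beta\#\alpha\# f\xRightarrow{\mathsf{E}}g\# f,$$ where each arrow is the appropriate whiskering of the indicated 2-cell. It does not depend on the choice of $\beta$. *)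

(* Defs.v *)
From Stdlib Require Import Setoid ProofIrrelevance.
Set Implicit Arguments.
Unset Strict Implicit.
Unset Printing Implicit Defensive.
Lemma sig_ext (A : Type) (P : A -> Prop) (u v : {x : A | P x}) :
  proj1_sig u = proj1_sig v -> u = v.
Proof.
destruct u as [x p], v as [y q]; simpl; intros e; destruct e.
now rewrite (proof_irrelevance _ p q).
Qed.

(** All compositions are in diagrammatic order: [f ⨟ g] is first [f], then [g]. *)

Reserved Notation "x ⟶ y" (at level 68, no associativity).
Reserved Notation "f ⨟ g" (at level 60, right associativity).

Record category := Category {
  cob :> Type;
  chom : cob -> cob -> Type;
  cid : forall x, chom x x;
  ccomp : forall x y z, chom x y -> chom y z -> chom x z;
  cid_l : forall x y (f : chom x y), ccomp (cid x) f = f;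
  cid_r : forall x y (f : chom x y), ccomp f (cid y) = f;
  ccompA : forall x y z t (f : chom x y) (g : chom y z) (h : chom z t),
    ccomp f (ccomp g h) = ccomp (ccomp f g) h
}.

Notation "x ⟶ y" := (chom x y).
Notation "f ⨟ g" := (ccomp f g).

Record functor (A B : category) := Functor {
  fob :> A -> B;
  fmap : forall x y, x ⟶ y -> fob x ⟶ fob y;
  fmap_id : forall x, fmap (cid x) = cid (fob x);
  fmap_comp : forall x y z (f : x ⟶ y) (g : y ⟶ z), fmap (f ⨟ g) = fmap f ⨟ fmap g
}.

Definition id_functor (A : category) : functor A A.
Proof.
exists (fun x => x) (fun x y f => f); reflexivity.
Defined.

Definition comp_functor (A B D : category) (F : functor A B) (G : functor B D) :
  functor A D.
Proof.
exists (fun x => G (F x)) (fun x y f => fmap G (fmap F f)).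
- intros x; now rewrite !fmap_id.
- intros x y z f g; now rewrite !fmap_comp.
Defined.

Definition prod_category (A B : category) : category.
Proof.
exists (A * B)%type
  (fun p q => ((fst p ⟶ fst q) * (snd p ⟶ snd q))%type)
  (fun p => (cid (fst p), cid (snd p)))
  (fun p q r f g => (fst f ⨟ fst g, snd f ⨟ snd g)).
- intros p q [f g]; simpl; now rewrite !cid_l.
- intros p q [f g]; simpl; now rewrite !cid_r.
- intros p q r s f g h; simpl; now rewrite !ccompA.
Defined.

Record iso (A : category) (x y : A) := Iso {
  iso_hom :> x ⟶ y;
  iso_inv : y ⟶ x;
  iso_hom_inv : iso_hom ⨟ iso_inv = cid x;
  iso_inv_hom : iso_inv ⨟ iso_hom = cid y
}.

Definition is_iso (A : category) (x y : A) (f : x ⟶ y) : Prop :=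
  exists g : y ⟶ x, f ⨟ g = cid x /\ g ⨟ f = cid y.

Definition naturally_isomorphic (A B : category) (F G : functor A B) : Prop :=
  exists t : forall x : A, iso (F x) (G x),
    forall (x y : A) (f : x ⟶ y), fmap F f ⨟ t y = t x ⨟ fmap G f.

Definition is_equivalence (A B : category) (F : functor A B) : Prop :=
  exists G : functor B A,
    naturally_isomorphic (comp_functor F G) (id_functor A) /\
    naturally_isomorphic (comp_functor G F) (id_functor B).

Definition tens_ob (A : category) (T : functor (prod_category A A) A) (x y : A) : A :=
  T (x, y).

Definition tens_hom (A : category) (T : functor (prod_category A A) A)
    (x x' y y' : A) (f : x ⟶ x') (g : y ⟶ y') : tens_ob T x y ⟶ tens_ob T x' y' :=
  @fmap _ _ T (x, y) (x', y') (f, g).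

Record monoidal_category := MonoidalCategory {
  mcat :> category;
  mtens : functor (prod_category mcat mcat) mcat;
  munit : mcat;
  massoc : forall x y z : mcat,
    iso (tens_ob mtens (tens_ob mtens x y) z) (tens_ob mtens x (tens_ob mtens y z));
  mlunit : forall x : mcat, iso (tens_ob mtens munit x) x;
  mrunit : forall x : mcat, iso (tens_ob mtens x munit) x;
  massoc_natural : forall x x' y y' z z' (f : x ⟶ x') (g : y ⟶ y') (h : z ⟶ z'),
    tens_hom mtens (tens_hom mtens f g) h ⨟ massoc x' y' z' =
    massoc x y z ⨟ tens_hom mtens f (tens_hom mtens g h);
  mlunit_natural : forall x x' (f : x ⟶ x'),
    tens_hom mtens (cid munit) f ⨟ mlunit x' = mlunit x ⨟ f;
  mrunit_natural : forall x x' (f : x ⟶ x'),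
    tens_hom mtens f (cid munit) ⨟ mrunit x' = mrunit x ⨟ f;
  mpentagon : forall x y z t,
    massoc (tens_ob mtens x y) z t ⨟ massoc x y (tens_ob mtens z t) =
    tens_hom mtens (massoc x y z) (cid t) ⨟ massoc x (tens_ob mtens y z) t
      ⨟ tens_hom mtens (cid x) (massoc y z t);
  mtriangle : forall x y,
    massoc x munit y ⨟ tens_hom mtens (cid x) (mlunit y) =
    tens_hom mtens (mrunit x) (cid y)
}.

Notation "x ⊗ y" := (tens_ob (mtens _) x y) (at level 40, left associativity).
Notation "f ⊠ g" := (tens_hom (mtens _) f g) (at level 40, left associativity).

Record is_braiding (M : monoidal_category) (c : forall x y : M, x ⊗ y ⟶ y ⊗ x) : Prop :=
  IsBraiding {
  braiding_iso : forall x y, is_iso (c x y);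
  braiding_natural : forall x x' y y' (f : x ⟶ x') (g : y ⟶ y'),
    (f ⊠ g) ⨟ c x' y' = c x y ⨟ (g ⊠ f);
  braiding_hexagon1 : forall x y z,
    massoc x y z ⨟ c x (y ⊗ z) ⨟ massoc y z x =
    (c x y ⊠ cid z) ⨟ massoc y x z ⨟ (cid y ⊠ c x z);
  braiding_hexagon2 : forall x y z,
    iso_inv (massoc x y z) ⨟ c (x ⊗ y) z ⨟ iso_inv (massoc z x y) =
    (cid x ⊠ c y z) ⨟ iso_inv (massoc x z y) ⨟ (c x z ⊠ cid y)
}.

Record braided_monoidal_category := BraidedMonoidalCategory {
  bmon :> monoidal_category;
  braid : forall x y : bmon, x ⊗ y ⟶ y ⊗ x;
  braidP : is_braiding braid
}.

Record monoidal_functor (M N : monoidal_category) := MonoidalFunctor {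
  mfun :> functor M N;
  mu : forall x y : M, iso (mfun x ⊗ mfun y) (mfun (x ⊗ y));
  eps : iso (munit N) (mfun (munit M));
  mu_natural : forall x x' y y' (f : x ⟶ x') (g : y ⟶ y'),
    (fmap mfun f ⊠ fmap mfun g) ⨟ mu x' y' = mu x y ⨟ fmap mfun (f ⊠ g);
  mu_assoc : forall x y z,
    (mu x y ⊠ cid (mfun z)) ⨟ mu (x ⊗ y) z ⨟ fmap mfun (massoc x y z) =
    massoc (mfun x) (mfun y) (mfun z) ⨟ (cid (mfun x) ⊠ mu y z) ⨟ mu x (y ⊗ z);
  mu_lunit : forall x,
    (eps ⊠ cid (mfun x)) ⨟ mu (munit M) x ⨟ fmap mfun (mlunit x) = mlunit (mfun x);
  mu_runit : forall x,
    (cid (mfun x) ⊠ eps) ⨟ mu x (munit M) ⨟ fmap mfun (mrunit x) = mrunit (mfun x)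
}.

Definition is_braided_functor (A B : braided_monoidal_category)
    (F : monoidal_functor A B) : Prop :=
  forall x y : A, mu F x y ⨟ fmap F (braid x y) = braid (F x) (F y) ⨟ mu F y x.

Definition braided_equivalent (A B : braided_monoidal_category) : Prop :=
  exists F : monoidal_functor A B, is_braided_functor F /\ is_equivalence F.

(** Since the tensor product below is associative on the nose, objects, arrows
    and 2-cells are not indexed by their boundaries: they form three types
    related by source and target functions, so that two strictly equal
    composites of arrows or 2-cells can be compared without any transport.
    Compositions are total functions, about which nothing is assumed outside
    composable pairs; the values there are junk, and no definition below uses
    them. *)

Reserved Notation "f # g" (at level 40, left associativity).
Reserved Notation "a ## b" (at level 40, left associativity).
Reserved Notation "a ;; b" (at level 60, right associativity).

Record two_category := TwoCategory {
  obj : Type;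
  arr : Type;
  cel : Type;
  src : arr -> obj;
  tgt : arr -> obj;
  dom : cel -> arr;
  cod : cel -> arr;
  src_dom : forall a, src (dom a) = src (cod a);
  tgt_dom : forall a, tgt (dom a) = tgt (cod a);
  id1 : obj -> arr;
  comp : arr -> arr -> arr where "f # g" := (comp f g);
  id2 : arr -> cel;
  vcomp : cel -> cel -> cel where "a ;; b" := (vcomp a b);
  hcomp : cel -> cel -> cel where "a ## b" := (hcomp a b);
  src_id1 : forall X, src (id1 X) = X;
  tgt_id1 : forall X, tgt (id1 X) = X;
  src_comp : forall f g, tgt f = src g -> src (f # g) = src f;
  tgt_comp : forall f g, tgt f = src g -> tgt (f # g) = tgt g;
  comp_id_l : forall f, id1 (src f) # f = f;
  comp_id_r : forall f, f # id1 (tgt f) = f;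
  compA : forall f g h, tgt f = src g -> tgt g = src h -> f # (g # h) = f # g # h;
  dom_id2 : forall f, dom (id2 f) = f;
  cod_id2 : forall f, cod (id2 f) = f;
  dom_vcomp : forall a b, cod a = dom b -> dom (a ;; b) = dom a;
  cod_vcomp : forall a b, cod a = dom b -> cod (a ;; b) = cod b;
  vcomp_id_l : forall a, id2 (dom a) ;; a = a;
  vcomp_id_r : forall a, a ;; id2 (cod a) = a;
  vcompA : forall a b c, cod a = dom b -> cod b = dom c ->
    a ;; (b ;; c) = (a ;; b) ;; c;
  dom_hcomp : forall a b, tgt (dom a) = src (dom b) -> dom (a ## b) = dom a # dom b;
  cod_hcomp : forall a b, tgt (dom a) = src (dom b) -> cod (a ## b) = cod a # cod b;
  hcomp_id_l : forall a, id2 (id1 (src (dom a))) ## a = a;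
  hcomp_id_r : forall a, a ## id2 (id1 (tgt (dom a))) = a;
  hcompA : forall a b c, tgt (dom a) = src (dom b) -> tgt (dom b) = src (dom c) ->
    a ## (b ## c) = a ## b ## c;
  hcomp_id2 : forall f g, tgt f = src g -> id2 f ## id2 g = id2 (f # g);
  interchange : forall a a' b b',
    cod a = dom a' -> cod b = dom b' -> tgt (dom a) = src (dom b) ->
    (a ;; a') ## (b ;; b') = (a ## b) ;; (a' ## b')
}.

Arguments id1 {_} X.
Notation "f # g" := (comp f g).
Notation "a ;; b" := (vcomp a b).
Notation "a ## b" := (hcomp a b).
Notation "f <| a" := (hcomp (id2 f) a) (at level 40, left associativity).
Notation "a |> f" := (hcomp a (id2 f)) (at level 40, left associativity).

Definition is_arrow (C : two_category) (f : arr C) (X Y : obj C) : Prop :=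
  src f = X /\ tgt f = Y.

Definition is_cell (C : two_category) (a : cel C) (f g : arr C) : Prop :=
  dom a = f /\ cod a = g.

Definition inverse_cells (C : two_category) (a a' : cel C) : Prop :=
  is_cell a' (cod a) (dom a) /\ a ;; a' = id2 (dom a) /\ a' ;; a = id2 (cod a).

Definition invertible_cell (C : two_category) (a : cel C) : Prop :=
  exists a', inverse_cells a a'.

Definition equi_arrow (C : two_category) (f : arr C) : Prop :=
  exists g : arr C, is_arrow g (tgt f) (src f) /\
    (exists a, is_cell a (f # g) (id1 (src f)) /\ invertible_cell a) /\
    (exists b, is_cell b (g # f) (id1 (tgt f)) /\ invertible_cell b).

Lemma is_arrow_id1 (C : two_category) (X : obj C) : is_arrow (id1 X) X X.
Proof. exact (conj (src_id1 X) (tgt_id1 X)). Qed.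

Lemma is_arrow_comp (C : two_category) (X Y Z : obj C) (f g : arr C) :
  is_arrow f X Y -> is_arrow g Y Z -> is_arrow (f # g) X Z.
Proof.
intros [Hf Hf'] [Hg Hg']; split; [rewrite src_comp | rewrite tgt_comp]; congruence.
Qed.

Lemma is_cell_id2 (C : two_category) (f : arr C) : is_cell (id2 f) f f.
Proof. exact (conj (dom_id2 f) (cod_id2 f)). Qed.

Lemma is_cell_vcomp (C : two_category) (f g h : arr C) (a b : cel C) :
  is_cell a f g -> is_cell b g h -> is_cell (a ;; b) f h.
Proof.
intros [Ha Ha'] [Hb Hb']; split; [rewrite dom_vcomp | rewrite cod_vcomp]; congruence.
Qed.

Lemma is_cell_hcomp (C : two_category) (f g f' g' : arr C) (a b : cel C) :
  is_cell a f f' -> is_cell b g g' -> tgt f = src g -> is_cell (a ## b) (f # g) (f' # g').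
Proof.
intros [Ha Ha'] [Hb Hb'] e; split; [rewrite dom_hcomp | rewrite cod_hcomp]; congruence.
Qed.

Definition hom_category (C : two_category) (X Y : obj C) : category.
Proof.
refine (@Category {f : arr C | is_arrow f X Y}
  (fun f g => {a : cel C | is_cell a (proj1_sig f) (proj1_sig g)})
  (fun f => exist _ (id2 (proj1_sig f)) (is_cell_id2 _))
  (fun f g h a b => exist _ (proj1_sig a ;; proj1_sig b)
     (is_cell_vcomp (proj2_sig a) (proj2_sig b))) _ _ _).
- intros f g [a [Ha Ha']]; apply sig_ext; simpl; rewrite <- Ha; apply vcomp_id_l.
- intros f g [a [Ha Ha']]; apply sig_ext; simpl; rewrite <- Ha'; apply vcomp_id_r.
- intros f g h k [a [Ha Ha']] [b [Hb Hb']] [c [Hc Hc']]; apply sig_ext; simpl.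
  apply vcompA; congruence.
Defined.

Record two_functor (C D : two_category) := TwoFunctor {
  fun0 :> obj C -> obj D;
  fun1 : arr C -> arr D;
  fun2 : cel C -> cel D;
  fun_src : forall f, src (fun1 f) = fun0 (src f);
  fun_tgt : forall f, tgt (fun1 f) = fun0 (tgt f);
  fun_dom : forall a, dom (fun2 a) = fun1 (dom a);
  fun_cod : forall a, cod (fun2 a) = fun1 (cod a);
  fun_id1 : forall X, fun1 (id1 X) = id1 (fun0 X);
  fun_comp : forall f g, tgt f = src g -> fun1 (f # g) = fun1 f # fun1 g;
  fun_id2 : forall f, fun2 (id2 f) = id2 (fun1 f);
  fun_vcomp : forall a b, cod a = dom b -> fun2 (a ;; b) = fun2 a ;; fun2 b;
  fun_hcomp : forall a b, tgt (dom a) = src (dom b) -> fun2 (a ## b) = fun2 a ## fun2 b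
}.

Lemma is_arrow_fun (C D : two_category) (F : two_functor C D) (X Y : obj C) (f : arr C) :
  is_arrow f X Y -> is_arrow (fun1 F f) (F X) (F Y).
Proof. intros [Hf Hf']; split; [rewrite fun_src | rewrite fun_tgt]; congruence. Qed.

Lemma is_cell_fun (C D : two_category) (F : two_functor C D) (f g : arr C) (a : cel C) :
  is_cell a f g -> is_cell (fun2 F a) (fun1 F f) (fun1 F g).
Proof. intros [Ha Ha']; split; [rewrite fun_dom | rewrite fun_cod]; congruence. Qed.

Definition hom_functor (C D : two_category) (F : two_functor C D) (X Y : obj C) :
  functor (hom_category X Y) (hom_category (F X) (F Y)).
Proof.
refine (@Functor (hom_category X Y) (hom_category (F X) (F Y))
  (fun f => exist _ (fun1 F (proj1_sig f)) (is_arrow_fun F (proj2_sig f)))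
  (fun f g a => exist _ (fun2 F (proj1_sig a)) (is_cell_fun F (proj2_sig a))) _ _).
- intros f; apply sig_ext; apply fun_id2.
- intros f g h [a [Ha Ha']] [b [Hb Hb']]; apply sig_ext; simpl.
  apply fun_vcomp; congruence.
Defined.

Definition is_two_equivalence (C D : two_category) (F : two_functor C D) : Prop :=
  (forall Y : obj D, exists (X : obj C) (e : arr D), is_arrow e (F X) Y /\ equi_arrow e) /\
  (forall X Y : obj C, is_equivalence (hom_functor F X Y)).

Definition prod_two_category (C D : two_category) : two_category.
Proof.
refine (@TwoCategory (obj C * obj D) (arr C * arr D) (cel C * cel D)
  (fun f => (src (fst f), src (snd f))) (fun f => (tgt (fst f), tgt (snd f)))
  (fun a => (dom (fst a), dom (snd a))) (fun a => (cod (fst a), cod (snd a)))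
  _ _
  (fun X => (id1 (fst X), id1 (snd X)))
  (fun f g => (fst f # fst g, snd f # snd g))
  (fun f => (id2 (fst f), id2 (snd f)))
  (fun a b => (fst a ;; fst b, snd a ;; snd b))
  (fun a b => (fst a ## fst b, snd a ## snd b))
  _ _ _ _ _ _ _ _ _ _ _ _ _ _ _ _ _ _ _ _ _);
repeat (intros [? ?]); simpl; intros;
repeat match goal with H : (_, _) = (_, _) |- _ => injection H; clear H; intros end;
f_equal;
auto using src_dom, tgt_dom, src_id1, tgt_id1, src_comp, tgt_comp, comp_id_l,
  comp_id_r, compA, dom_id2, cod_id2, dom_vcomp, cod_vcomp, vcomp_id_l, vcomp_id_r,
  vcompA, dom_hcomp, cod_hcomp, hcomp_id_l, hcomp_id_r, hcompA, hcomp_id2, interchange.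
Defined.

(** Strict associativity is the equality of the two strict 2-functors
    [C × C × C -> C], expressed on objects, arrows and 2-cells. *)
Record semimonoidal_two_category := SemimonoidalTwoCategory {
  stwo :> two_category;
  stens : two_functor (prod_two_category stwo stwo) stwo;
  stens0A : forall X Y Z, stens (stens (X, Y), Z) = stens (X, stens (Y, Z));
  stens1A : forall f g h,
    fun1 stens (fun1 stens (f, g), h) = fun1 stens (f, fun1 stens (g, h));
  stens2A : forall a b c,
    fun2 stens (fun2 stens (a, b), c) = fun2 stens (a, fun2 stens (b, c))
}.

Notation "X ⊗₀ Y" := (fun0 (stens _) (X, Y)) (at level 35, right associativity).
Notation "f ⊗₁ g" := (fun1 (stens _) (f, g)) (at level 35, right associativity).
Notation "a ⊗₂ b" := (fun2 (stens _) (a, b)) (at level 35, right associativity).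

(** [Iu] and [uI], for an arrow or a 2-cell [u]. *)
Notation "X ⋉₁ f" := (fun1 (stens _) (id1 X, f)) (at level 35, right associativity).
Notation "f ⋊₁ X" := (fun1 (stens _) (f, id1 X)) (at level 35, right associativity).
Notation "X ⋉₂ a" := (fun2 (stens _) (id2 (id1 X), a)) (at level 35, right associativity).
Notation "a ⋊₂ X" := (fun2 (stens _) (a, id2 (id1 X))) (at level 35, right associativity).

Lemma id1_comp (C : two_category) (X : obj C) : id1 X # id1 X = id1 X.
Proof. now rewrite <- (src_id1 X) at 1; rewrite comp_id_l. Qed.

Lemma id2_vcomp (C : two_category) (f : arr C) : id2 f ;; id2 f = id2 f.
Proof. now rewrite <- (dom_id2 f) at 1; rewrite vcomp_id_l. Qed.

Lemma id2_hcomp (C : two_category) (X : obj C) :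
  id2 (id1 X) ## id2 (id1 X) = id2 (id1 X).
Proof. rewrite hcomp_id2, id1_comp; trivial; now rewrite src_id1, tgt_id1. Qed.

Definition left_tensor (C : semimonoidal_two_category) (I : obj C) : two_functor C C.
Proof.
refine (@TwoFunctor C C (fun X => I ⊗₀ X) (fun f => I ⋉₁ f) (fun a => I ⋉₂ a)
  _ _ _ _ _ _ _ _ _).
- intros f; rewrite fun_src; simpl; now rewrite src_id1.
- intros f; rewrite fun_tgt; simpl; now rewrite tgt_id1.
- intros a; rewrite fun_dom; simpl; now rewrite dom_id2.
- intros a; rewrite fun_cod; simpl; now rewrite cod_id2.
- intros X; exact (fun_id1 (stens C) (I, X)).
- intros f g e; rewrite <- (fun_comp (stens C)); simpl.
  + now rewrite id1_comp.
  + now rewrite src_id1, tgt_id1, e.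
- intros f; exact (fun_id2 (stens C) (id1 I, f)).
- intros a b e; rewrite <- (fun_vcomp (stens C)); simpl.
  + now rewrite id2_vcomp.
  + now rewrite dom_id2, cod_id2, e.
- intros a b e; rewrite <- (fun_hcomp (stens C)); simpl.
  + now rewrite id2_hcomp.
  + now rewrite dom_id2, src_id1, tgt_id1, e.
Defined.

Definition right_tensor (C : semimonoidal_two_category) (I : obj C) : two_functor C C.
Proof.
refine (@TwoFunctor C C (fun X => X ⊗₀ I) (fun f => f ⋊₁ I) (fun a => a ⋊₂ I)
  _ _ _ _ _ _ _ _ _).
- intros f; rewrite fun_src; simpl; now rewrite src_id1.
- intros f; rewrite fun_tgt; simpl; now rewrite tgt_id1.
- intros a; rewrite fun_dom; simpl; now rewrite dom_id2.
- intros a; rewrite fun_cod; simpl; now rewrite cod_id2.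
- intros X; exact (fun_id1 (stens C) (X, I)).
- intros f g e; rewrite <- (fun_comp (stens C)); simpl.
  + now rewrite id1_comp.
  + now rewrite src_id1, tgt_id1, e.
- intros f; exact (fun_id2 (stens C) (f, id1 I)).
- intros a b e; rewrite <- (fun_vcomp (stens C)); simpl.
  + now rewrite id2_vcomp.
  + now rewrite dom_id2, cod_id2, e.
- intros a b e; rewrite <- (fun_hcomp (stens C)); simpl.
  + now rewrite id2_hcomp.
  + now rewrite dom_id2, src_id1, tgt_id1, e.
Defined.

Definition weak_unit (C : semimonoidal_two_category) (I : obj C) (alpha : arr C) : Prop :=
  is_two_equivalence (left_tensor I) /\
  is_two_equivalence (right_tensor I) /\
  is_arrow alpha (I ⊗₀ I) I /\ equi_arrow alpha.

Lemma end_composable (C : two_category) (I : obj C) (f g : hom_category I I) :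
  tgt (proj1_sig f) = src (proj1_sig g).
Proof. exact (eq_trans (proj2 (proj2_sig f)) (eq_sym (proj1 (proj2_sig g)))). Qed.

(** The tensor product of [End(I)]: composition of arrows, horizontal
    composition of 2-cells. *)
Definition end_comp (C : two_category) (I : obj C) :
  functor (prod_category (hom_category I I) (hom_category I I)) (hom_category I I).
Proof.
refine (@Functor (prod_category (hom_category I I) (hom_category I I))
  (hom_category I I)
  (fun p => exist _ (proj1_sig (fst p) # proj1_sig (snd p))
     (is_arrow_comp (proj2_sig (fst p)) (proj2_sig (snd p))))
  (fun p q a => exist _ (proj1_sig (fst a) ## proj1_sig (snd a))
     (is_cell_hcomp (proj2_sig (fst a)) (proj2_sig (snd a)) (end_composable _ _))) _ _).
- intros [f g]; apply sig_ext; simpl; apply hcomp_id2, end_composable.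
- intros [f f'] [g g'] [h h'] [[a [Ha Ha']] [b [Hb Hb']]] [[c [Hc Hc']] [d [Hd Hd']]].
  apply sig_ext; simpl in *; apply interchange; try congruence.
  rewrite Ha, Hb; apply end_composable.
Defined.

Definition end_unit (C : two_category) (I : obj C) : hom_category I I :=
  exist _ (id1 I) (is_arrow_id1 I).

Lemma is_cell_eq (C : two_category) (f g : arr C) : f = g -> is_cell (id2 f) f g.
Proof. intros e; destruct e; apply is_cell_id2. Qed.

(** Two objects of a hom category with the same underlying arrow are isomorphic
    by the identity 2-cell of that arrow. *)
Definition identity_iso (C : two_category) (X Y : obj C) (f g : hom_category X Y)
    (e : proj1_sig f = proj1_sig g) : iso f g.
Proof.
refine (@Iso (hom_category X Y) f g
  (exist _ (id2 (proj1_sig f)) (is_cell_eq e))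
  (exist _ (id2 (proj1_sig g)) (is_cell_eq (eq_sym e))) _ _).
- apply sig_ext; simpl; rewrite <- e; apply id2_vcomp.
- apply sig_ext; simpl; rewrite e; apply id2_vcomp.
Defined.

Lemma end_compA (C : two_category) (I : obj C) (f g h : hom_category I I) :
  proj1_sig (end_comp I (end_comp I (f, g), h)) =
  proj1_sig (end_comp I (f, end_comp I (g, h))).
Proof. simpl; symmetry; apply compA; apply end_composable. Qed.

Lemma end_comp_id_l (C : two_category) (I : obj C) (f : hom_category I I) :
  proj1_sig (end_comp I (end_unit I, f)) = proj1_sig f.
Proof. destruct f as [f [Hf Hf']]; simpl; rewrite <- Hf at 1; apply comp_id_l. Qed.

Lemma end_comp_id_r (C : two_category) (I : obj C) (f : hom_category I I) :
  proj1_sig (end_comp I (f, end_unit I)) = proj1_sig f.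
Proof. destruct f as [f [Hf Hf']]; simpl; rewrite <- Hf' at 1; apply comp_id_r. Qed.

Lemma identity_iso_natural (C : two_category) (X Y : obj C)
    (f f' g g' : hom_category X Y) (a : f ⟶ f') (b : g ⟶ g')
    (e : proj1_sig f = proj1_sig g) (e' : proj1_sig f' = proj1_sig g') :
  proj1_sig a = proj1_sig b -> a ⨟ identity_iso e' = identity_iso e ⨟ b.
Proof.
intros eab; apply sig_ext.
transitivity (proj1_sig a).
- destruct a as [a [Ha Ha']]; simpl; rewrite <- Ha'; apply vcomp_id_r.
- rewrite eab; simpl; rewrite e; destruct b as [b [Hb Hb']]; simpl.
  rewrite <- Hb; symmetry; apply vcomp_id_l.
Qed.

Lemma end_hcomp_id2 (C : two_category) (I : obj C) (f g : hom_category I I) :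
  id2 (proj1_sig f) ## id2 (proj1_sig g) = id2 (proj1_sig f # proj1_sig g).
Proof. apply hcomp_id2, end_composable. Qed.

Definition end_monoidal (C : two_category) (I : obj C) : monoidal_category.
Proof.
refine (@MonoidalCategory (hom_category I I) (end_comp I) (end_unit I)
  (fun f g h => identity_iso (end_compA f g h))
  (fun f => identity_iso (end_comp_id_l f)) (fun f => identity_iso (end_comp_id_r f))
  _ _ _ _ _).
- intros f f' g g' h h' a b c; apply identity_iso_natural.
  simpl; symmetry; apply hcompA.
  + rewrite (proj1 (proj2_sig a)), (proj1 (proj2_sig b)); apply end_composable.
  + rewrite (proj1 (proj2_sig b)), (proj1 (proj2_sig c)); apply end_composable.
- intros f f' a; apply identity_iso_natural; simpl.
  rewrite <- (hcomp_id_l (proj1_sig a)) at 2.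
  now rewrite (proj1 (proj2_sig a)), (proj1 (proj2_sig f)).
- intros f f' a; apply identity_iso_natural; simpl.
  rewrite <- (hcomp_id_r (proj1_sig a)) at 2.
  now rewrite (proj1 (proj2_sig a)), (proj2 (proj2_sig f)).
- intros f g h k; apply sig_ext; simpl.
  pose proof (end_compA f g h) as e1; pose proof (end_compA g h k) as e2.
  pose proof (end_compA f (end_comp I (g, h)) k) as e4.
  pose proof (end_compA f g (end_comp I (h, k))) as e5.
  pose proof (end_hcomp_id2 (end_comp I (end_comp I (f, g), h)) k) as E1.
  pose proof (end_hcomp_id2 f (end_comp I (end_comp I (g, h), k))) as E2.
  simpl in *; rewrite E1, E2, e1, e4, e2, e5, !id2_vcomp; reflexivity.
- intros f g; apply sig_ext; simpl.
  pose proof (end_compA f (end_unit I) g) as e1.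
  pose proof (end_comp_id_l g) as e2.
  pose proof (end_hcomp_id2 f (end_comp I (end_unit I, g))) as E1.
  pose proof (end_hcomp_id2 (end_comp I (f, end_unit I)) g) as E2.
  simpl in *; rewrite E1, E2, e1, e2, id2_vcomp; reflexivity.
Defined.

(** The choices entering the construction of the braiding, together with the
    2-cells [A] and [B] that they determine.  A suffix [i] denotes the inverse
    of a 2-cell.  The right adjoint quasi-inverse [β] comes with a unit
    [η : id ⇒ α # β] and a counit [E : β # α ⇒ id]. *)
Record unit_choices (C : semimonoidal_two_category) (I : obj C) (alpha : arr C) :=
  UnitChoices {
  uc_lam : arr C;
  uc_lam_arrow : is_arrow uc_lam (I ⊗₀ I) I;
  uc_l : cel C;
  uc_li : cel C;
  uc_l_cell : is_cell uc_l (I ⋉₁ uc_lam) (alpha ⋊₁ I);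
  uc_l_inv : inverse_cells uc_l uc_li;
  uc_rho : arr C;
  uc_rho_arrow : is_arrow uc_rho (I ⊗₀ I) I;
  uc_r : cel C;
  uc_ri : cel C;
  uc_r_cell : is_cell uc_r (I ⋉₁ alpha) (uc_rho ⋊₁ I);
  uc_r_inv : inverse_cells uc_r uc_ri;
  uc_A : cel C;
  uc_Ai : cel C;
  uc_A_cell : is_cell uc_A (I ⋉₁ alpha) (alpha ⋊₁ I);
  uc_A_inv : inverse_cells uc_A uc_Ai;
  uc_A_eq : (I ⋉₁ (alpha ⋊₁ I)) <| uc_A =
    ((I ⋉₂ uc_li) ## uc_r) ;; ((uc_ri ⋊₂ I) ## uc_l);
  uc_beta : arr C;
  uc_beta_arrow : is_arrow uc_beta I (I ⊗₀ I);
  uc_eta : cel C;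
  uc_eta_cell : is_cell uc_eta (id1 (I ⊗₀ I)) (alpha # uc_beta);
  uc_eta_invertible : invertible_cell uc_eta;
  uc_E : cel C;
  uc_Ei : cel C;
  uc_E_cell : is_cell uc_E (uc_beta # alpha) (id1 I);
  uc_E_inv : inverse_cells uc_E uc_Ei;
  uc_triangle_alpha : (uc_eta |> alpha) ;; (alpha <| uc_E) = id2 alpha;
  uc_triangle_beta : (uc_beta <| uc_eta) ;; (uc_E |> uc_beta) = id2 uc_beta;
  uc_B : cel C;
  uc_Bi : cel C;
  uc_B_cell : is_cell uc_B (uc_beta ⋊₁ I) (I ⋉₁ uc_beta);
  uc_B_inv : inverse_cells uc_B uc_Bi;
  uc_B_eq : (uc_B |> (I ⋉₁ alpha)) ;; (I ⋉₂ uc_E) =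
    ((uc_beta ⋊₁ I) <| uc_A) ;; (uc_E ⋊₂ I)
}.

Definition is_L (C : semimonoidal_two_category) (I : obj C) (alpha : arr C)
    (D : unit_choices I alpha) (f : arr C) (L : cel C) : Prop :=
  is_cell L ((I ⋉₁ f) # alpha) (alpha # f) /\ invertible_cell L /\
  I ⋉₂ L = ((I ⋉₁ (I ⋉₁ f)) <| uc_A D) ;; (uc_Ai D |> (I ⋉₁ f)).

Definition is_R (C : semimonoidal_two_category) (I : obj C) (alpha : arr C)
    (D : unit_choices I alpha) (f : arr C) (R : cel C) : Prop :=
  is_cell R ((f ⋊₁ I) # alpha) (alpha # f) /\ invertible_cell R /\
  R ⋊₂ I = (((f ⋊₁ I) ⋊₁ I) <| uc_Ai D) ;; (uc_A D |> (f ⋊₁ I)).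

Definition is_Lbar (C : semimonoidal_two_category) (I : obj C) (alpha : arr C)
    (D : unit_choices I alpha) (f : arr C) (L : cel C) : Prop :=
  is_cell L (uc_beta D # (I ⋉₁ f)) (f # uc_beta D) /\ invertible_cell L /\
  I ⋉₂ L = (uc_Bi D |> (I ⋉₁ (I ⋉₁ f))) ;; ((I ⋉₁ f) <| uc_B D).

Definition is_Rbar (C : semimonoidal_two_category) (I : obj C) (alpha : arr C)
    (D : unit_choices I alpha) (f : arr C) (R : cel C) : Prop :=
  is_cell R (uc_beta D # (f ⋊₁ I)) (f # uc_beta D) /\ invertible_cell R /\
  R ⋊₂ I = (uc_B D |> ((f ⋊₁ I) ⋊₁ I)) ;; ((f ⋊₁ I) <| uc_Bi D).

(** [t : f # g ⇒ g # f] is the composite [T f g], for some choice of the data.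
    The identifications [f # id # g = f # g] and [If # gI = gI # If] needed to
    compose its factors are strict equalities of arrows. *)
Definition is_T (C : semimonoidal_two_category) (I : obj C) (alpha f g : arr C)
    (t : cel C) : Prop :=
  exists (D : unit_choices I alpha) (L R Ri Lbar Lbari Rbar : cel C),
    is_L D f L /\
    is_R D g R /\ inverse_cells R Ri /\
    is_Lbar D f Lbar /\ inverse_cells Lbar Lbari /\
    is_Rbar D g Rbar /\
    t = ((f <| uc_Ei D) |> g) ;;
        (Lbari |> (alpha # g)) ;;
        ((uc_beta D # (I ⋉₁ f)) <| Ri) ;;
        (Rbar |> ((I ⋉₁ f) # alpha)) ;;
        ((g # uc_beta D) <| L) ;;
        ((g <| uc_E D) |> f).

(** [T] is the family of the 2-cells [T f g].  The equivalence says that the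
    construction can be carried out for all [f] and [g] (from right to left) and
    that its result does not depend on the choices (from left to right). *)
Definition is_T_family (C : semimonoidal_two_category) (I : obj C) (alpha : arr C)
    (T : forall f g : end_monoidal I, f ⊗ g ⟶ g ⊗ f) : Prop :=
  forall (f g : hom_category I I) (t : cel C),
    is_T I alpha (proj1_sig f) (proj1_sig g) t <-> t = proj1_sig (T f g).

(* Main.v *)
From Stdlib Require Import List Arith Lia ClassicalEpsilon FunctionalExtensionality ProofIrrelevance.
Require Import Defs.
Set Implicit Arguments.
Unset Strict Implicit.
Unset Printing Implicit Defensive.

(** (i) The braiding [t = T f g] is the only 2-cell [f # g ⇒ g # f] for which moving
    first [g] and then [f] out of [If # gI = gI # If] across [α], followed by [t],
    agrees with moving first [f] and then [g]. Naturality and the hexagons follow,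
    since [L] and [R] are natural and compatible with composition and [α] is an
    equi-arrow; the part played by [β] disappears.

    (ii) Let [B] be made strict. The objects of the 2-category are numbers of
    strands, a state is a list of objects of [B] colouring the strands, and an
    arrow is a function between states together with isomorphisms identifying the
    total (product) of the image of a state [l] with the total of [l] times a fixed
    object, which is the value of the arrow. Juxtaposition of functions satisfies
    the interchange law on the nose; the braiding is recorded in the isomorphisms.
    The 2-cells are the morphisms between values, [α] multiplies two strands, and
    the value is an equivalence from the endomorphisms of one strand to [B]. *)


(** * Deciding equality of pasting composites *)

(** A composite of 2-cells is flattened to the list of its layers, each of them
    an atomic 2-cell whiskered on both sides by paths of arrows. Consecutive
    layers need not have literally the same path in between: it is enough that
    both paths compose to the same arrow, which leaves a proof obligation. *)

(** The obstacle in (ii) is that [⊗] must be a strict 2-functor, so that [(f # f') ⊗ (g # g')] and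
    [(f ⊗ g) # (f' ⊗ g')] are the same arrow. If arrows were objects of the braided category, with
    [#] and [⊗] both given by its product, these would be the words f f' g g' and f g f' g', related
    only by a braiding. Letting arrows act on states, in the manner of Cayley's theorem, makes the
    two composites one and the same function. The price is that the value of a composite is only
    isomorphic to the product of the values, and the braiding sits in that comparison. It comes back
    in the computation of [T]: an arrow [g] on the first strand has to pass a second strand already
    coloured by the value of [f]. This happens on the side of the equation that makes [T] the
    inverse of the braiding of [g] with [f]. In (i) the obstacle is that [T] is defined through [β]
    and many choices. The choices that change [A] differ by 2-cells that cancel in its defining
    equation, and [L] and [R] depend on [A] alone; the barred 2-cells are then eliminated because
    they are mates of [L] and [R] with respect to the counit. *)

Ltac bd :=
  repeat (first [ rewrite dom_id2 | rewrite cod_id2 | rewrite src_id1 | rewrite tgt_id1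
    | rewrite dom_hcomp by bd | rewrite cod_hcomp by bd
    | rewrite dom_vcomp by bd | rewrite cod_vcomp by bd
    | rewrite src_comp by bd | rewrite tgt_comp by bd ]); congruence.

Section Pasting.
Variable C : two_category.
Implicit Types (X Y Z : obj C) (p q d e : list (arr C)).

Fixpoint path_arr X p : arr C :=
  match p with nil => id1 X | f :: p => f # path_arr (tgt f) p end.

Fixpoint path_end X p : obj C :=
  match p with nil => X | f :: p => path_end (tgt f) p end.

Fixpoint path_wf X p : Prop :=
  match p with nil => True | f :: p => src f = X /\ path_wf (tgt f) p end.

Lemma path_end_app X p q : path_end X (p ++ q) = path_end (path_end X p) q.
Proof. revert X; induction p; simpl; auto. Qed.

Lemma path_wf_app X p q : path_wf X (p ++ q) <-> path_wf X p /\ path_wf (path_end X p) q.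
Proof. revert X; induction p as [|f p IH]; simpl; intros X; [|rewrite IH]; tauto. Qed.

Lemma path_arr_typed X p : path_wf X p -> is_arrow (path_arr X p) X (path_end X p).
Proof.
revert X; induction p as [|f p IH]; simpl; intros X; [intros _; apply is_arrow_id1|].
intros [e H]; apply is_arrow_comp with (tgt f); [now split | auto].
Qed.

Lemma src_path X p : path_wf X p -> src (path_arr X p) = X.
Proof. intros H; apply (path_arr_typed H). Qed.

Lemma tgt_path X p : path_wf X p -> tgt (path_arr X p) = path_end X p.
Proof. intros H; apply (path_arr_typed H). Qed.

Lemma path_arr_app X p q : path_wf X p -> path_wf (path_end X p) q ->
  path_arr X (p ++ q) = path_arr X p # path_arr (path_end X p) q.
Proof.
revert X; induction p as [|f p IH]; simpl; intros X.
- intros _ H; rewrite <- (src_path H) at 2; now rewrite comp_id_l.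
- intros [e H] H'; rewrite IH; trivial; apply compA; now rewrite src_path, ?tgt_path.
Qed.

Record layer := Layer {
  lay_pre : list (arr C); lay_cel : cel C;
  lay_dom : list (arr C); lay_cod : list (arr C); lay_post : list (arr C) }.

Definition layer_dom l := lay_pre l ++ lay_dom l ++ lay_post l.
Definition layer_cod l := lay_pre l ++ lay_cod l ++ lay_post l.

Definition layer_cel X l : cel C :=
  let Y := path_end X (lay_pre l) in
  (path_arr X (lay_pre l) <| lay_cel l) |> path_arr (path_end Y (lay_dom l)) (lay_post l).

Definition layer_wf X l : Prop :=
  let Y := path_end X (lay_pre l) in
  path_wf X (lay_pre l) /\ path_wf Y (lay_dom l) /\ path_wf Y (lay_cod l) /\
  is_cell (lay_cel l) (path_arr Y (lay_dom l)) (path_arr Y (lay_cod l)) /\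
  path_wf (path_end Y (lay_dom l)) (lay_post l).

Fixpoint last_path p (L : list layer) : list (arr C) :=
  match L with nil => p | l :: L => last_path (layer_cod l) L end.

Fixpoint layers_cel X p (L : list layer) : cel C :=
  match L with
  | nil => id2 (path_arr X p)
  | l :: L => layer_cel X l ;; layers_cel X (layer_cod l) L
  end.

Fixpoint layers_wf X p (L : list layer) : Prop :=
  match L with
  | nil => True
  | l :: L => path_arr X p = path_arr X (layer_dom l) /\ layer_wf X l /\
      layers_wf X (layer_cod l) L
  end.

Lemma layer_end X l : layer_wf X l ->
  path_end (path_end X (lay_pre l)) (lay_dom l) = path_end (path_end X (lay_pre l)) (lay_cod l).
Proof.
intros (_ & Hd & He & [Hc Hc'] & _).
rewrite <- (tgt_path Hd), <- (tgt_path He), <- Hc, <- Hc'; apply tgt_dom.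
Qed.

Lemma layer_dom_wf X l : layer_wf X l -> path_wf X (layer_dom l).
Proof. intros (H1 & H2 & H3 & H4 & H5); unfold layer_dom; now rewrite !path_wf_app. Qed.

Lemma layer_cod_wf X l : layer_wf X l -> path_wf X (layer_cod l).
Proof.
intros H; pose proof (layer_end H) as E; destruct H as (H1 & H2 & H3 & H4 & H5).
unfold layer_cod; now rewrite !path_wf_app, <- E.
Qed.

Lemma layer_cod_end X l : layer_wf X l ->
  path_end X (layer_cod l) = path_end X (layer_dom l).
Proof. intros H; unfold layer_cod, layer_dom; now rewrite !path_end_app, (layer_end H). Qed.

Lemma path_arr3 X p q r : path_wf X p -> path_wf (path_end X p) q ->
  path_wf (path_end (path_end X p) q) r ->
  path_arr X (p ++ q ++ r) =
  path_arr X p # path_arr (path_end X p) q # path_arr (path_end (path_end X p) q) r.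
Proof.
intros H1 H2 H3; rewrite path_arr_app, path_arr_app; trivial.
- apply compA; now rewrite ?src_path, ?tgt_path.
- now rewrite path_wf_app.
Qed.

Lemma layer_cel_typed X l : layer_wf X l ->
  is_cell (layer_cel X l) (path_arr X (layer_dom l)) (path_arr X (layer_cod l)).
Proof.
intros H; pose proof (layer_end H) as E; destruct H as (H1 & H2 & H3 & H4 & H5).
unfold layer_dom, layer_cod, layer_cel.
rewrite !path_arr3; trivial; [|now rewrite <- E]; rewrite <- E.
apply is_cell_hcomp; [apply is_cell_hcomp; trivial; [apply is_cell_id2|]|apply is_cell_id2|].
- now rewrite tgt_path, src_path.
- rewrite tgt_comp; now rewrite ?tgt_path, ?src_path.
Qed.

Lemma last_path_wf X p L : path_wf X p -> layers_wf X p L -> path_wf X (last_path p L).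
Proof.
revert p; induction L as [|l L IH]; simpl; trivial; intros p Hp (e & Hl & HL).
apply IH; trivial; now apply layer_cod_wf.
Qed.

Lemma last_path_end X p L : path_wf X p -> layers_wf X p L ->
  path_end X (last_path p L) = path_end X p.
Proof.
revert p; induction L as [|l L IH]; simpl; trivial; intros p Hp (e & Hl & HL).
rewrite IH; trivial; [|now apply layer_cod_wf].
rewrite layer_cod_end; trivial.
rewrite <- (tgt_path Hp), e, tgt_path; trivial; now apply layer_dom_wf.
Qed.

Lemma layers_cel_typed X p L : path_wf X p -> layers_wf X p L ->
  is_cell (layers_cel X p L) (path_arr X p) (path_arr X (last_path p L)).
Proof.
revert p; induction L as [|l L IH]; simpl; [intros; apply is_cell_id2|].
intros p Hp (e & Hl & HL); rewrite e; apply is_cell_vcomp with (path_arr X (layer_cod l)).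
- now apply layer_cel_typed.
- apply IH; trivial; now apply layer_cod_wf.
Qed.

(** Well-formedness and value see the starting path only through its composite. This is what allows
    two lists of layers to be joined along a strict equality of arrows. *)
Lemma layers_congr X p p' L : path_arr X p = path_arr X p' -> layers_wf X p L ->
  layers_wf X p' L /\ layers_cel X p L = layers_cel X p' L /\
  path_arr X (last_path p L) = path_arr X (last_path p' L).
Proof.
destruct L as [|l L]; simpl; intros e.
- now rewrite e.
- now rewrite e.
Qed.

Lemma layers_app_wf X p L L' :
  layers_wf X p (L ++ L') <-> layers_wf X p L /\ layers_wf X (last_path p L) L'.
Proof. revert p; induction L as [|l L IH]; simpl; intros p; [|rewrite IH]; tauto. Qed.

Lemma layers_cel_app X p L L' : path_wf X p ->
  layers_wf X p L -> layers_wf X (last_path p L) L' ->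
  layers_cel X p (L ++ L') = layers_cel X p L ;; layers_cel X (last_path p L) L'.
Proof.
revert p; induction L as [|l L IH]; simpl; intros p Hp.
- intros _ H; rewrite <- (proj1 (layers_cel_typed Hp H)); now rewrite vcomp_id_l.
- intros (e & Hl & HL) H; rewrite IH; trivial; [|now apply layer_cod_wf].
  pose proof (layer_cel_typed Hl) as [T1 T2].
  pose proof (layers_cel_typed (layer_cod_wf Hl) HL) as [T3 T4].
  pose proof (layers_cel_typed (last_path_wf (layer_cod_wf Hl) HL) H) as [T5 T6].
  apply vcompA; congruence.
Qed.

Definition layer_whisk p q l :=
  Layer (p ++ lay_pre l) (lay_cel l) (lay_dom l) (lay_cod l) (lay_post l ++ q).

Lemma layer_whisk_dom p q l : layer_dom (layer_whisk p q l) = p ++ layer_dom l ++ q.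
Proof. unfold layer_dom; simpl; now rewrite !app_assoc. Qed.

Lemma layer_whisk_cod p q l : layer_cod (layer_whisk p q l) = p ++ layer_cod l ++ q.
Proof. unfold layer_cod; simpl; now rewrite !app_assoc. Qed.

Lemma layer_whisk_wf X p q l : path_wf X p -> layer_wf (path_end X p) l ->
  path_wf (path_end (path_end X p) (layer_dom l)) q ->
  layer_wf X (layer_whisk p q l) /\
  layer_cel X (layer_whisk p q l) =
    (path_arr X p <| layer_cel (path_end X p) l)
      |> path_arr (path_end (path_end X p) (layer_dom l)) q.
Proof.
intros Hp (H1 & H2 & H3 & H4 & H5) Hq; unfold layer_dom in *.
rewrite !path_end_app in *; split.
- unfold layer_wf; simpl; now rewrite path_end_app, !path_wf_app.
- unfold layer_cel; simpl; rewrite !path_end_app, !path_arr_app; trivial.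
  assert (E1: src (dom (lay_cel l)) = path_end (path_end X p) (lay_pre l))
    by now rewrite (proj1 H4), src_path.
  assert (E2: tgt (dom (lay_cel l)) = path_end (path_end (path_end X p) (lay_pre l)) (lay_dom l))
    by now rewrite (proj1 H4), tgt_path.
  rewrite <- !hcomp_id2 by now rewrite ?src_path, ?tgt_path.
  assert (S1: tgt (path_arr X p) = path_end X p) by now apply tgt_path.
  assert (S2: src (path_arr (path_end X p) (lay_pre l)) = path_end X p) by now apply src_path.
  assert (S3: tgt (path_arr (path_end X p) (lay_pre l)) = path_end (path_end X p) (lay_pre l)) by now apply tgt_path.
  pose proof (src_path H5) as S4; pose proof (tgt_path H5) as S5; pose proof (src_path Hq) as S6.
  set (c := lay_cel l) in *; set (F := path_arr X p) in *.
  set (G := path_arr _ (lay_pre l)) in *; set (H := path_arr _ q) in *.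
  set (K := path_arr _ (lay_post l)) in *.
  rewrite <- (hcompA (a := id2 F) (b := id2 G) (c := c)) by bd.
  rewrite (hcompA (b := id2 K) (c := id2 H)) by bd.
  now rewrite <- (hcompA (a := id2 F) (b := id2 G ## c) (c := id2 K)) by bd.
Qed.

Lemma layers_whisk X p q r L : path_wf X p -> path_wf (path_end X p) r ->
  path_wf (path_end (path_end X p) r) q -> layers_wf (path_end X p) r L ->
  let L' := map (layer_whisk p q) L in
  layers_wf X (p ++ r ++ q) L' /\
  last_path (p ++ r ++ q) L' = p ++ last_path r L ++ q /\
  layers_cel X (p ++ r ++ q) L' =
    (path_arr X p <| layers_cel (path_end X p) r L)
      |> path_arr (path_end (path_end X p) r) q.
Proof.
simpl; intros Hp Hr Hq; revert r Hr Hq; induction L as [|l L IH]; simpl; intros r Hr Hq.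
- intros _; repeat split; rewrite path_arr3; trivial.
  rewrite !hcomp_id2; trivial; rewrite ?tgt_comp; now rewrite ?src_path, ?tgt_path.
- intros (e & Hl & HL).
  pose proof (layer_cod_wf Hl) as Wc; pose proof (layer_dom_wf Hl) as Wd.
  assert (Ed: path_end (path_end X p) (layer_dom l) = path_end (path_end X p) r).
  { now rewrite <- (tgt_path Hr), e, tgt_path. }
  assert (Ec := layer_cod_end Hl).
  destruct (IH (layer_cod l)) as (I1 & I2 & I3); trivial; [now rewrite Ec, Ed|].
  destruct (layer_whisk_wf (q := q) Hp Hl) as [J1 J2]; [now rewrite Ed|].
  rewrite layer_whisk_cod, I2, I3, J2, layer_whisk_dom, Ec, Ed.
  split; [split; [|now split]|split; trivial].
  + rewrite !path_arr3, e; trivial; [now rewrite Ed | now rewrite Ed].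
  + pose proof (layer_cel_typed Hl) as [T1 T2].
    pose proof (layers_cel_typed (layer_cod_wf Hl) HL) as [T3 T4].
    assert (P1 := tgt_path Hp). assert (P2 := src_path Hq).
    assert (P3 := src_path Wd). assert (P4 := tgt_path Wd).
    assert (P5 := src_path Wc). assert (P6 := tgt_path Wc).
    set (a := layer_cel _ l) in *; set (b := layers_cel _ _ L) in *.
    set (f := path_arr X p) in *; set (g := path_arr (path_end (path_end X p) r) q) in *.
    rewrite <- (id2_vcomp f) at 3; rewrite <- (id2_vcomp g) at 3.
    now rewrite !interchange by bd.
Qed.

(** * Reification of arrows and 2-cells *)

Inductive arr_expr := AAtom (f : arr C) | AId (X : obj C) | AComp (a b : arr_expr).

Fixpoint arr_eval a : arr C :=
  match a with AAtom f => f | AId X => id1 X | AComp a b => arr_eval a # arr_eval b end.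
Fixpoint arr_src a : obj C :=
  match a with AAtom f => src f | AId X => X | AComp a b => arr_src a end.
Fixpoint arr_flat a : list (arr C) :=
  match a with AAtom f => f :: nil | AId X => nil | AComp a b => arr_flat a ++ arr_flat b end.
Fixpoint arr_wf a : Prop :=
  match a with
  | AAtom f => True
  | AId X => True
  | AComp a b => arr_wf a /\ arr_wf b /\ path_end (arr_src a) (arr_flat a) = arr_src b
  end.

Lemma arr_flatP a : arr_wf a ->
  path_wf (arr_src a) (arr_flat a) /\ arr_eval a = path_arr (arr_src a) (arr_flat a).
Proof.
induction a as [f|X|a IHa b IHb]; simpl; auto.
- intros _; now rewrite comp_id_r.
- intros (Ha & Hb & e); destruct (IHa Ha) as [A1 A2], (IHb Hb) as [B1 B2].
  rewrite path_wf_app, path_arr_app, e; trivial; [|now rewrite e].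
  now rewrite A2, B2.
Qed.

Inductive cel_expr :=
| CAtom (c : cel C) (a b : arr_expr)
| CId (a : arr_expr)
| CV (x y : cel_expr)
| CH (x y : cel_expr).

Fixpoint cel_eval x : cel C :=
  match x with
  | CAtom c _ _ => c
  | CId a => id2 (arr_eval a)
  | CV x y => cel_eval x ;; cel_eval y
  | CH x y => cel_eval x ## cel_eval y
  end.
Fixpoint cel_src x : obj C :=
  match x with CAtom _ a _ => arr_src a | CId a => arr_src a | CV x _ | CH x _ => cel_src x end.
Fixpoint cel_path x : list (arr C) :=
  match x with
  | CAtom _ a _ => arr_flat a
  | CId a => arr_flat a
  | CV x _ => cel_path x
  | CH x y => cel_path x ++ cel_path y
  end.
(** Interchange allows several orders for [CH]. Here the left factor acts first, whiskered by the
    domain of the right one, which is then whiskered by the codomain of the left one. *)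
Fixpoint cel_layers x : list layer :=
  match x with
  | CAtom c a b => Layer nil c (arr_flat a) (arr_flat b) nil :: nil
  | CId _ => nil
  | CV x y => cel_layers x ++ cel_layers y
  | CH x y => map (layer_whisk nil (cel_path y)) (cel_layers x)
      ++ map (layer_whisk (last_path (cel_path x) (cel_layers x)) nil) (cel_layers y)
  end.
Definition cel_last x := last_path (cel_path x) (cel_layers x).
Fixpoint cel_wf x : Prop :=
  match x with
  | CAtom c a b => arr_wf a /\ arr_wf b /\ arr_src b = arr_src a /\
      is_cell c (arr_eval a) (arr_eval b)
  | CId a => arr_wf a
  | CV x y => cel_wf x /\ cel_wf y /\ cel_src y = cel_src x /\
      path_arr (cel_src x) (cel_last x) = path_arr (cel_src x) (cel_path y)
  | CH x y => cel_wf x /\ cel_wf y /\ path_end (cel_src x) (cel_path x) = cel_src y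
  end.

Lemma cel_layersP x : cel_wf x ->
  path_wf (cel_src x) (cel_path x) /\
  layers_wf (cel_src x) (cel_path x) (cel_layers x) /\
  cel_eval x = layers_cel (cel_src x) (cel_path x) (cel_layers x).
Proof.
induction x as [c a b|a|x IHx y IHy|x IHx y IHy]; simpl.
- intros (Ha & Hb & e & Hc); destruct (arr_flatP Ha) as [A1 A2], (arr_flatP Hb) as [B1 B2].
  rewrite e in *.
  unfold layer_dom, layer_cod, layer_wf, layer_cel; simpl; rewrite !app_nil_r.
  rewrite A2, B2 in Hc; repeat split; trivial; try apply Hc.
  destruct Hc as [Hc Hc'].
  assert (E: c = id2 (id1 (arr_src a)) ## c
     ## id2 (id1 (path_end (arr_src a) (arr_flat a)))).
  { rewrite <- (src_path A1), <- Hc at 1; rewrite hcomp_id_l.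
    rewrite <- (tgt_path A1), <- Hc at 1; now rewrite hcomp_id_r. }
  rewrite <- E, <- Hc'; now rewrite vcomp_id_r.
- intros Ha; destruct (arr_flatP Ha) as [A1 A2]; now rewrite A2.
- intros (Hx & Hy & e & j); destruct (IHx Hx) as (X1 & X2 & X3), (IHy Hy) as (Y1 & Y2 & Y3).
  rewrite e in *; destruct (layers_congr (eq_sym j) Y2) as (Z1 & Z2 & Z3).
  repeat split; trivial.
  + now rewrite layers_app_wf.
  + rewrite layers_cel_app; trivial; now rewrite X3, Y3, Z2.
- intros (Hx & Hy & e); destruct (IHx Hx) as (X1 & X2 & X3), (IHy Hy) as (Y1 & Y2 & Y3).
  rewrite <- e in Y1, Y2, Y3; clear IHx IHy; clear Hx Hy.
  pose proof (last_path_wf X1 X2) as W1; pose proof (last_path_end X1 X2) as W2.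
  destruct (layers_whisk (X := cel_src x) (p := nil) (q := cel_path y) (r := cel_path x)
    (L := cel_layers x)) as (A1 & A2 & A3); simpl; trivial.
  destruct (layers_whisk (X := cel_src x) (p := last_path (cel_path x) (cel_layers x)) (q := nil)
    (r := cel_path y) (L := cel_layers y)) as (B1 & B2 & B3); simpl; trivial; try now rewrite W2.
  simpl in A1, A2, A3; rewrite app_nil_r in B1, B3.
  repeat split.
  + now rewrite path_wf_app.
  + now rewrite layers_app_wf, A2.
  + rewrite layers_cel_app, A2, A3, B3; trivial; [|now rewrite path_wf_app | now rewrite A2].
    pose proof (layers_cel_typed X1 X2) as [T1 T2].
    pose proof (layers_cel_typed Y1 Y2) as [T3 T4].
    assert (S1 := src_path X1); assert (S2 := tgt_path X1); assert (S3 := src_path Y1);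
    assert (S4 := tgt_path Y1).
    rewrite W2, <- X3, <- Y3 in *; simpl.
    set (a := cel_eval x) in *; set (b := cel_eval y) in *.
    assert (E0: id2 (id1 (cel_src x)) ## a = a) by (rewrite <- S1, <- T1; apply hcomp_id_l).
    assert (E: (path_arr (cel_src x) (last_path (cel_path x) (cel_layers x)) <| b)
       |> id1 (path_end (path_end (cel_src x) (cel_path x)) (cel_path y)) =
       cod a <| b).
    { rewrite <- T2, <- hcompA.
      - rewrite <- S4, <- T3 at 1; now rewrite hcomp_id_r.
      - rewrite dom_id2, <- tgt_dom; congruence.
      - rewrite dom_id2, src_id1; congruence. }
    rewrite E0, E, <- T3.
    rewrite <- interchange by bd.
    now rewrite vcomp_id_r, vcomp_id_l.
Qed.

Lemma cel_eval_typed x : cel_wf x ->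
  is_cell (cel_eval x) (path_arr (cel_src x) (cel_path x)) (path_arr (cel_src x) (cel_last x)).
Proof.
intros H; destruct (cel_layersP H) as (H1 & H2 & ->); now apply layers_cel_typed.
Qed.

Lemma cel_expr_typed x a b : cel_wf x -> arr_wf a -> arr_wf b ->
  arr_src a = cel_src x -> arr_src b = cel_src x ->
  path_arr (cel_src x) (cel_path x) = path_arr (cel_src x) (arr_flat a) ->
  path_arr (cel_src x) (cel_last x) = path_arr (cel_src x) (arr_flat b) ->
  is_cell (cel_eval x) (arr_eval a) (arr_eval b).
Proof.
intros Hx Ha Hb ea eb e1 e2; pose proof (cel_eval_typed Hx) as T.
destruct (arr_flatP Ha) as [_ ->], (arr_flatP Hb) as [_ ->]; rewrite ea, eb; congruence.
Qed.

(** Two successive layers act on disjoint parts of the boundary when the second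
    one lies entirely to the left of the output of the first. *)
Definition swappable (l1 l2 : layer) : bool :=
  length (lay_pre l2) + length (lay_dom l2) <=? length (lay_pre l1).
Definition gap (l1 l2 : layer) :=
  skipn (length (lay_pre l2) + length (lay_dom l2)) (lay_pre l1).
Definition swap_fst l1 l2 :=
  Layer (lay_pre l2) (lay_cel l2) (lay_dom l2) (lay_cod l2)
    (gap l1 l2 ++ lay_dom l1 ++ lay_post l1).
Definition swap_snd l1 l2 :=
  Layer (lay_pre l2 ++ lay_cod l2 ++ gap l1 l2) (lay_cel l1) (lay_dom l1) (lay_cod l1)
    (lay_post l1).
(** [swappable] and [gap] only count arrows. That the paths really decompose in this way is an
    equality of lists of arrows, to be proved by reflexivity; it is here that a strict equality used
    between two layers blocks their exchange. *)
Definition swap_ok l1 l2 : Prop :=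
  lay_pre l1 = lay_pre l2 ++ lay_dom l2 ++ gap l1 l2 /\
  lay_post l2 = gap l1 l2 ++ lay_cod l1 ++ lay_post l1.

Lemma hcomp_swap (a b : cel C) : tgt (dom a) = src (dom b) ->
  (dom a <| b) ;; (a |> cod b) = (a |> dom b) ;; (cod a <| b).
Proof.
intros e; rewrite <- !interchange; rewrite ?dom_id2, ?cod_id2; trivial.
now rewrite !vcomp_id_l, !vcomp_id_r.
Qed.

Lemma whisker_vcomp (f g : arr C) (a b : cel C) :
  cod a = dom b -> tgt f = src (dom a) -> tgt (dom a) = src g ->
  (f <| (a ;; b)) |> g = ((f <| a) |> g) ;; ((f <| b) |> g).
Proof.
intros e1 e2 e3; pose proof (src_dom a); pose proof (tgt_dom a).
rewrite <- interchange, id2_vcomp by bd.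
now rewrite <- interchange, id2_vcomp by bd.
Qed.

Lemma swapP X l1 l2 : layer_wf X l1 -> layer_wf X l2 -> swap_ok l1 l2 ->
  let l2' := swap_fst l1 l2 in let l1' := swap_snd l1 l2 in
  layer_wf X l2' /\ layer_wf X l1' /\
  layer_dom l2' = layer_dom l1 /\ layer_cod l2' = layer_dom l1' /\
  layer_cod l1' = layer_cod l2 /\
  layer_cel X l1 ;; layer_cel X l2 = layer_cel X l2' ;; layer_cel X l1'.
Proof.
unfold swap_ok, swap_fst, swap_snd; generalize (gap l1 l2) as r; intros r.
destruct l1 as [p1 c1 d1 e1 q1], l2 as [p2 c2 d2 e2 q2]; simpl; intros H1 H2 [-> ->].
pose proof (layer_end H1) as E1; pose proof (layer_end H2) as E2.
unfold layer_wf, layer_dom, layer_cod in *; simpl in *.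
rewrite !path_end_app, !path_wf_app in *.
destruct H1 as ((A1 & A2 & A3) & A4 & A5 & A6 & A7).
destruct H2 as (_ & _ & B3 & B4 & B5 & B6 & B7).
rewrite ?path_end_app in *; simpl.
rewrite <- E2; rewrite <- !app_assoc.
split; [now repeat (split; trivial)|split; [now repeat (split; trivial)|]].
do 3 (split; trivial).
assert (E3: path_end (path_end X p2) e2 = path_end (path_end X p2) d2) by easy.
assert (B5': path_wf (path_end (path_end X p2) e2) r) by now rewrite E3.
assert (A7': path_wf (path_end (path_end (path_end (path_end X p2) d2) r) e1) q1) by now rewrite <- E1.
unfold layer_cel; simpl; rewrite !path_end_app.
rewrite (path_arr3 (p := p2) (q := d2)), (path_arr3 (p := p2) (q := e2)) by trivial.
rewrite E3, (path_arr3 (p := r) (q := e1)), (path_arr3 (p := r) (q := d1)), <- E1 by trivial.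
pose proof (path_arr_typed A1) as [? ?]; pose proof (path_arr_typed A2) as [? ?].
pose proof (path_arr_typed B3) as [? TF]; rewrite E3 in TF.
pose proof (path_arr_typed A3) as [? ?]; pose proof (path_arr_typed A4) as [? ?].
pose proof (path_arr_typed A5) as [? TG]; rewrite <- E1 in TG.
pose proof (path_arr_typed A7) as [? ?]; destruct A6 as [K1 K2], B4 as [K3 K4].
set (V := path_end (path_end _ r) d1) in *; set (U := path_end _ r) in *.
set (Z := path_end _ d2) in *; set (Y := path_end X p2) in *.
set (P := path_arr X p2) in *; set (D2 := path_arr Y d2) in *; set (F2 := path_arr Y e2) in *.
set (R := path_arr Z r) in *; set (D1 := path_arr U d1) in *; set (F1 := path_arr U e1) in *.
set (Q := path_arr V q1) in *.
(* The outer paths [P] and [Q] are common to both layers. Between them [c2] and [c1] stand side by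
   side, separated by [R], so that [hcomp_swap] applies. *)
transitivity ((P <| ((D2 <| (R <| c1)) ;; (c2 |> (R # F1)))) |> Q).
- assert (EL: (P # D2 # R) <| c1 |> Q = (P <| (D2 <| (R <| c1))) |> Q).
  { rewrite <- !hcomp_id2 by bd; now rewrite !hcompA by bd. }
  assert (ER: P <| c2 |> (R # F1 # Q) = (P <| (c2 |> (R # F1))) |> Q).
  { rewrite <- !hcomp_id2 by bd; now repeat rewrite !hcompA by bd. }
  now rewrite EL, ER, whisker_vcomp by bd.
- assert (EL: P <| c2 |> (R # D1 # Q) = (P <| (c2 |> (R # D1))) |> Q).
  { rewrite <- !hcomp_id2 by bd; now repeat rewrite !hcompA by bd. }
  assert (ER: (P # F2 # R) <| c1 |> Q = (P <| (F2 <| (R <| c1))) |> Q).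
  { rewrite <- !hcomp_id2 by bd; now repeat rewrite !hcompA by bd. }
  rewrite EL, ER, <- whisker_vcomp by bd.
  pose proof (@hcomp_swap c2 (R <| c1)) as E.
  rewrite cod_hcomp, dom_hcomp, cod_id2, dom_id2, K1, K2, K3, K4 in E by bd.
  rewrite E by bd; reflexivity.
Qed.

(** Insertion sort that performs a layer lying entirely to the left before the layer that precedes
    it. Only soundness is proved: composites with equal sorted lists are equal, and nothing is
    claimed when the lists differ. *)
Fixpoint insert_layer l (L : list layer) : list layer :=
  match L with
  | nil => l :: nil
  | l2 :: L' =>
      if swappable l l2 then swap_fst l l2 :: insert_layer (swap_snd l l2) L' else l :: L
  end.
Fixpoint insert_ok l (L : list layer) : Prop :=
  match L with
  | nil => True
  | l2 :: L' =>
      if swappable l l2 then swap_ok l l2 /\ insert_ok (swap_snd l l2) L' else True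
  end.
Fixpoint sort_layers (L : list layer) : list layer :=
  match L with nil => nil | l :: L => insert_layer l (sort_layers L) end.
Fixpoint sort_ok (L : list layer) : Prop :=
  match L with nil => True | l :: L => sort_ok L /\ insert_ok l (sort_layers L) end.

Lemma insert_layerP X p l L : path_wf X p ->
  layers_wf X p (l :: L) -> insert_ok l L ->
  layers_wf X p (insert_layer l L) /\
  layers_cel X p (insert_layer l L) = layers_cel X p (l :: L).
Proof.
revert p l; induction L as [|l2 L IH]; intros p l Hp; [now split|].
simpl; destruct (swappable l l2); [|now split].
intros (e & Hl & e2 & Hl2 & HL) [Hs Hi].
destruct (swapP Hl Hl2 Hs) as (S1 & S2 & S3 & S4 & S5 & S6).
destruct (IH (layer_cod (swap_fst l l2)) (swap_snd l l2)) as [I1 I2]; trivial.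
- now apply layer_cod_wf.
- simpl; now rewrite S4, S5.
- split; simpl.
  + now rewrite S3.
  + pose proof (layer_cel_typed Hl) as [A1 A2]; pose proof (layer_cel_typed Hl2) as [A3 A4].
    pose proof (layer_cel_typed S1) as [B1 B2]; pose proof (layer_cel_typed S2) as [B3 B4].
    pose proof (layers_cel_typed (layer_cod_wf Hl2) HL) as [D1 D2].
    simpl in I2; rewrite I2, S5, (vcompA (a := layer_cel X l)) by congruence.
    rewrite S6; apply vcompA; congruence.
Qed.

Lemma sort_layersP X p L : path_wf X p -> layers_wf X p L -> sort_ok L ->
  layers_wf X p (sort_layers L) /\ layers_cel X p (sort_layers L) = layers_cel X p L.
Proof.
revert p; induction L as [|l L IH]; intros p Hp; [now split|].
intros (e & Hl & HL) [Hs Hi]; simpl in *.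
destruct (IH (layer_cod l)) as [I1 I2]; trivial; [now apply layer_cod_wf|].
destruct (insert_layerP (p := p) (l := l) (L := sort_layers L) Hp) as [J1 J2]; trivial.
- now repeat (split; trivial).
- split; trivial; rewrite J2; simpl; now rewrite I2.
Qed.

Lemma pasting_eq x y : cel_wf x -> cel_wf y -> cel_src y = cel_src x ->
  path_arr (cel_src x) (cel_path x) = path_arr (cel_src x) (cel_path y) ->
  cel_layers x = cel_layers y -> cel_eval x = cel_eval y.
Proof.
intros Hx Hy e ep el; destruct (cel_layersP Hx) as (X1 & X2 & X3), (cel_layersP Hy) as (Y1 & Y2 & Y3).
rewrite X3, Y3, e, el in *; apply layers_congr; trivial; now rewrite <- el.
Qed.

Lemma pasting_eq_sort x y : cel_wf x -> cel_wf y -> cel_src y = cel_src x ->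
  path_arr (cel_src x) (cel_path x) = path_arr (cel_src x) (cel_path y) ->
  sort_ok (cel_layers x) -> sort_ok (cel_layers y) ->
  sort_layers (cel_layers x) = sort_layers (cel_layers y) -> cel_eval x = cel_eval y.
Proof.
intros Hx Hy e ep ox oy el.
destruct (cel_layersP Hx) as (X1 & X2 & X3), (cel_layersP Hy) as (Y1 & Y2 & Y3).
destruct (sort_layersP X1 X2 ox) as [S1 S2], (sort_layersP Y1 Y2 oy) as [T1 T2].
rewrite X3, Y3, <- S2, <- T2, e, <- el in *; apply layers_congr; trivial.
Qed.
End Pasting.

Arguments AId {C} X.

Ltac reify_arr f :=
  lazymatch f with
  | id1 ?X => constr:(AId X)
  | ?f # ?g => let a := reify_arr f in let b := reify_arr g in constr:(AComp a b)
  | ?f => constr:(AAtom f)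
  end.

(** Atomic 2-cells get their boundary from a hypothesis [is_cell _ _ _]. *)
Ltac reify_cel u :=
  lazymatch u with
  | id2 ?f => let a := reify_arr f in constr:(CId a)
  | ?u ;; ?v => let x := reify_cel u in let y := reify_cel v in constr:(CV x y)
  | ?u ## ?v => let x := reify_cel u in let y := reify_cel v in constr:(CH x y)
  | ?u => lazymatch goal with
      | H : is_cell u ?f ?g |- _ =>
          let a := reify_arr f in let b := reify_arr g in constr:(CAtom u a b)
      | _ => fail 0 "no boundary known for" u
      end
  end.

Ltac pasting_cbv :=
  cbv [cel_wf cel_src cel_path cel_layers cel_last cel_eval arr_wf arr_src arr_flat arr_eval
    last_path path_end path_arr List.app map layer_whisk layer_cod layer_dom
    lay_pre lay_cel lay_dom lay_cod lay_post sort_ok sort_layers insert_layer insert_ok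
    swappable swap_fst swap_snd swap_ok gap length Nat.add Nat.leb skipn].

(** Redefined below for 2-categories with a single object. *)
Ltac object_eq :=
  repeat match goal with
  | H : is_arrow ?f _ _ |- context [src ?f] => rewrite (proj1 H)
  | H : is_arrow ?f _ _ |- context [tgt ?f] => rewrite (proj2 H)
  end; try rewrite ?src_id1, ?tgt_id1; reflexivity.

Ltac pasting_side :=
  pasting_cbv;
  repeat match goal with |- _ /\ _ => split | |- True => exact I end;
  try lazymatch goal with
  | |- is_cell _ _ _ => assumption
  | |- @eq (obj _) _ _ => object_eq
  | |- _ => reflexivity
  end.

(** Equality modulo the axioms other than interchange. *)
Ltac pasting :=
  lazymatch goal with
  | |- ?u = ?v => let x := reify_cel u in let y := reify_cel v in
      apply (pasting_eq (x := x) (y := y)); pasting_side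
  | |- is_cell ?u ?f ?g => let x := reify_cel u in
      let a := reify_arr f in let b := reify_arr g in
      apply (cel_expr_typed (x := x) (a := a) (b := b)); pasting_side
  end.

(** Equality modulo all the axioms, provided that no strict equality between
    arrows is used at the place where two layers have to be exchanged. *)
Ltac pasting_interchange :=
  lazymatch goal with
  | |- ?u = ?v => let x := reify_cel u in let y := reify_cel v in
      apply (pasting_eq_sort (x := x) (y := y)); pasting_side
  end.

(** * Equivalences *)

Lemma equivalence_faithful (A B : category) (F : functor A B) (x y : A) (f g : x ⟶ y) :
  is_equivalence F -> fmap F f = fmap F g -> f = g.
Proof.
intros (G & (t & Ht) & _) e.
pose (s := t : forall x, iso (G (F x)) x).
assert (E : forall h : x ⟶ y, h = iso_inv (s x) ⨟ (fmap G (fmap F h) ⨟ s y)).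
{ intros h; transitivity (iso_inv (s x) ⨟ (s x ⨟ h)).
  - now rewrite ccompA, iso_inv_hom, cid_l.
  - f_equal; symmetry; exact (Ht _ _ h). }
now rewrite (E f), (E g), e.
Qed.

(** The preimage is [G h] conjugated by the isomorphisms [G (F x) ≅ x]. The definition of an
    equivalence is symmetric, so [G] is faithful too, and the equation can be checked after applying
    [G]. *)
Lemma equivalence_full (A B : category) (F : functor A B) (x y : A) (h : F x ⟶ F y) :
  is_equivalence F -> exists f : x ⟶ y, fmap F f = h.
Proof.
intros HF; pose proof HF as (G & (t & Ht) & HG').
assert (HG : is_equivalence G) by (exists F; split; trivial; now exists t).
pose (s := t : forall x, iso (G (F x)) x).
exists (iso_inv (s x) ⨟ (fmap G h ⨟ s y)).
apply (equivalence_faithful HG).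
set (k := iso_inv (s x) ⨟ _) in *.
assert (E : fmap G (fmap F k) ⨟ s y = s x ⨟ k) by exact (Ht _ _ k).
rewrite <- (cid_r (fmap G (fmap F k))), <- (iso_hom_inv (s y)), ccompA, E; unfold k.
now rewrite ccompA, iso_hom_inv, cid_l, <- ccompA, iso_hom_inv, cid_r.
Qed.

Lemma equivalence_surjective (A B : category) (F : functor A B) (y : B) :
  is_equivalence F -> exists x : A, inhabited (iso (F x) y).
Proof. intros (G & _ & (t & _)); exists (G y); constructor; exact (t y). Qed.

(** * Cancellation along invertible 2-cells and equi-arrows *)

Section Cells.
Variable C : two_category.
Implicit Types (f g h : arr C) (a b c : cel C) (X Y Z W : obj C).

Lemma inverse_cells_sym a a' : inverse_cells a a' -> inverse_cells a' a.
Proof. intros ([H1 H2] & H3 & H4); split; [split|]; rewrite ?H1, ?H2; auto. Qed.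

Lemma invertible_cell_inverse f g a : is_cell a f g -> invertible_cell a ->
  exists a', is_cell a' g f /\ a ;; a' = id2 f /\ a' ;; a = id2 g.
Proof. intros [<- <-] [a' H]; exists a'; exact H. Qed.

Lemma inverse_cells_intro f g a a' : is_cell a f g -> is_cell a' g f ->
  a ;; a' = id2 f -> a' ;; a = id2 g -> inverse_cells a a'.
Proof. intros [<- <-] [H1 H2] H3 H4; repeat split; trivial. Qed.

Lemma inverse_cells_elim f g a a' : is_cell a f g -> inverse_cells a a' ->
  is_cell a' g f /\ a ;; a' = id2 f /\ a' ;; a = id2 g.
Proof. now intros [<- <-]. Qed.

Lemma inverse_cells_unique a a' a'' : inverse_cells a a' -> inverse_cells a a'' -> a' = a''.
Proof.
intros ([D1 D2] & H1 & H2) ([D3 D4] & H3 & H4).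
rewrite <- (vcomp_id_r a'), D2, <- H3, vcompA, H2, <- D3 by congruence; apply vcomp_id_l.
Qed.

Lemma vcomp_id_left f g a : is_cell a f g -> id2 f ;; a = a.
Proof. intros [<- _]; apply vcomp_id_l. Qed.

Lemma vcomp_id_right f g a : is_cell a f g -> a ;; id2 g = a.
Proof. intros [_ <-]; apply vcomp_id_r. Qed.

Lemma vcomp_assoc f g h k a b c : is_cell a f g -> is_cell b g h -> is_cell c h k ->
  a ;; (b ;; c) = (a ;; b) ;; c.
Proof. intros [? ?] [? ?] [? ?]; apply vcompA; congruence. Qed.

Lemma vcomp_cancel_l f g h a b c : is_cell a f g -> is_cell b g h -> is_cell c g h ->
  invertible_cell a -> a ;; b = a ;; c -> b = c.
Proof.
intros Ha Hb Hc Hi e; destruct (invertible_cell_inverse Ha Hi) as (a' & Ha' & _ & E).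
rewrite <- (vcomp_id_left Hb), <- (vcomp_id_left Hc), <- E.
now rewrite <- (vcomp_assoc Ha' Ha Hb), <- (vcomp_assoc Ha' Ha Hc), e.
Qed.

Lemma vcomp_cancel_r f g h a b c : is_cell a g h -> is_cell b f g -> is_cell c f g ->
  invertible_cell a -> b ;; a = c ;; a -> b = c.
Proof.
intros Ha Hb Hc Hi e; destruct (invertible_cell_inverse Ha Hi) as (a' & Ha' & E & _).
rewrite <- (vcomp_id_right Hb), <- (vcomp_id_right Hc), <- E.
now rewrite (vcomp_assoc Hb Ha Ha'), (vcomp_assoc Hc Ha Ha'), e.
Qed.

Lemma invertible_id2 f : invertible_cell (id2 f).
Proof.
exists (id2 f); apply inverse_cells_intro with f f; trivial using is_cell_id2, id2_vcomp.
Qed.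

Lemma invertible_vcomp f g h a b : is_cell a f g -> is_cell b g h ->
  invertible_cell a -> invertible_cell b -> invertible_cell (a ;; b).
Proof.
intros Ha Hb Ia Ib.
destruct (invertible_cell_inverse Ha Ia) as (a' & Ha' & A1 & A2).
destruct (invertible_cell_inverse Hb Ib) as (b' & Hb' & B1 & B2).
exists (b' ;; a'); apply inverse_cells_intro with f h; eauto using is_cell_vcomp.
- rewrite <- (vcomp_assoc Ha Hb (is_cell_vcomp Hb' Ha')), (vcomp_assoc Hb Hb' Ha'), B1.
  now rewrite (vcomp_id_left Ha').
- rewrite <- (vcomp_assoc Hb' Ha' (is_cell_vcomp Ha Hb)), (vcomp_assoc Ha' Ha Hb), A2.
  now rewrite (vcomp_id_left Hb).
Qed.

Lemma invertible_hcomp a b : tgt (dom a) = src (dom b) ->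
  invertible_cell a -> invertible_cell b -> invertible_cell (a ## b).
Proof.
intros e [a' ([A1 A2] & A3 & A4)] [b' ([B1 B2] & B3 & B4)].
pose proof (src_dom b); pose proof (tgt_dom a).
exists (a' ## b'); apply inverse_cells_intro with (dom a # dom b) (cod a # cod b).
- split; bd.
- split; bd.
- rewrite <- interchange, A3, B3 by bd; apply hcomp_id2; bd.
- rewrite <- interchange, A4, B4 by bd; apply hcomp_id2; bd.
Qed.

Lemma invertible_inverse a a' : inverse_cells a a' -> invertible_cell a'.
Proof. intros H; exists a; now apply inverse_cells_sym. Qed.

Lemma equi_arrow_elim X Y f : is_arrow f X Y -> equi_arrow f ->
  exists g, is_arrow g Y X /\ equi_arrow g /\
    (exists a, is_cell a (f # g) (id1 X) /\ invertible_cell a) /\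
    (exists b, is_cell b (g # f) (id1 Y) /\ invertible_cell b).
Proof.
intros [<- <-] (g & [G1 G2] & Ha & Hb); exists g; repeat split; trivial.
exists f; repeat split; trivial; now rewrite ?G1, ?G2.
Qed.

(** With [u : e' # e ⇒ id] invertible, interchange recovers [c] from [e <| c]: whisker further with
    [e'] and conjugate by [u]. *)
Lemma whisker_l_faithful X Y Z e f g a b : is_arrow e X Y -> equi_arrow e ->
  is_arrow f Y Z -> is_arrow g Y Z -> is_cell a f g -> is_cell b f g ->
  e <| a = e <| b -> a = b.
Proof.
intros He Ee Hf Hg Ha Hb E.
destruct (equi_arrow_elim He Ee) as (e' & He' & _ & _ & (u & Hu & Iu)).
destruct (invertible_cell_inverse Hu Iu) as (u' & Hu' & U1 & U2).
assert (K : forall c, is_cell c f g -> c = (u' |> f) ;; (e' <| (e <| c)) ;; (u |> g)).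
{ intros c Hc; transitivity (((u' ;; u) |> f) ;; c).
  - rewrite U2; pasting.
  - transitivity ((u' |> f) ;; (u |> f) ;; (id1 Y <| c)); [pasting|].
    transitivity ((u' |> f) ;; ((u |> f) ;; (id1 Y <| c))); [pasting|].
    assert (S : (u |> f) ;; (id1 Y <| c) = (e' <| (e <| c)) ;; (u |> g)) by pasting_interchange.
    rewrite S; pasting. }
rewrite (K a Ha), (K b Hb), E; reflexivity.
Qed.

(** The formula that recovers a 2-cell in [whisker_l_faithful] is used as the definition of the
    preimage. The quasi-inverse [e'] is itself an equi-arrow, so the required equation may be tested
    after whiskering with [e']. *)
Lemma whisker_l_full X Y Z e f g c : is_arrow e X Y -> equi_arrow e ->
  is_arrow f Y Z -> is_arrow g Y Z -> is_cell c (e # f) (e # g) ->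
  exists a, is_cell a f g /\ e <| a = c.
Proof.
intros He Ee Hf Hg Hc.
destruct (equi_arrow_elim He Ee) as (e' & He' & Ee' & _ & (u & Hu & Iu)).
destruct (invertible_cell_inverse Hu Iu) as (u' & Hu' & U1 & U2).
pose (a := (u' |> f) ;; (e' <| c) ;; (u |> g)).
assert (Ha : is_cell a f g) by (unfold a; pasting).
exists a; split; trivial.
apply (whisker_l_faithful He' Ee' (f := e # f) (g := e # g) (Z := Z));
  trivial; try (apply is_arrow_comp with Y; assumption).
{ pasting. }
apply (@vcomp_cancel_r (e' # (e # f)) (e' # (e # g)) g (u |> g)); try solve [pasting].
{ apply invertible_hcomp; trivial using invertible_id2.
  rewrite dom_id2, (proj1 Hu); rewrite (proj2 (is_arrow_comp He' He)); symmetry; apply Hg. }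
transitivity ((u |> f) ;; (id1 Y <| a)); [pasting_interchange|].
transitivity ((u |> f) ;; a); [pasting|]; unfold a.
transitivity (((u ;; u') |> f) ;; (e' <| c) ;; (u |> g)); [pasting|].
rewrite U1; pasting.
Qed.

Lemma whisker_r_faithful X Y Z e f g a b : is_arrow e Y Z -> equi_arrow e ->
  is_arrow f X Y -> is_arrow g X Y -> is_cell a f g -> is_cell b f g ->
  a |> e = b |> e -> a = b.
Proof.
intros He Ee Hf Hg Ha Hb E.
destruct (equi_arrow_elim He Ee) as (e' & He' & _ & (u & Hu & Iu) & _).
destruct (invertible_cell_inverse Hu Iu) as (u' & Hu' & U1 & U2).
assert (K : forall c, is_cell c f g -> c = (f <| u') ;; ((c |> e) |> e') ;; (g <| u)).
{ intros c Hc; transitivity (c ;; (g <| (u' ;; u))).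
  - rewrite U2; pasting.
  - transitivity ((c |> id1 Y) ;; (g <| u') ;; (g <| u)); [pasting|].
    transitivity (((c |> id1 Y) ;; (g <| u')) ;; (g <| u)); [pasting|].
    assert (S : (c |> id1 Y) ;; (g <| u') = (f <| u') ;; ((c |> e) |> e'))
      by pasting_interchange.
    rewrite S; pasting. }
rewrite (K a Ha), (K b Hb), E; reflexivity.
Qed.

Lemma whisker_r_full X Y Z e f g c : is_arrow e Y Z -> equi_arrow e ->
  is_arrow f X Y -> is_arrow g X Y -> is_cell c (f # e) (g # e) ->
  exists a, is_cell a f g /\ a |> e = c.
Proof.
intros He Ee Hf Hg Hc.
destruct (equi_arrow_elim He Ee) as (e' & He' & Ee' & (u & Hu & Iu) & _).
destruct (invertible_cell_inverse Hu Iu) as (u' & Hu' & U1 & U2).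
pose (a := (f <| u') ;; (c |> e') ;; (g <| u)).
assert (Ha : is_cell a f g) by (unfold a; pasting).
exists a; split; trivial.
apply (whisker_r_faithful He' Ee' (f := f # e) (g := g # e) (X := X));
  trivial; try (apply is_arrow_comp with Y; assumption).
{ pasting. }
apply (@vcomp_cancel_r ((f # e) # e') ((g # e) # e') g (g <| u)); try solve [pasting].
{ apply invertible_hcomp; trivial using invertible_id2.
  rewrite dom_id2, (proj1 Hu); rewrite (proj1 (is_arrow_comp He He')); apply Hg. }
transitivity ((f <| u) ;; (a |> id1 Y)); [pasting_interchange|].
transitivity ((f <| u) ;; a); [pasting|]; unfold a.
transitivity ((f <| (u ;; u')) ;; (c |> e') ;; (g <| u)); [pasting|].
rewrite U1; pasting.
Qed.

Lemma whisker_l_invertible X Y Z e f g a : is_arrow e X Y -> equi_arrow e ->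
  is_arrow f Y Z -> is_arrow g Y Z -> is_cell a f g ->
  invertible_cell (e <| a) -> invertible_cell a.
Proof.
intros He Ee Hf Hg Ha Ia.
assert (Hea : is_cell (e <| a) (e # f) (e # g)) by pasting.
destruct (invertible_cell_inverse Hea Ia) as (c & Hc & C1 & C2).
destruct (whisker_l_full He Ee Hg Hf Hc) as (b & Hb & <-).
exists b; apply inverse_cells_intro with f g; trivial.
- apply (whisker_l_faithful He Ee Hf Hf); try solve [pasting].
  transitivity (e <| a ;; e <| b); [pasting|]; rewrite C1; pasting.
- apply (whisker_l_faithful He Ee Hg Hg); try solve [pasting].
  transitivity (e <| b ;; e <| a); [pasting|]; rewrite C2; pasting.
Qed.

Lemma whisker_r_invertible X Y Z e f g a : is_arrow e Y Z -> equi_arrow e ->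
  is_arrow f X Y -> is_arrow g X Y -> is_cell a f g ->
  invertible_cell (a |> e) -> invertible_cell a.
Proof.
intros He Ee Hf Hg Ha Ia.
assert (Hea : is_cell (a |> e) (f # e) (g # e)) by pasting.
destruct (invertible_cell_inverse Hea Ia) as (c & Hc & C1 & C2).
destruct (whisker_r_full He Ee Hg Hf Hc) as (b & Hb & <-).
exists b; apply inverse_cells_intro with f g; trivial.
- apply (whisker_r_faithful He Ee Hf Hf); try solve [pasting].
  transitivity (a |> e ;; b |> e); [pasting|]; rewrite C1; pasting.
- apply (whisker_r_faithful He Ee Hg Hg); try solve [pasting].
  transitivity (b |> e ;; a |> e); [pasting|]; rewrite C2; pasting.
Qed.

(** An arbitrary invertible [v] is kept as counit, and the unit is the solution [u] of the first
    triangle identity, which exists because whiskering with [f] is full. The second identity is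
    tested after whiskering with [f]. *)
Lemma adjoint_equivalence X Y f : is_arrow f X Y -> equi_arrow f ->
  exists g u v, is_arrow g Y X /\
    is_cell u (id1 X) (f # g) /\ invertible_cell u /\
    is_cell v (g # f) (id1 Y) /\ invertible_cell v /\
    (u |> f) ;; (f <| v) = id2 f /\ (g <| u) ;; (v |> g) = id2 g.
Proof.
intros Hf Ef; destruct (equi_arrow_elim Hf Ef) as (g & Hg & Eg & _ & (v & Hv & Iv)).
destruct (invertible_cell_inverse Hv Iv) as (v' & Hv' & V1 & V2).
assert (Hc : is_cell (f <| v') (id1 X # f) ((f # g) # f)) by pasting.
destruct (whisker_r_full Hf Ef (is_arrow_id1 X) (is_arrow_comp Hf Hg) Hc) as (u & Hu & Ec).
assert (T : (u |> f) ;; (f <| v) = id2 f).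
{ rewrite Ec; transitivity (f <| (v' ;; v)); [pasting|]; rewrite V2; pasting. }
exists g, u, v; repeat (split; trivial).
- apply (whisker_r_invertible Hf Ef (is_arrow_id1 X) (is_arrow_comp Hf Hg) Hu).
  rewrite Ec; exists (f <| v); apply inverse_cells_intro with f (f # (g # f)); try solve [pasting].
  + transitivity (f <| (v' ;; v)); [pasting|]; rewrite V2; pasting.
  + transitivity (f <| (v ;; v')); [pasting|]; rewrite V1; pasting.
- apply (whisker_r_faithful Hf Ef Hg Hg); try solve [pasting].
  transitivity ((g <| (u |> f)) ;; (v |> (g # f))); [pasting|]; rewrite Ec.
  (* [v |> (g # f)] and [(g # f) <| v] agree, since they agree before [v] *)
  assert (E : v |> (g # f) = (g # f) <| v).
  { apply (@vcomp_cancel_r ((g # f) # (g # f)) (g # f) (id1 Y) v); trivial; try solve [pasting].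
    transitivity ((v |> (g # f)) ;; (id1 Y <| v)); [pasting|].
    transitivity (((g # f) <| v) ;; (v |> id1 Y)); [symmetry; pasting_interchange|pasting]. }
  rewrite E; transitivity ((g # f) <| (v' ;; v)); [pasting|]; rewrite V2; pasting.
Qed.

End Cells.

(** * Action of 2-functors and 2-equivalences on 2-cells *)

Section Functor.
Variables (C D : two_category) (F : two_functor C D).

Lemma inverse_cells_fun a b : inverse_cells a b -> inverse_cells (fun2 F a) (fun2 F b).
Proof.
intros ([B1 B2] & B3 & B4).
apply inverse_cells_intro with (fun1 F (dom a)) (fun1 F (cod a)).
- split; [apply fun_dom | apply fun_cod].
- split; rewrite ?fun_dom, ?fun_cod; congruence.
- rewrite <- fun_vcomp, B3 by congruence; apply fun_id2.
- rewrite <- fun_vcomp, B4 by congruence; apply fun_id2.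
Qed.

Lemma invertible_fun a : invertible_cell a -> invertible_cell (fun2 F a).
Proof. intros [b H]; exists (fun2 F b); now apply inverse_cells_fun. Qed.

Lemma equi_arrow_fun f : equi_arrow f -> equi_arrow (fun1 F f).
Proof.
intros Ef; destruct (equi_arrow_elim (conj eq_refl eq_refl) Ef)
  as (g & Hg & _ & (u & Hu & Iu) & (v & Hv & Iv)).
exists (fun1 F g); rewrite fun_src, fun_tgt; split; [now apply is_arrow_fun|split].
- exists (fun2 F u); split; [|now apply invertible_fun].
  rewrite <- fun_comp, <- fun_id1; [now apply is_cell_fun|symmetry; apply Hg].
- exists (fun2 F v); split; [|now apply invertible_fun].
  rewrite <- fun_comp, <- fun_id1; [now apply is_cell_fun|apply Hg].
Qed.

Hypothesis EF : is_two_equivalence F.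

Lemma fun_faithful X Y f g a b : is_arrow f X Y -> is_arrow g X Y ->
  is_cell a f g -> is_cell b f g -> fun2 F a = fun2 F b -> a = b.
Proof.
intros Hf Hg Ha Hb e.
pose (f' := exist _ f Hf : hom_category X Y); pose (g' := exist _ g Hg : hom_category X Y).
pose (a' := exist _ a Ha : f' ⟶ g'); pose (b' := exist _ b Hb : f' ⟶ g').
assert (E : a' = b') by (apply (equivalence_faithful (proj2 EF X Y)), sig_ext; exact e).
exact (f_equal (@proj1_sig _ _) E).
Qed.

Lemma fun_full X Y f g c : is_arrow f X Y -> is_arrow g X Y ->
  is_cell c (fun1 F f) (fun1 F g) -> exists a, is_cell a f g /\ fun2 F a = c.
Proof.
intros Hf Hg Hc.
pose (f' := exist _ f Hf : hom_category X Y); pose (g' := exist _ g Hg : hom_category X Y).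
destruct (@equivalence_full _ _ (hom_functor F X Y) f' g' (exist _ c Hc) (proj2 EF X Y))
  as [[a Ha] e].
exists a; split; [exact Ha | exact (f_equal (@proj1_sig _ _) e)].
Qed.

Lemma fun_reflects_invertible X Y f g a : is_arrow f X Y -> is_arrow g X Y ->
  is_cell a f g -> invertible_cell (fun2 F a) -> invertible_cell a.
Proof.
intros Hf Hg Ha Ia.
destruct (invertible_cell_inverse (is_cell_fun F Ha) Ia) as (c & Hc & C1 & C2).
destruct (fun_full Hg Hf Hc) as (b & Hb & <-).
pose proof Ha as [A1 A2]; pose proof Hb as [B1 B2].
exists b; apply inverse_cells_intro with f g; trivial.
- apply (fun_faithful Hf Hf); eauto using is_cell_vcomp, is_cell_id2.
  rewrite fun_vcomp, fun_id2; congruence.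
- apply (fun_faithful Hg Hg); eauto using is_cell_vcomp, is_cell_id2.
  rewrite fun_vcomp, fun_id2; congruence.
Qed.

Lemma fun_surjective X Y h : is_arrow h (F X) (F Y) ->
  exists f c, is_arrow f X Y /\ is_cell c (fun1 F f) h /\ invertible_cell c.
Proof.
intros Hh; destruct (equivalence_surjective (F := hom_functor F X Y)
  (exist _ h Hh) (proj2 EF X Y)) as [[f Hf] [[[c Hc] [c' Hc'] E1 E2]]].
exists f, c; repeat (split; trivial); try apply Hc.
exists c'; apply inverse_cells_intro with (fun1 F f) h; trivial.
- exact (f_equal (@proj1_sig _ _) E1).
- exact (f_equal (@proj1_sig _ _) E2).
Qed.
End Functor.

(** * The braiding of a weak unit *)

Section Tensor.
Variable C : semimonoidal_two_category.
Implicit Types (f g h : arr C) (a b c : cel C) (X Y Z W I : obj C).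

Lemma tens_comp f f' g g' : tgt f = src f' -> tgt g = src g' ->
  (f # f') ⊗₁ (g # g') = (f ⊗₁ g) # (f' ⊗₁ g').
Proof. intros e e'; apply (@fun_comp _ _ (stens C) (f, g) (f', g')); simpl; now rewrite e, e'. Qed.

Lemma tens_hcomp a a' b b' : tgt (dom a) = src (dom a') -> tgt (dom b) = src (dom b') ->
  (a ## a') ⊗₂ (b ## b') = (a ⊗₂ b) ## (a' ⊗₂ b').
Proof. intros e e'; apply (@fun_hcomp _ _ (stens C) (a, b) (a', b')); simpl; now rewrite e, e'. Qed.

Lemma tens_id1 X Y : id1 X ⊗₁ id1 Y = id1 (X ⊗₀ Y).
Proof. exact (fun_id1 (stens C) (X, Y)). Qed.

Lemma tens_id2 f g : id2 f ⊗₂ id2 g = id2 (f ⊗₁ g).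
Proof. exact (fun_id2 (stens C) (f, g)). Qed.

Lemma comp_id_left X Y f : is_arrow f X Y -> id1 X # f = f.
Proof. intros [<- _]; apply comp_id_l. Qed.

Lemma comp_id_right X Y f : is_arrow f X Y -> f # id1 Y = f.
Proof. intros [_ <-]; apply comp_id_r. Qed.

Lemma left_left_arrow I X f : I ⋉₁ (X ⋉₁ f) = (I ⊗₀ X) ⋉₁ f.
Proof. now rewrite <- stens1A, tens_id1. Qed.

Lemma right_right_arrow I X f : (f ⋊₁ X) ⋊₁ I = f ⋊₁ (X ⊗₀ I).
Proof. now rewrite stens1A, tens_id1. Qed.

Lemma left_left_cell I X a : I ⋉₂ (X ⋉₂ a) = (I ⊗₀ X) ⋉₂ a.
Proof. now rewrite <- stens2A, tens_id2, tens_id1. Qed.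

Lemma right_right_cell I X a : (a ⋊₂ X) ⋊₂ I = a ⋊₂ (X ⊗₀ I).
Proof. now rewrite stens2A, tens_id2, tens_id1. Qed.

Lemma tens_right_left X Y Z W f g : is_arrow f X Y -> is_arrow g Z W ->
  (f ⋊₁ Z) # (Y ⋉₁ g) = f ⊗₁ g.
Proof.
intros Hf Hg; rewrite <- tens_comp, (comp_id_right Hf), (comp_id_left Hg); trivial.
- rewrite src_id1; apply Hf.
- rewrite tgt_id1; symmetry; apply Hg.
Qed.

Lemma tens_left_right X Y Z W f g : is_arrow f X Y -> is_arrow g Z W ->
  (X ⋉₁ g) # (f ⋊₁ W) = f ⊗₁ g.
Proof.
intros Hf Hg; rewrite <- tens_comp, (comp_id_left Hf), (comp_id_right Hg); trivial.
- rewrite tgt_id1; symmetry; apply Hf.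
- rewrite src_id1; apply Hg.
Qed.

Lemma tens_exchange X Y Z W f g : is_arrow f X Y -> is_arrow g Z W ->
  (X ⋉₁ g) # (f ⋊₁ W) = (f ⋊₁ Z) # (Y ⋉₁ g).
Proof. intros Hf Hg; now rewrite (tens_right_left Hf Hg), (tens_left_right Hf Hg). Qed.

Lemma tens_exchange_cell_left X Y Z W f g h a : is_arrow f X Y -> is_cell a f h ->
  is_arrow g Z W -> (a ⋊₂ Z) |> (Y ⋉₁ g) = (X ⋉₁ g) <| (a ⋊₂ W).
Proof.
intros [F1 F2] [A1 A2] [G1 G2]; pose proof (src_dom a); pose proof (tgt_dom a).
rewrite <- !tens_id2, <- !tens_hcomp by bd.
rewrite <- F2 at 1; rewrite <- F1, <- A1, hcomp_id_l, hcomp_id_r.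
f_equal; f_equal; rewrite <- G1, <- G2, !hcomp_id2 by bd; f_equal.
now rewrite comp_id_l, comp_id_r.
Qed.

Lemma tens_exchange_cell_right X Y Z W f g h a : is_arrow f X Y -> is_cell a g h ->
  is_arrow g Z W -> (f ⋊₁ Z) <| (Y ⋉₂ a) = (X ⋉₂ a) |> (f ⋊₁ W).
Proof.
intros [F1 F2] [A1 A2] [G1 G2]; pose proof (src_dom a); pose proof (tgt_dom a).
rewrite <- !tens_id2, <- !tens_hcomp by bd.
rewrite <- G1 at 1; rewrite <- G2, <- A1, hcomp_id_l, hcomp_id_r.
f_equal; f_equal; rewrite <- F1, <- F2, !hcomp_id2 by bd; f_equal.
now rewrite comp_id_l, comp_id_r.
Qed.

Lemma left_comp I f g : tgt f = src g -> I ⋉₁ (f # g) = (I ⋉₁ f) # (I ⋉₁ g).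
Proof. exact (@fun_comp _ _ (left_tensor I) f g). Qed.

Lemma right_comp I f g : tgt f = src g -> (f # g) ⋊₁ I = (f ⋊₁ I) # (g ⋊₁ I).
Proof. exact (@fun_comp _ _ (right_tensor I) f g). Qed.

Lemma left_vcomp I a b : cod a = dom b -> I ⋉₂ (a ;; b) = (I ⋉₂ a) ;; (I ⋉₂ b).
Proof. exact (@fun_vcomp _ _ (left_tensor I) a b). Qed.

Lemma right_vcomp I a b : cod a = dom b -> (a ;; b) ⋊₂ I = (a ⋊₂ I) ;; (b ⋊₂ I).
Proof. exact (@fun_vcomp _ _ (right_tensor I) a b). Qed.

Lemma left_hcomp I a b : tgt (dom a) = src (dom b) ->
  I ⋉₂ (a ## b) = (I ⋉₂ a) ## (I ⋉₂ b).
Proof. exact (@fun_hcomp _ _ (left_tensor I) a b). Qed.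

Lemma right_hcomp I a b : tgt (dom a) = src (dom b) ->
  (a ## b) ⋊₂ I = (a ⋊₂ I) ## (b ⋊₂ I).
Proof. exact (@fun_hcomp _ _ (right_tensor I) a b). Qed.

Lemma left_id2 I f : I ⋉₂ id2 f = id2 (I ⋉₁ f).
Proof. exact (fun_id2 (left_tensor I) f). Qed.

Lemma right_id2 I f : id2 f ⋊₂ I = id2 (f ⋊₁ I).
Proof. exact (fun_id2 (right_tensor I) f). Qed.

Lemma left_id1 I X : I ⋉₁ id1 X = id1 (I ⊗₀ X).
Proof. exact (fun_id1 (left_tensor I) X). Qed.

Lemma right_id1 I X : id1 X ⋊₁ I = id1 (X ⊗₀ I).
Proof. exact (fun_id1 (right_tensor I) X). Qed.

Lemma is_arrow_left I X Y f : is_arrow f X Y -> is_arrow (I ⋉₁ f) (I ⊗₀ X) (I ⊗₀ Y).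
Proof. exact (@is_arrow_fun _ _ (left_tensor I) X Y f). Qed.

Lemma is_arrow_right I X Y f : is_arrow f X Y -> is_arrow (f ⋊₁ I) (X ⊗₀ I) (Y ⊗₀ I).
Proof. exact (@is_arrow_fun _ _ (right_tensor I) X Y f). Qed.

Lemma is_cell_left I f g a : is_cell a f g -> is_cell (I ⋉₂ a) (I ⋉₁ f) (I ⋉₁ g).
Proof. exact (@is_cell_fun _ _ (left_tensor I) f g a). Qed.

Lemma is_cell_right I f g a : is_cell a f g -> is_cell (a ⋊₂ I) (f ⋊₁ I) (g ⋊₁ I).
Proof. exact (@is_cell_fun _ _ (right_tensor I) f g a). Qed.
End Tensor.

Ltac boundary :=
  repeat first
  [ match goal with
    | H : is_arrow ?f _ _ |- context [src ?f] => rewrite (proj1 H)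
    | H : is_arrow ?f _ _ |- context [tgt ?f] => rewrite (proj2 H)
    | H : is_cell ?a _ _ |- context [dom ?a] => rewrite (proj1 H)
    | H : is_cell ?a _ _ |- context [cod ?a] => rewrite (proj2 H)
    end
  | rewrite src_id1 | rewrite tgt_id1 | rewrite dom_id2 | rewrite cod_id2
  | rewrite src_comp by boundary | rewrite tgt_comp by boundary
  | rewrite dom_hcomp by boundary | rewrite cod_hcomp by boundary
  | rewrite dom_vcomp by boundary | rewrite cod_vcomp by boundary ];
  first [ reflexivity | rewrite ?compA by boundary; reflexivity ].

(** Uses an equality [E] between composites of two arrows inside longer ones. *)
Ltac junction E :=
  rewrite ?comp_id_r;
  repeat lazymatch goal with |- ?x # _ = ?x # _ => apply (f_equal (comp x)) end;
  first [ reflexivity | exact E | exact (eq_sym E)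
        | rewrite !compA by boundary; now rewrite E ].

(** * The 2-cells attached to a weak unit *)

Section Unit.
Variables (C : semimonoidal_two_category) (I : obj C) (alpha : arr C).
Hypothesis W : weak_unit I alpha.
Implicit Types (D : unit_choices I alpha).

Let Halpha : is_arrow alpha (I ⊗₀ I) I := proj1 (proj2 (proj2 W)).
Let Ealpha : equi_arrow alpha := proj2 (proj2 (proj2 W)).

Lemma left_faithful X Y f g a b : is_arrow f X Y -> is_arrow g X Y ->
  is_cell a f g -> is_cell b f g -> I ⋉₂ a = I ⋉₂ b -> a = b.
Proof. exact (@fun_faithful _ _ (left_tensor I) (proj1 W) X Y f g a b). Qed.

Lemma right_faithful X Y f g a b : is_arrow f X Y -> is_arrow g X Y ->
  is_cell a f g -> is_cell b f g -> a ⋊₂ I = b ⋊₂ I -> a = b.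
Proof. exact (@fun_faithful _ _ (right_tensor I) (proj1 (proj2 W)) X Y f g a b). Qed.

Lemma left_full X Y f g c : is_arrow f X Y -> is_arrow g X Y ->
  is_cell c (I ⋉₁ f) (I ⋉₁ g) -> exists a, is_cell a f g /\ I ⋉₂ a = c.
Proof. exact (@fun_full _ _ (left_tensor I) (proj1 W) X Y f g c). Qed.

Lemma right_full X Y f g c : is_arrow f X Y -> is_arrow g X Y ->
  is_cell c (f ⋊₁ I) (g ⋊₁ I) -> exists a, is_cell a f g /\ a ⋊₂ I = c.
Proof. exact (@fun_full _ _ (right_tensor I) (proj1 (proj2 W)) X Y f g c). Qed.

Lemma left_reflects_invertible X Y f g a : is_arrow f X Y -> is_arrow g X Y ->
  is_cell a f g -> invertible_cell (I ⋉₂ a) -> invertible_cell a.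
Proof. exact (@fun_reflects_invertible _ _ (left_tensor I) (proj1 W) X Y f g a). Qed.

Lemma right_reflects_invertible X Y f g a : is_arrow f X Y -> is_arrow g X Y ->
  is_cell a f g -> invertible_cell (a ⋊₂ I) -> invertible_cell a.
Proof. exact (@fun_reflects_invertible _ _ (right_tensor I) (proj1 (proj2 W)) X Y f g a). Qed.

Ltac arrow_facts H :=
  let H1 := fresh in let H2 := fresh in
  let H3 := fresh in let H4 := fresh in let H5 := fresh in let H6 := fresh in
  pose proof (is_arrow_left I H) as H1; pose proof (is_arrow_right I H) as H2;
  pose proof (is_arrow_left I H1) as H3; pose proof (is_arrow_left I H2) as H4;
  pose proof (is_arrow_right I H2) as H5; pose proof (is_arrow_right I H1) as H6;
  rewrite ?stens0A in H1; rewrite ?stens0A in H2; rewrite ?stens0A in H3;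
  rewrite ?stens0A in H4; rewrite ?stens0A in H5; rewrite ?stens0A in H6.

Lemma exchange_end f : is_arrow f I I ->
  (I ⋉₁ (I ⋉₁ f)) # (alpha ⋊₁ I) = (alpha ⋊₁ I) # (I ⋉₁ f) /\
  ((f ⋊₁ I) ⋊₁ I) # (I ⋉₁ alpha) = (I ⋉₁ alpha) # (f ⋊₁ I).
Proof.
intros Hf; rewrite left_left_arrow, right_right_arrow; split.
- apply (tens_exchange Halpha Hf).
- symmetry; apply (tens_exchange Hf Halpha).
Qed.

Lemma exchange_lam_rho lam rho : is_arrow lam (I ⊗₀ I) I -> is_arrow rho (I ⊗₀ I) I ->
  (I ⋉₁ (I ⋉₁ lam)) # (rho ⋊₁ I) = ((rho ⋊₁ I) ⋊₁ I) # (I ⋉₁ lam).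
Proof.
intros Hl Hr; rewrite left_left_arrow, right_right_arrow; apply (tens_exchange Hr Hl).
Qed.

Definition A_composite l li r ri : cel C :=
  ((I ⋉₂ li) ## r) ;; ((ri ⋊₂ I) ## l).

Lemma right_left_arrow f : (I ⋉₁ f) ⋊₁ I = I ⋉₁ (f ⋊₁ I).
Proof. apply stens1A. Qed.

(** Two choices of [lam] differ by a 2-cell [k] with [I ⋉₂ k = l ;; li'], because tensoring with [I]
    is full. The correction enters the composite once through [II k] and once through [I k].
    Whiskered with [rho] these two agree by the interchange of the tensor product ([E3]), so they
    cancel. *)
Lemma A_composite_indep_l lam l li lam' l' li' rho r ri :
  is_arrow lam (I ⊗₀ I) I -> is_arrow lam' (I ⊗₀ I) I -> is_arrow rho (I ⊗₀ I) I ->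
  is_cell l (I ⋉₁ lam) (alpha ⋊₁ I) -> is_cell l' (I ⋉₁ lam') (alpha ⋊₁ I) ->
  is_cell r (I ⋉₁ alpha) (rho ⋊₁ I) ->
  inverse_cells l li -> inverse_cells l' li' -> inverse_cells r ri ->
  A_composite l li r ri = A_composite l' li' r ri.
Proof.
intros Hlam Hlam' Hrho Hl Hl' Hr Il Il' Ir.
destruct (inverse_cells_elim Hl Il) as (Hli & L1 & L2).
destruct (inverse_cells_elim Hl' Il') as (Hli' & L1' & L2').
destruct (inverse_cells_elim Hr Ir) as (Hri & R1 & R2).
arrow_facts Halpha; arrow_facts Hlam; arrow_facts Hlam'; arrow_facts Hrho.
destruct (left_full Hlam Hlam' (c := l ;; li')) as (k & Hk & Ek).
{ pasting. }
pose proof (is_cell_left I Hk) as HIk; pose proof (is_cell_left I HIk) as HIIk.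
pose proof (is_cell_left I Hli); pose proof (is_cell_left I Hli').
pose proof (is_cell_right I Hri) as HriI.
pose proof (exchange_lam_rho Hlam Hrho) as X1.
pose proof (exchange_lam_rho Hlam' Hrho) as X2.
assert (E1 : l = (I ⋉₂ k) ;; l').
{ rewrite Ek; transitivity (l ;; (li' ;; l')); [rewrite L2'|]; pasting. }
assert (E2 : I ⋉₂ li' = (I ⋉₂ li) ;; (I ⋉₂ (I ⋉₂ k))).
{ rewrite <- left_vcomp by boundary; f_equal; f_equal.
  rewrite Ek; transitivity ((li ;; l) ;; li'); [rewrite L2|]; pasting. }
assert (E3 : (I ⋉₂ (I ⋉₂ k)) |> (rho ⋊₁ I) = ((rho ⋊₁ I) ⋊₁ I) <| (I ⋉₂ k)).
{ rewrite left_left_cell, right_right_arrow; symmetry.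
  apply (tens_exchange_cell_right Hrho Hk Hlam). }
unfold A_composite.
transitivity (((I ⋉₂ li) ## r) ;; (((rho ⋊₁ I) ⋊₁ I) <| (I ⋉₂ k)) ;; ((ri ⋊₂ I) ## l')).
- transitivity (((I ⋉₂ li) ## r) ;; ((ri ⋊₂ I) ## ((I ⋉₂ k) ;; l'))); [now rewrite <- E1|].
  apply f_equal; pasting_interchange.
- rewrite <- E3, E2.
  transitivity ((((I ⋉₂ li) ## r) ;; ((I ⋉₂ (I ⋉₂ k)) |> (rho ⋊₁ I))) ;; ((ri ⋊₂ I) ## l')).
  { pasting; junction X2. }
  f_equal; pasting_interchange.
Qed.

(** Mirror image of [A_composite_indep_l]: the correction [m] between the two choices of [rho] comes
    from fullness of tensoring on the right. *)
Lemma A_composite_indep_r lam l li rho r ri rho' r' ri' :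
  is_arrow lam (I ⊗₀ I) I -> is_arrow rho (I ⊗₀ I) I -> is_arrow rho' (I ⊗₀ I) I ->
  is_cell l (I ⋉₁ lam) (alpha ⋊₁ I) ->
  is_cell r (I ⋉₁ alpha) (rho ⋊₁ I) -> is_cell r' (I ⋉₁ alpha) (rho' ⋊₁ I) ->
  inverse_cells l li -> inverse_cells r ri -> inverse_cells r' ri' ->
  A_composite l li r ri = A_composite l li r' ri'.
Proof.
intros Hlam Hrho Hrho' Hl Hr Hr' Il Ir Ir'.
destruct (inverse_cells_elim Hl Il) as (Hli & L1 & L2).
destruct (inverse_cells_elim Hr Ir) as (Hri & R1 & R2).
destruct (inverse_cells_elim Hr' Ir') as (Hri' & R1' & R2').
arrow_facts Halpha; arrow_facts Hlam; arrow_facts Hrho'; arrow_facts Hrho.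
destruct (right_full Hrho Hrho' (c := ri ;; r')) as (m & Hm & Em).
{ pasting. }
pose proof (is_cell_right I Hm) as HmI; pose proof (is_cell_right I HmI) as HmII.
pose proof (is_cell_left I Hli).
pose proof (is_cell_right I Hri) as HriI; pose proof (is_cell_right I Hri') as HriI'.
pose proof (exchange_lam_rho Hlam Hrho) as X1.
pose proof (exchange_lam_rho Hlam Hrho') as X2.
assert (E1 : r' = r ;; (m ⋊₂ I)).
{ rewrite Em; transitivity ((r ;; ri) ;; r'); [rewrite R1|]; pasting. }
assert (E2 : ri ⋊₂ I = ((m ⋊₂ I) ⋊₂ I) ;; (ri' ⋊₂ I)).
{ rewrite <- right_vcomp by boundary; f_equal; f_equal.
  rewrite Em; transitivity (ri ;; (r' ;; ri')); [rewrite R1'|]; pasting. }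
assert (E3 : (I ⋉₁ (I ⋉₁ lam)) <| (m ⋊₂ I) = ((m ⋊₂ I) ⋊₂ I) |> (I ⋉₁ lam)).
{ rewrite left_left_arrow, right_right_cell; symmetry.
  apply (tens_exchange_cell_left Hrho Hm Hlam). }
unfold A_composite.
transitivity (((I ⋉₂ li) ## r) ;; (((m ⋊₂ I) ⋊₂ I) |> (I ⋉₁ lam)) ;; ((ri' ⋊₂ I) ## l)).
- rewrite E2; apply f_equal; pasting_interchange.
- rewrite <- E3, E1.
  transitivity ((((I ⋉₂ li) ## r) ;; ((I ⋉₁ (I ⋉₁ lam)) <| (m ⋊₂ I))) ;; ((ri' ⋊₂ I) ## l)).
  { pasting; junction X2. }
  f_equal; pasting_interchange.
Qed.

Lemma A_composite_typed lam l li rho r ri :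
  is_arrow lam (I ⊗₀ I) I -> is_arrow rho (I ⊗₀ I) I ->
  is_cell l (I ⋉₁ lam) (alpha ⋊₁ I) -> is_cell r (I ⋉₁ alpha) (rho ⋊₁ I) ->
  inverse_cells l li -> inverse_cells r ri ->
  is_cell (A_composite l li r ri) ((I ⋉₁ (alpha ⋊₁ I)) # (I ⋉₁ alpha))
    ((I ⋉₁ (alpha ⋊₁ I)) # (alpha ⋊₁ I)) /\
  invertible_cell (A_composite l li r ri).
Proof.
intros Hlam Hrho Hl Hr Il Ir.
destruct (inverse_cells_elim Hl Il) as (Hli & L1 & L2).
destruct (inverse_cells_elim Hr Ir) as (Hri & R1 & R2).
arrow_facts Halpha; arrow_facts Hlam; arrow_facts Hrho.
pose proof (is_cell_left I Hli) as HIli.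
pose proof (is_cell_right I Hri) as HriI; rewrite right_left_arrow in HriI.
pose proof (exchange_lam_rho Hlam Hrho) as X1; unfold A_composite; split.
- pasting; junction X1.
- apply (invertible_vcomp (f := (I ⋉₁ (alpha ⋊₁ I)) # (I ⋉₁ alpha))
    (g := (I ⋉₁ (I ⋉₁ lam)) # (rho ⋊₁ I)) (h := (I ⋉₁ (alpha ⋊₁ I)) # (alpha ⋊₁ I))).
  + pasting.
  + pasting; junction X1.
  + apply invertible_hcomp; [boundary| |exists ri; trivial].
    apply (invertible_fun (left_tensor I)); now apply invertible_inverse with l.
  + apply invertible_hcomp; [boundary| |exists li; trivial].
    apply (invertible_fun (right_tensor I)); now apply invertible_inverse with r.
Qed.

Lemma equi_left f : equi_arrow f -> equi_arrow (I ⋉₁ f).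
Proof. exact (@equi_arrow_fun _ _ (left_tensor I) f). Qed.

Lemma equi_right f : equi_arrow f -> equi_arrow (f ⋊₁ I).
Proof. exact (@equi_arrow_fun _ _ (right_tensor I) f). Qed.

(** Whiskering with the equi-arrow [I ⋉₁ (alpha ⋊₁ I)] is faithful, and the right-hand sides agree
    by independence. Not being phrased with [unit_choices], it also compares [uc_A] with a solution
    found by hand, which is how [A] is computed on strands. *)
Lemma A_unique lam l li rho r ri lam' l' li' rho' r' ri' A A' :
  is_arrow lam (I ⊗₀ I) I -> is_arrow rho (I ⊗₀ I) I ->
  is_cell l (I ⋉₁ lam) (alpha ⋊₁ I) -> is_cell r (I ⋉₁ alpha) (rho ⋊₁ I) ->
  inverse_cells l li -> inverse_cells r ri ->
  is_arrow lam' (I ⊗₀ I) I -> is_arrow rho' (I ⊗₀ I) I ->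
  is_cell l' (I ⋉₁ lam') (alpha ⋊₁ I) -> is_cell r' (I ⋉₁ alpha) (rho' ⋊₁ I) ->
  inverse_cells l' li' -> inverse_cells r' ri' ->
  is_cell A (I ⋉₁ alpha) (alpha ⋊₁ I) -> is_cell A' (I ⋉₁ alpha) (alpha ⋊₁ I) ->
  (I ⋉₁ (alpha ⋊₁ I)) <| A = A_composite l li r ri ->
  (I ⋉₁ (alpha ⋊₁ I)) <| A' = A_composite l' li' r' ri' -> A = A'.
Proof.
intros Hlam Hrho Hl Hr Il Ir Hlam' Hrho' Hl' Hr' Il' Ir' HA HA' E E'.
arrow_facts Halpha.
eapply (whisker_l_faithful (e := I ⋉₁ (alpha ⋊₁ I))); [eassumption | | | | exact HA | exact HA' | ]; try eassumption.
- now apply equi_left, equi_right.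
- rewrite E, E', (A_composite_indep_l Hlam Hlam' Hrho Hl Hl' Hr Il Il' Ir).
  now apply A_composite_indep_r with lam' rho rho'.
Qed.

Lemma choices_A_unique D D' : uc_A D = uc_A D' /\ uc_Ai D = uc_Ai D'.
Proof.
assert (E : uc_A D = uc_A D').
{ exact (A_unique (uc_lam_arrow D) (uc_rho_arrow D) (uc_l_cell D) (uc_r_cell D)
    (uc_l_inv D) (uc_r_inv D) (uc_lam_arrow D') (uc_rho_arrow D') (uc_l_cell D')
    (uc_r_cell D') (uc_l_inv D') (uc_r_inv D') (uc_A_cell D) (uc_A_cell D')
    (uc_A_eq D) (uc_A_eq D')). }
split; trivial; apply inverse_cells_unique with (uc_A D); [apply uc_A_inv|].
rewrite E; apply uc_A_inv.
Qed.

(** The ingredients come from propositional existence statements, so the record, which is a type, is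
    only shown to be inhabited by means of [exists]. *)
Lemma unit_choices_exist : exists D : unit_choices I alpha, True.
Proof.
arrow_facts Halpha.
destruct (@fun_surjective _ _ (left_tensor I) (proj1 W) (I ⊗₀ I) I (alpha ⋊₁ I))
  as (lam & l & Hlam & Hl & li & Il); [eassumption|]; simpl in Hl.
destruct (@fun_surjective _ _ (right_tensor I) (proj1 (proj2 W)) (I ⊗₀ I) I (I ⋉₁ alpha))
  as (rho & ri & Hrho & Hri & r & Ir).
{ simpl; rewrite stens0A; eassumption. }
simpl in Hri.
(* Essential surjectivity gives a 2-cell out of [rho ⋊₁ I], which is the inverse of [r]; the roles
   are exchanged here. *)
destruct (inverse_cells_elim Hri Ir) as (Hr & R1 & R2); apply inverse_cells_sym in Ir.
destruct (A_composite_typed Hlam Hrho Hl Hr Il Ir) as [HX IX].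
assert (Eq : equi_arrow (I ⋉₁ (alpha ⋊₁ I))) by now apply equi_left, equi_right.
assert (HIa : is_arrow (I ⋉₁ alpha) (I ⊗₀ I ⊗₀ I) (I ⊗₀ I)) by assumption.
assert (HaI : is_arrow (alpha ⋊₁ I) (I ⊗₀ I ⊗₀ I) (I ⊗₀ I)) by assumption.
assert (HIaI : is_arrow (I ⋉₁ (alpha ⋊₁ I)) (I ⊗₀ I ⊗₀ I ⊗₀ I) (I ⊗₀ I ⊗₀ I)) by assumption.
destruct (whisker_l_full HIaI Eq HIa HaI HX) as (A & HA & EA).
assert (IA : invertible_cell A).
{ apply (whisker_l_invertible HIaI Eq HIa HaI HA); now rewrite EA. }
destruct IA as [Ai IA].
destruct (adjoint_equivalence Halpha Ealpha)
  as (beta & eta & E & Hbeta & Heta & Ieta & HE & [Ei IE] & T1 & T2).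
arrow_facts Hbeta.
destruct (inverse_cells_elim HE IE) as (HEi & E1 & E2).
pose proof (is_cell_right I HE) as HEI; pose proof (is_cell_left I HEi) as HIEi.
pose proof (is_cell_left I HE) as HIE.
rewrite right_comp, right_id1 in HEI by boundary.
rewrite left_comp, left_id1 in HIEi by boundary.
rewrite left_comp, left_id1 in HIE by boundary.
(* The equation defining [B] is solved for [B |> (I ⋉₁ alpha)] by moving [I ⋉₂ E] to the other side.
   Whiskering with the equi-arrow [I ⋉₁ alpha] is full, which gives [B]. *)
assert (HX' : is_cell (((beta ⋊₁ I) <| A) ;; (E ⋊₂ I) ;; (I ⋉₂ Ei))
  ((beta ⋊₁ I) # (I ⋉₁ alpha)) ((I ⋉₁ beta) # (I ⋉₁ alpha))) by pasting.
assert (EI : equi_arrow (I ⋉₁ alpha)) by now apply equi_left.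
assert (HbI : is_arrow (beta ⋊₁ I) (I ⊗₀ I) (I ⊗₀ I ⊗₀ I)) by assumption.
assert (HIb : is_arrow (I ⋉₁ beta) (I ⊗₀ I) (I ⊗₀ I ⊗₀ I)) by assumption.
destruct (whisker_r_full HIa EI HbI HIb HX') as (B & HB & EB).
assert (IB : invertible_cell B).
{ apply (whisker_r_invertible HIa EI HbI HIb HB).
  rewrite EB.
  assert (I1 : invertible_cell ((beta ⋊₁ I) <| A)).
  { apply invertible_hcomp; [boundary|apply invertible_id2|now exists Ai]. }
  assert (I2 : invertible_cell (E ⋊₂ I)).
  { apply (invertible_fun (right_tensor I)); now exists Ei. }
  assert (I3 : invertible_cell (I ⋉₂ Ei)).
  { apply (invertible_fun (left_tensor I)); now apply invertible_inverse with E. }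
  apply (invertible_vcomp (f := (beta ⋊₁ I) # (I ⋉₁ alpha)) (g := (beta ⋊₁ I) # (alpha ⋊₁ I))
    (h := (I ⋉₁ beta) # (I ⋉₁ alpha))); trivial; try solve [pasting].
  now apply (invertible_vcomp HEI HIEi). }
destruct IB as [Bi IB].
unshelve eexists (@UnitChoices _ _ _ lam Hlam l li Hl Il rho Hrho r ri Hr Ir A Ai HA IA EA
  beta Hbeta eta Heta Ieta E Ei HE IE T1 T2 B Bi HB IB _); trivial.
rewrite EB; transitivity (((beta ⋊₁ I) <| A) ;; (E ⋊₂ I) ;; ((I ⋉₂ Ei) ;; (I ⋉₂ E))); [pasting|].
rewrite <- left_vcomp, E2, left_id2, left_id1 by boundary; pasting.
Qed.

Ltac choice_facts D :=
  let Hb := fresh "Hbeta" in let HA := fresh "HA" in let HAi := fresh "HAi" in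
  let HE := fresh "HE" in let HEi := fresh "HEi" in let HB := fresh "HB" in
  let HBi := fresh "HBi" in let HIE := fresh "HIE" in let HEI := fresh "HEI" in
  pose proof (uc_A_cell D) as HA; pose proof (uc_E_cell D) as HE;
  pose proof (uc_B_cell D) as HB; pose proof (uc_beta_arrow D) as Hb;
  arrow_facts Halpha; arrow_facts Hb;
  destruct (inverse_cells_elim HA (uc_A_inv D)) as (HAi & ?A_Ai & ?Ai_A);
  destruct (inverse_cells_elim HE (uc_E_inv D)) as (HEi & ?E_Ei & ?Ei_E);
  destruct (inverse_cells_elim HB (uc_B_inv D)) as (HBi & ?B_Bi & ?Bi_B);
  pose proof (is_cell_right I HE) as HEI; pose proof (is_cell_left I HE) as HIE;
  rewrite right_comp, right_id1 in HEI by boundary;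
  rewrite left_comp, left_id1 in HIE by boundary.

Lemma exchange_end_beta D f : is_arrow f I I ->
  (I ⋉₁ f) # (uc_beta D ⋊₁ I) = (uc_beta D ⋊₁ I) # (I ⋉₁ (I ⋉₁ f)) /\
  (f ⋊₁ I) # (I ⋉₁ uc_beta D) = (I ⋉₁ uc_beta D) # ((f ⋊₁ I) ⋊₁ I).
Proof.
intros Hf; rewrite left_left_arrow, right_right_arrow; split.
- apply (tens_exchange (uc_beta_arrow D) Hf).
- symmetry; apply (tens_exchange Hf (uc_beta_arrow D)).
Qed.

(** The prescribed value [c] of [I ⋉₂ L] is well typed thanks to the strict equality [exchange_end].
    Tensoring with [I] is full and reflects invertibility. The three lemmas that follow use the same
    argument, on the right for [R] and with [exchange_end_beta] for the barred 2-cells. *)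
Lemma L_exists D f : is_arrow f I I -> exists L, is_L D f L.
Proof.
intros Hf; arrow_facts Hf; choice_facts D; destruct (exchange_end Hf) as [X1 X2].
pose (c := (I ⋉₁ (I ⋉₁ f)) <| uc_A D ;; uc_Ai D |> (I ⋉₁ f)).
assert (T1 : is_arrow ((I ⋉₁ f) # alpha) (I ⊗₀ I) I) by (split; boundary).
assert (T2 : is_arrow (alpha # f) (I ⊗₀ I) I) by (split; boundary).
destruct (left_full T1 T2 (c := c)) as (L & HL & EL).
{ rewrite !left_comp by boundary; unfold c; pasting; junction X1. }
exists L; repeat (split; trivial).
apply (left_reflects_invertible T1 T2 HL); rewrite EL; unfold c.
apply (invertible_vcomp (f := (I ⋉₁ (I ⋉₁ f)) # (I ⋉₁ alpha))
  (g := (I ⋉₁ (I ⋉₁ f)) # (alpha ⋊₁ I)) (h := (I ⋉₁ alpha) # (I ⋉₁ f))).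
- pasting.
- pasting; junction X1.
- apply invertible_hcomp; [boundary|apply invertible_id2|exists (uc_Ai D); apply uc_A_inv].
- apply invertible_hcomp; [boundary| |apply invertible_id2].
  apply invertible_inverse with (uc_A D); apply uc_A_inv.
Qed.

Lemma R_exists D f : is_arrow f I I -> exists R, is_R D f R.
Proof.
intros Hf; arrow_facts Hf; choice_facts D; destruct (exchange_end Hf) as [X1 X2].
pose (c := ((f ⋊₁ I) ⋊₁ I) <| uc_Ai D ;; uc_A D |> (f ⋊₁ I)).
assert (T1 : is_arrow ((f ⋊₁ I) # alpha) (I ⊗₀ I) I) by (split; boundary).
assert (T2 : is_arrow (alpha # f) (I ⊗₀ I) I) by (split; boundary).
destruct (right_full T1 T2 (c := c)) as (R & HR & ER).
{ rewrite !right_comp by boundary; unfold c; pasting; junction X2. }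
exists R; repeat (split; trivial).
apply (right_reflects_invertible T1 T2 HR); rewrite ER; unfold c.
apply (invertible_vcomp (f := ((f ⋊₁ I) ⋊₁ I) # (alpha ⋊₁ I))
  (g := ((f ⋊₁ I) ⋊₁ I) # (I ⋉₁ alpha)) (h := (alpha ⋊₁ I) # (f ⋊₁ I))).
- pasting.
- pasting; junction X2.
- apply invertible_hcomp; [boundary|apply invertible_id2|].
  apply invertible_inverse with (uc_A D); apply uc_A_inv.
- apply invertible_hcomp; [boundary| |apply invertible_id2].
  exists (uc_Ai D); apply uc_A_inv.
Qed.

Lemma Lbar_exists D f : is_arrow f I I -> exists L, is_Lbar D f L.
Proof.
intros Hf; arrow_facts Hf; choice_facts D; destruct (exchange_end_beta D Hf) as [X1 X2].
pose (c := uc_Bi D |> (I ⋉₁ (I ⋉₁ f)) ;; (I ⋉₁ f) <| uc_B D).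
assert (T1 : is_arrow (uc_beta D # (I ⋉₁ f)) I (I ⊗₀ I)) by (split; boundary).
assert (T2 : is_arrow (f # uc_beta D) I (I ⊗₀ I)) by (split; boundary).
destruct (left_full T1 T2 (c := c)) as (L & HL & EL).
{ rewrite !left_comp by boundary; unfold c; pasting; junction X1. }
exists L; repeat (split; trivial).
apply (left_reflects_invertible T1 T2 HL); rewrite EL; unfold c.
apply (invertible_vcomp (f := (I ⋉₁ uc_beta D) # (I ⋉₁ (I ⋉₁ f)))
  (g := (uc_beta D ⋊₁ I) # (I ⋉₁ (I ⋉₁ f))) (h := (I ⋉₁ f) # (I ⋉₁ uc_beta D))).
- pasting.
- pasting; junction X1.
- apply invertible_hcomp; [boundary| |apply invertible_id2].
  apply invertible_inverse with (uc_B D); apply uc_B_inv.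
- apply invertible_hcomp; [boundary|apply invertible_id2|].
  exists (uc_Bi D); apply uc_B_inv.
Qed.

Lemma Rbar_exists D f : is_arrow f I I -> exists R, is_Rbar D f R.
Proof.
intros Hf; arrow_facts Hf; choice_facts D; destruct (exchange_end_beta D Hf) as [X1 X2].
pose (c := uc_B D |> ((f ⋊₁ I) ⋊₁ I) ;; (f ⋊₁ I) <| uc_Bi D).
assert (T1 : is_arrow (uc_beta D # (f ⋊₁ I)) I (I ⊗₀ I)) by (split; boundary).
assert (T2 : is_arrow (f # uc_beta D) I (I ⊗₀ I)) by (split; boundary).
destruct (right_full T1 T2 (c := c)) as (R & HR & ER).
{ rewrite !right_comp by boundary; unfold c; pasting; junction X2. }
exists R; repeat (split; trivial).
apply (right_reflects_invertible T1 T2 HR); rewrite ER; unfold c.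
apply (invertible_vcomp (f := (uc_beta D ⋊₁ I) # ((f ⋊₁ I) ⋊₁ I))
  (g := (I ⋉₁ uc_beta D) # ((f ⋊₁ I) ⋊₁ I)) (h := (f ⋊₁ I) # (uc_beta D ⋊₁ I))).
- pasting.
- pasting; junction X2.
- apply invertible_hcomp; [boundary| |apply invertible_id2].
  exists (uc_Bi D); apply uc_B_inv.
- apply invertible_hcomp; [boundary|apply invertible_id2|].
  apply invertible_inverse with (uc_B D); apply uc_B_inv.
Qed.

(** The records [D] and [D'] may differ: they enter only through [uc_A] and its inverse, which do
    not depend on the choices. *)
Lemma L_unique D D' f L L' : is_arrow f I I -> is_L D f L -> is_L D' f L' -> L = L'.
Proof.
intros Hf (HL & _ & EL) (HL' & _ & EL').
apply (left_faithful (X := I ⊗₀ I) (Y := I) (f := (I ⋉₁ f) # alpha) (g := alpha # f)); trivial.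
- arrow_facts Hf; split; boundary.
- split; boundary.
- destruct (choices_A_unique D D') as [E1 E2]; now rewrite EL, EL', E1, E2.
Qed.

Lemma R_unique D D' f R R' : is_arrow f I I -> is_R D f R -> is_R D' f R' -> R = R'.
Proof.
intros Hf (HR & _ & ER) (HR' & _ & ER').
apply (right_faithful (X := I ⊗₀ I) (Y := I) (f := (f ⋊₁ I) # alpha) (g := alpha # f)); trivial.
- arrow_facts Hf; split; boundary.
- split; boundary.
- destruct (choices_A_unique D D') as [E1 E2]; now rewrite ER, ER', E1, E2.
Qed.

(** After tensoring with [I], the 2-cell [a] slides past [A] and its inverse by interchange in the
    2-category. Between the two it crosses [alpha ⋊₁ I] by interchange of the tensor product
    ([X2]). *)
Lemma L_natural D f f' L L' a : is_arrow f I I -> is_arrow f' I I -> is_cell a f f' ->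
  is_L D f L -> is_L D f' L' -> ((I ⋉₂ a) |> alpha) ;; L' = L ;; (alpha <| a).
Proof.
intros Hf Hf' Ha (HL & _ & EL) (HL' & _ & EL').
arrow_facts Hf; arrow_facts Hf'; choice_facts D.
destruct (exchange_end Hf) as [X1 _]; destruct (exchange_end Hf') as [X1' _].
pose proof (is_cell_left I Ha) as HIa; pose proof (is_cell_left I HIa) as HIIa.
assert (X2 : (alpha ⋊₁ I) <| (I ⋉₂ a) = (I ⋉₂ (I ⋉₂ a)) |> (alpha ⋊₁ I)).
{ rewrite left_left_cell; apply (tens_exchange_cell_right Halpha Ha Hf). }
apply (left_faithful (X := I ⊗₀ I) (Y := I) (f := (I ⋉₁ f) # alpha) (g := alpha # f'));
  try solve [split; boundary | pasting].
rewrite !left_vcomp, !left_hcomp, EL, EL', !left_id2 by boundary.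
transitivity ((((I ⋉₂ (I ⋉₂ a)) |> (I ⋉₁ alpha)) ;; ((I ⋉₁ (I ⋉₁ f')) <| uc_A D)) ;;
  (uc_Ai D |> (I ⋉₁ f'))); [pasting; junction X1'|].
transitivity ((((I ⋉₁ (I ⋉₁ f)) <| uc_A D) ;; ((I ⋉₂ (I ⋉₂ a)) |> (alpha ⋊₁ I))) ;;
  (uc_Ai D |> (I ⋉₁ f'))); [f_equal; pasting_interchange|].
rewrite <- X2.
transitivity (((I ⋉₁ (I ⋉₁ f)) <| uc_A D) ;; (((alpha ⋊₁ I) <| (I ⋉₂ a)) ;;
  (uc_Ai D |> (I ⋉₁ f')))); [pasting; junction X1|].
transitivity (((I ⋉₁ (I ⋉₁ f)) <| uc_A D) ;; ((uc_Ai D |> (I ⋉₁ f)) ;;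
  ((I ⋉₁ alpha) <| (I ⋉₂ a)))); [f_equal; pasting_interchange|pasting; junction X1].
Qed.

Lemma R_natural D f f' R R' a : is_arrow f I I -> is_arrow f' I I -> is_cell a f f' ->
  is_R D f R -> is_R D f' R' -> ((a ⋊₂ I) |> alpha) ;; R' = R ;; (alpha <| a).
Proof.
intros Hf Hf' Ha (HR & _ & ER) (HR' & _ & ER').
arrow_facts Hf; arrow_facts Hf'; choice_facts D.
destruct (exchange_end Hf) as [_ X1]; destruct (exchange_end Hf') as [_ X1'].
pose proof (is_cell_right I Ha) as HaI; pose proof (is_cell_right I HaI) as HaII.
assert (X2 : (I ⋉₁ alpha) <| (a ⋊₂ I) = ((a ⋊₂ I) ⋊₂ I) |> (I ⋉₁ alpha)).
{ rewrite right_right_cell; symmetry; apply (tens_exchange_cell_left Hf Ha Halpha). }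
apply (right_faithful (X := I ⊗₀ I) (Y := I) (f := (f ⋊₁ I) # alpha) (g := alpha # f'));
  try solve [split; boundary | pasting].
rewrite !right_vcomp, !right_hcomp, ER, ER', !right_id2 by boundary.
transitivity (((((a ⋊₂ I) ⋊₂ I) |> (alpha ⋊₁ I)) ;; (((f' ⋊₁ I) ⋊₁ I) <| uc_Ai D)) ;;
  (uc_A D |> (f' ⋊₁ I))); [pasting; junction X1'|].
transitivity (((((f ⋊₁ I) ⋊₁ I) <| uc_Ai D) ;; (((a ⋊₂ I) ⋊₂ I) |> (I ⋉₁ alpha))) ;;
  (uc_A D |> (f' ⋊₁ I))); [f_equal; pasting_interchange|].
rewrite <- X2.
transitivity ((((f ⋊₁ I) ⋊₁ I) <| uc_Ai D) ;; (((I ⋉₁ alpha) <| (a ⋊₂ I)) ;;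
  (uc_A D |> (f' ⋊₁ I)))); [pasting; junction X1|].
transitivity ((((f ⋊₁ I) ⋊₁ I) <| uc_Ai D) ;; ((uc_A D |> (f ⋊₁ I)) ;;
  ((alpha ⋊₁ I) <| (a ⋊₂ I)))); [f_equal; pasting_interchange|pasting; junction X1].
Qed.

(** After tensoring with [I], the inverse of [A] coming from [M] meets the [A] coming from [L] and
    they cancel. This compatibility with [#], together with [R_comp], is the source of the
    hexagons. *)
Lemma L_comp D f g L M : is_arrow f I I -> is_arrow g I I ->
  is_L D f L -> is_L D g M -> is_L D (f # g) (((I ⋉₁ f) <| M) ;; (L |> g)).
Proof.
intros Hf Hg (HL & IL & EL) (HM & IM & EM).
arrow_facts Hf; arrow_facts Hg; choice_facts D.
destruct (exchange_end Hf) as [X1 _]; destruct (exchange_end Hg) as [X1' _].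
assert (EI : I ⋉₁ (f # g) = (I ⋉₁ f) # (I ⋉₁ g)) by now rewrite left_comp by boundary.
split; [|split].
- rewrite EI; pasting.
- apply (invertible_vcomp (f := (I ⋉₁ f) # ((I ⋉₁ g) # alpha)) (g := (I ⋉₁ f) # (alpha # g))
    (h := (alpha # f) # g)); try solve [pasting];
    (apply invertible_hcomp; [boundary| |]; trivial using invertible_id2).
- rewrite EI, left_vcomp, !left_hcomp, EL, EM, !left_id2, left_comp by boundary.
  transitivity (((I ⋉₁ (I ⋉₁ f)) # (I ⋉₁ (I ⋉₁ g))) <| uc_A D ;;
    ((I ⋉₁ (I ⋉₁ f)) <| (uc_Ai D ;; uc_A D)) |> (I ⋉₁ g) ;;
    (uc_Ai D |> ((I ⋉₁ f) # (I ⋉₁ g)))).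
  + pasting; try junction X1; try junction X1'.
  + rewrite Ai_A; pasting; try junction X1; try junction X1';
    rewrite !comp_id_r, X1', !compA by boundary; now rewrite X1.
Qed.

Lemma R_comp D f g L M : is_arrow f I I -> is_arrow g I I ->
  is_R D f L -> is_R D g M -> is_R D (f # g) (((f ⋊₁ I) <| M) ;; (L |> g)).
Proof.
intros Hf Hg (HL & IL & EL) (HM & IM & EM).
arrow_facts Hf; arrow_facts Hg; choice_facts D.
destruct (exchange_end Hf) as [_ X1]; destruct (exchange_end Hg) as [_ X1'].
assert (EI : (f # g) ⋊₁ I = (f ⋊₁ I) # (g ⋊₁ I)) by now rewrite right_comp by boundary.
split; [|split].
- rewrite EI; pasting.
- apply (invertible_vcomp (f := (f ⋊₁ I) # ((g ⋊₁ I) # alpha)) (g := (f ⋊₁ I) # (alpha # g))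
    (h := (alpha # f) # g)); try solve [pasting];
    (apply invertible_hcomp; [boundary| |]; trivial using invertible_id2).
- rewrite EI, right_vcomp, !right_hcomp, EL, EM, !right_id2, right_comp by boundary.
  transitivity ((((f ⋊₁ I) ⋊₁ I) # ((g ⋊₁ I) ⋊₁ I)) <| uc_Ai D ;;
    (((f ⋊₁ I) ⋊₁ I) <| (uc_A D ;; uc_Ai D)) |> (g ⋊₁ I) ;;
    (uc_A D |> ((f ⋊₁ I) # (g ⋊₁ I)))).
  + pasting; try junction X1; try junction X1'.
  + rewrite A_Ai; pasting; try junction X1; try junction X1';
    rewrite !comp_id_r, X1', !compA by boundary; now rewrite X1.
Qed.

(** [Lbar] and [L] are mates: moving [f] across [β] and then removing [β # α] is the same as moving
    it across [α] first. This is the relation by which [β] is eliminated from [T]. It holds because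
    the equation for [B] trades [I ⋉₂ E] for [E ⋊₂ I], which commutes with [I ⋉₁ f] ([X3]). *)
Lemma Lbar_compat D f L Lbar : is_arrow f I I -> is_L D f L -> is_Lbar D f Lbar ->
  (Lbar |> alpha) ;; (f <| uc_E D) = (uc_beta D <| L) ;; (uc_E D |> f).
Proof.
intros Hf (HL & IL & EL) (HM & IM & EM).
arrow_facts Hf; choice_facts D; destruct (exchange_end Hf) as [X1 _].
destruct (exchange_end_beta D Hf) as [X2 _].
assert (X3 : (I ⋉₁ f) <| (uc_E D ⋊₂ I) = (uc_E D ⋊₂ I) |> (I ⋉₁ f)).
{ symmetry; apply (tens_exchange_cell_left (f := uc_beta D # alpha) (h := id1 I)); trivial.
  split; boundary. }
apply (left_faithful (X := I) (Y := I) (f := uc_beta D # (I ⋉₁ f) # alpha) (g := f));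
  try solve [split; boundary | pasting].
rewrite !left_vcomp, !left_hcomp, EL, EM, !left_id2 by boundary.
(* Composing first with [B] cancels the inverse of [B] inside [I ⋉₂ Lbar]. On the other side it can
   be carried past [A] and its inverse until it meets [I ⋉₂ E], where [uc_B_eq] applies. *)
apply (@vcomp_cancel_l _ ((uc_beta D ⋊₁ I) # (I ⋉₁ (I ⋉₁ f)) # (I ⋉₁ alpha))
  ((I ⋉₁ uc_beta D) # (I ⋉₁ (I ⋉₁ f)) # (I ⋉₁ alpha)) (I ⋉₁ f)
  (uc_B D |> ((I ⋉₁ (I ⋉₁ f)) # (I ⋉₁ alpha)))).
- pasting.
- pasting; junction X2.
- pasting; junction X1.
- apply invertible_hcomp; [boundary| |apply invertible_id2].
  exists (uc_Bi D); apply uc_B_inv.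
- pose proof (uc_B_eq D) as EB.
  transitivity (((uc_B D ;; uc_Bi D) |> ((I ⋉₁ (I ⋉₁ f)) # (I ⋉₁ alpha))) ;;
    ((I ⋉₁ f) <| ((uc_B D |> (I ⋉₁ alpha)) ;; (I ⋉₂ uc_E D)))); [pasting; junction X2|].
  rewrite EB, B_Bi.
  transitivity ((((I ⋉₁ f) # (uc_beta D ⋊₁ I)) <| uc_A D) ;;
    ((I ⋉₁ f) <| (uc_E D ⋊₂ I))); [pasting; junction X2|].
  rewrite X2, X3; symmetry.
  transitivity (((uc_B D |> ((I ⋉₁ (I ⋉₁ f)) # (I ⋉₁ alpha))) ;;
    (((I ⋉₁ uc_beta D) # (I ⋉₁ (I ⋉₁ f))) <| uc_A D)) ;;
    (((I ⋉₁ uc_beta D) <| uc_Ai D) |> (I ⋉₁ f) ;; (I ⋉₂ uc_E D) |> (I ⋉₁ f)));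
    [pasting; junction X1|].
  transitivity (((((uc_beta D ⋊₁ I) # (I ⋉₁ (I ⋉₁ f))) <| uc_A D) ;;
    (uc_B D |> ((I ⋉₁ (I ⋉₁ f)) # (alpha ⋊₁ I)))) ;;
    (((I ⋉₁ uc_beta D) <| uc_Ai D) |> (I ⋉₁ f) ;; (I ⋉₂ uc_E D) |> (I ⋉₁ f)));
    [f_equal; pasting_interchange|].
  rewrite X1.
  transitivity ((((uc_beta D ⋊₁ I) # (I ⋉₁ (I ⋉₁ f))) <| uc_A D) ;;
    ((uc_B D |> ((alpha ⋊₁ I) # (I ⋉₁ f))) ;; ((I ⋉₁ uc_beta D) <| uc_Ai D) |> (I ⋉₁ f)) ;;
    ((I ⋉₂ uc_E D) |> (I ⋉₁ f))); [pasting; junction X1|].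
  transitivity ((((uc_beta D ⋊₁ I) # (I ⋉₁ (I ⋉₁ f))) <| uc_A D) ;;
    (((uc_beta D ⋊₁ I) <| uc_Ai D) |> (I ⋉₁ f) ;; (uc_B D |> ((I ⋉₁ alpha) # (I ⋉₁ f)))) ;;
    ((I ⋉₂ uc_E D) |> (I ⋉₁ f))); [f_equal; f_equal; pasting_interchange|].
  transitivity ((((uc_beta D ⋊₁ I) # (I ⋉₁ (I ⋉₁ f))) <| uc_A D) ;;
    ((uc_beta D ⋊₁ I) <| uc_Ai D) |> (I ⋉₁ f) ;;
    ((uc_B D |> (I ⋉₁ alpha) ;; (I ⋉₂ uc_E D)) |> (I ⋉₁ f))); [pasting; junction X1|].
  rewrite EB.
  transitivity ((((uc_beta D ⋊₁ I) # (I ⋉₁ (I ⋉₁ f))) <| uc_A D) ;;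
    ((uc_beta D ⋊₁ I) <| (uc_Ai D ;; uc_A D)) |> (I ⋉₁ f) ;;
    ((uc_E D ⋊₂ I) |> (I ⋉₁ f))); [pasting; junction X1|].
  rewrite Ai_A; pasting; junction X1.
Qed.

Lemma Rbar_compat D f R Rbar : is_arrow f I I -> is_R D f R -> is_Rbar D f Rbar ->
  (Rbar |> alpha) ;; (f <| uc_E D) = (uc_beta D <| R) ;; (uc_E D |> f).
Proof.
intros Hf (HR & IR & ER) (HM & IM & EM).
arrow_facts Hf; choice_facts D; destruct (exchange_end Hf) as [_ X1].
destruct (exchange_end_beta D Hf) as [_ X2].
assert (X3 : (f ⋊₁ I) <| (I ⋉₂ uc_E D) = (I ⋉₂ uc_E D) |> (f ⋊₁ I)).
{ apply (tens_exchange_cell_right (g := uc_beta D # alpha) (h := id1 I) (X := I) (Y := I));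
  trivial; split; boundary. }
apply (right_faithful (X := I) (Y := I) (f := uc_beta D # (f ⋊₁ I) # alpha) (g := f));
  try solve [split; boundary | pasting].
rewrite !right_vcomp, !right_hcomp, ER, EM, !right_id2 by boundary.
apply (@vcomp_cancel_l _ ((I ⋉₁ uc_beta D) # ((f ⋊₁ I) ⋊₁ I) # (alpha ⋊₁ I))
  ((uc_beta D ⋊₁ I) # ((f ⋊₁ I) ⋊₁ I) # (alpha ⋊₁ I)) (f ⋊₁ I)
  (uc_Bi D |> (((f ⋊₁ I) ⋊₁ I) # (alpha ⋊₁ I)))).
- pasting.
- pasting; junction X2.
- pasting; junction X1.
- apply invertible_hcomp; [boundary| |apply invertible_id2].
  apply invertible_inverse with (uc_B D); apply uc_B_inv.
(* The equation for [B], rewritten in terms of the inverses of [A] and [B]; it plays here the part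
   of [uc_B_eq] in [Lbar_compat]. *)
- assert (EB : (uc_Bi D |> (alpha ⋊₁ I)) ;; (uc_E D ⋊₂ I) =
    ((I ⋉₁ uc_beta D) <| uc_Ai D) ;; (I ⋉₂ uc_E D)).
  { transitivity ((((I ⋉₁ uc_beta D) <| (uc_Ai D ;; uc_A D)) ;; (uc_Bi D |> (alpha ⋊₁ I))) ;;
      (uc_E D ⋊₂ I)); [rewrite Ai_A; pasting|].
    transitivity (((I ⋉₁ uc_beta D) <| uc_Ai D ;; uc_Bi D |> (I ⋉₁ alpha)) ;;
      ((uc_beta D ⋊₁ I) <| uc_A D ;; (uc_E D ⋊₂ I))); [pasting_interchange|].
    rewrite <- uc_B_eq.
    transitivity (((I ⋉₁ uc_beta D) <| uc_Ai D) ;; ((uc_Bi D ;; uc_B D) |> (I ⋉₁ alpha)) ;;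
      (I ⋉₂ uc_E D)); [pasting|]; rewrite Bi_B; pasting. }
  transitivity (((uc_Bi D ;; uc_B D) |> (((f ⋊₁ I) ⋊₁ I) # (alpha ⋊₁ I))) ;;
    ((f ⋊₁ I) <| ((uc_Bi D |> (alpha ⋊₁ I)) ;; (uc_E D ⋊₂ I)))); [pasting; junction X2|].
  rewrite EB, Bi_B.
  transitivity ((((f ⋊₁ I) # (I ⋉₁ uc_beta D)) <| uc_Ai D) ;;
    ((f ⋊₁ I) <| (I ⋉₂ uc_E D))); [pasting; junction X2|].
  rewrite X2, X3; symmetry.
  transitivity (((uc_Bi D |> (((f ⋊₁ I) ⋊₁ I) # (alpha ⋊₁ I))) ;;
    (((uc_beta D ⋊₁ I) # ((f ⋊₁ I) ⋊₁ I)) <| uc_Ai D)) ;;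
    (((uc_beta D ⋊₁ I) <| uc_A D) |> (f ⋊₁ I) ;; (uc_E D ⋊₂ I) |> (f ⋊₁ I)));
    [pasting; junction X1|].
  transitivity (((((I ⋉₁ uc_beta D) # ((f ⋊₁ I) ⋊₁ I)) <| uc_Ai D) ;;
    (uc_Bi D |> (((f ⋊₁ I) ⋊₁ I) # (I ⋉₁ alpha)))) ;;
    (((uc_beta D ⋊₁ I) <| uc_A D) |> (f ⋊₁ I) ;; (uc_E D ⋊₂ I) |> (f ⋊₁ I)));
    [f_equal; pasting_interchange|].
  rewrite X1.
  transitivity ((((I ⋉₁ uc_beta D) # ((f ⋊₁ I) ⋊₁ I)) <| uc_Ai D) ;;
    ((uc_Bi D |> ((I ⋉₁ alpha) # (f ⋊₁ I))) ;; ((uc_beta D ⋊₁ I) <| uc_A D) |> (f ⋊₁ I)) ;;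
    ((uc_E D ⋊₂ I) |> (f ⋊₁ I))); [pasting; junction X1|].
  transitivity ((((I ⋉₁ uc_beta D) # ((f ⋊₁ I) ⋊₁ I)) <| uc_Ai D) ;;
    (((I ⋉₁ uc_beta D) <| uc_A D) |> (f ⋊₁ I) ;; (uc_Bi D |> ((alpha ⋊₁ I) # (f ⋊₁ I)))) ;;
    ((uc_E D ⋊₂ I) |> (f ⋊₁ I))); [f_equal; f_equal; pasting_interchange|].
  transitivity ((((I ⋉₁ uc_beta D) # ((f ⋊₁ I) ⋊₁ I)) <| uc_Ai D) ;;
    ((I ⋉₁ uc_beta D) <| uc_A D) |> (f ⋊₁ I) ;;
    ((uc_Bi D |> (alpha ⋊₁ I) ;; (uc_E D ⋊₂ I)) |> (f ⋊₁ I))); [pasting; junction X1|].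
  rewrite EB.
  transitivity ((((I ⋉₁ uc_beta D) # ((f ⋊₁ I) ⋊₁ I)) <| uc_Ai D) ;;
    ((I ⋉₁ uc_beta D) <| (uc_A D ;; uc_Ai D)) |> (f ⋊₁ I) ;;
    ((I ⋉₂ uc_E D) |> (f ⋊₁ I))); [pasting; junction X1|].
  rewrite A_Ai; pasting; junction X1.
Qed.

(** * The slide equation and the braiding it determines *)

Lemma exchange_ends f g : is_arrow f I I -> is_arrow g I I ->
  (I ⋉₁ f) # (g ⋊₁ I) = (g ⋊₁ I) # (I ⋉₁ f).
Proof. intros Hf Hg; apply (tens_exchange Hg Hf). Qed.

Lemma equi_beta D : equi_arrow (uc_beta D).
Proof.
pose proof (uc_beta_arrow D) as Hb; destruct (uc_eta_invertible D) as [etai Ieta].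
destruct (inverse_cells_elim (uc_eta_cell D) Ieta) as (Hetai & _ & _).
exists alpha; rewrite (proj1 Hb), (proj2 Hb); repeat split; try apply Halpha.
- exists (uc_E D); split; [apply uc_E_cell|exists (uc_Ei D); apply uc_E_inv].
- exists etai; split; [exact Hetai|]; now apply invertible_inverse with (uc_eta D).
Qed.

(** The two ways of moving [f] and [g] out of [II]; [α] being an equi-arrow, this
    equation determines [t], and [β] does not occur in it. *)
Definition slide_eq f g L R t : Prop :=
  ((I ⋉₁ f) <| R) ;; (L |> g) ;; (alpha <| t) = ((g ⋊₁ I) <| L) ;; (R |> f).

Lemma slide_eq_unique D f g L R t t' : is_arrow f I I -> is_arrow g I I ->
  is_L D f L -> is_R D g R ->
  is_cell t (f # g) (g # f) -> is_cell t' (f # g) (g # f) ->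
  slide_eq f g L R t -> slide_eq f g L R t' -> t = t'.
Proof.
intros Hf Hg (HL & IL & _) (HR & IR & _) Ht Ht' e e'.
arrow_facts Hf; arrow_facts Hg.
apply (whisker_l_faithful (f := f # g) (g := g # f) (Z := I) Halpha Ealpha);
  trivial; try (split; boundary).
apply (@vcomp_cancel_l _ ((I ⋉₁ f) # (g ⋊₁ I) # alpha) (alpha # (f # g)) (alpha # (g # f))
  (((I ⋉₁ f) <| R) ;; (L |> g))); try solve [pasting].
- apply (invertible_vcomp (f := (I ⋉₁ f) # ((g ⋊₁ I) # alpha)) (g := (I ⋉₁ f) # (alpha # g))
    (h := (alpha # f) # g)); try solve [pasting];
    (apply invertible_hcomp; [boundary| |]; trivial using invertible_id2).
- etransitivity; [|etransitivity; [exact (eq_trans e (eq_sym e'))|]]; pasting.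
Qed.

Section Composite.
Variables (D : unit_choices I alpha) (f g : arr C) (L R Ri Lbar Lbari Rbar : cel C).
Hypotheses (Hf : is_arrow f I I) (Hg : is_arrow g I I).
Hypotheses (DL : is_L D f L) (DR : is_R D g R) (IR : inverse_cells R Ri).
Hypotheses (DLbar : is_Lbar D f Lbar) (ILbar : inverse_cells Lbar Lbari).
Hypothesis DRbar : is_Rbar D g Rbar.

Let t : cel C :=
  ((f <| uc_Ei D) |> g) ;; (Lbari |> (alpha # g)) ;; ((uc_beta D # (I ⋉₁ f)) <| Ri) ;;
  (Rbar |> ((I ⋉₁ f) # alpha)) ;; ((g # uc_beta D) <| L) ;; ((g <| uc_E D) |> f).

(** The slide equation is tested after whiskering with the equi-arrow [β] and composing with the
    counit. On the left, [Lbar_compat] produces the inverses of the first three factors of [t]. On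
    the right, [Rbar_compat] produces its last three factors. *)
Lemma composite_T : is_cell t (f # g) (g # f) /\ slide_eq f g L R t /\ invertible_cell t.
Proof.
pose proof DL as (HL & JL & _). pose proof DR as (HR & JR & _).
pose proof DLbar as (HLbar & JLbar & _). pose proof DRbar as (HRbar & JRbar & _).
destruct (inverse_cells_elim HR IR) as (HRi & R_Ri & Ri_R).
destruct (inverse_cells_elim HLbar ILbar) as (HLbari & Lb_Lbi & Lbi_Lb).
arrow_facts Hf; arrow_facts Hg; choice_facts D.
pose proof (exchange_ends Hf Hg) as X.
assert (Ht : is_cell t (f # g) (g # f)) by (unfold t; pasting; junction X).
split; [exact Ht|split].
- unfold slide_eq.
  assert (Hl : is_cell ((I ⋉₁ f) <| R ;; L |> g ;; alpha <| t)
    (((I ⋉₁ f) # (g ⋊₁ I)) # alpha) (alpha # (g # f))) by pasting.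
  assert (Hr : is_cell ((g ⋊₁ I) <| L ;; R |> f)
    (((I ⋉₁ f) # (g ⋊₁ I)) # alpha) (alpha # (g # f))) by (pasting; junction X).
  apply (whisker_l_faithful (f := ((I ⋉₁ f) # (g ⋊₁ I)) # alpha) (g := alpha # (g # f)) (Z := I)
    Hbeta (equi_beta D)); trivial; try (split; boundary).
  apply (@vcomp_cancel_r _ (uc_beta D # (((I ⋉₁ f) # (g ⋊₁ I)) # alpha))
    (uc_beta D # (alpha # (g # f))) (g # f) (uc_E D |> (g # f))).
  { pasting. }
  { apply is_cell_hcomp; [apply is_cell_id2 | exact Hl | boundary]. }
  { apply is_cell_hcomp; [apply is_cell_id2 | exact Hr | boundary]. }
  { apply invertible_hcomp; [boundary| |apply invertible_id2].
    exists (uc_Ei D); apply uc_E_inv. }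
  (* The last three factors of [t]; both sides of the equation reduce to this 2-cell. *)
  set (rest := (Rbar |> ((I ⋉₁ f) # alpha)) ;; ((g # uc_beta D) <| L) ;; ((g <| uc_E D) |> f)).
  assert (Hrest : is_cell rest (uc_beta D # (I ⋉₁ f) # (g ⋊₁ I) # alpha) (g # f))
    by (unfold rest; pasting; junction X).
  transitivity rest; [|symmetry].
  + transitivity (((uc_beta D # (I ⋉₁ f)) <| R ;; (uc_beta D <| L) |> g) ;;
      ((uc_beta D # alpha) <| t ;; uc_E D |> (g # f))); [pasting|].
    transitivity (((uc_beta D # (I ⋉₁ f)) <| R ;; (uc_beta D <| L) |> g) ;;
      (uc_E D |> (f # g) ;; t)); [f_equal; pasting_interchange|].
    transitivity (((uc_beta D # (I ⋉₁ f)) <| R) ;;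
      ((uc_beta D <| L) ;; (uc_E D |> f)) |> g ;; t); [pasting|].
    rewrite <- (Lbar_compat Hf DL DLbar); unfold t; fold rest.
    transitivity (((uc_beta D # (I ⋉₁ f)) <| R) ;; (Lbar |> (alpha # g)) ;;
      ((f <| (uc_E D ;; uc_Ei D)) |> g) ;; (Lbari |> (alpha # g)) ;;
      ((uc_beta D # (I ⋉₁ f)) <| Ri) ;; rest); [pasting|].
    rewrite E_Ei.
    transitivity (((uc_beta D # (I ⋉₁ f)) <| R) ;; ((Lbar ;; Lbari) |> (alpha # g)) ;;
      ((uc_beta D # (I ⋉₁ f)) <| Ri) ;; rest); [pasting|].
    rewrite Lb_Lbi; transitivity (((uc_beta D # (I ⋉₁ f)) <| (R ;; Ri)) ;; rest); [pasting|].
    rewrite R_Ri; pasting.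
  + transitivity (((uc_beta D # (g ⋊₁ I)) <| L) ;;
      ((uc_beta D <| R) ;; (uc_E D |> g)) |> f); [pasting; junction X|].
    rewrite <- (Rbar_compat Hg DR DRbar); unfold rest; pasting_interchange.
- assert (JRi : invertible_cell Ri) by now apply invertible_inverse with R.
  assert (JLi : invertible_cell Lbari) by now apply invertible_inverse with Lbar.
  assert (JEi : invertible_cell (uc_Ei D)).
  { apply invertible_inverse with (uc_E D); apply uc_E_inv. }
  assert (JE : invertible_cell (uc_E D)) by (exists (uc_Ei D); apply uc_E_inv).
  assert (K : forall (h : arr C) (u : cel C) (k : arr C), tgt h = src (dom u) -> tgt (dom u) = src k ->
    invertible_cell u -> invertible_cell ((h <| u) |> k)).
  { intros h u k e1 e2 Ju; apply invertible_hcomp; [bd| |apply invertible_id2].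
    apply invertible_hcomp; [bd|apply invertible_id2|exact Ju]. }
  unfold t.
  apply (invertible_vcomp (f := f # g) (g := (f # uc_beta D) # (alpha # g)) (h := g # f));
    [pasting|pasting; junction X|apply K; trivial; boundary|].
  apply (invertible_vcomp (f := (f # uc_beta D) # (alpha # g))
    (g := (uc_beta D # (I ⋉₁ f)) # (alpha # g)) (h := g # f));
    [pasting|pasting; junction X| |].
  { apply invertible_hcomp; [boundary|trivial|apply invertible_id2]. }
  apply (invertible_vcomp (f := (uc_beta D # (I ⋉₁ f)) # (alpha # g))
    (g := (uc_beta D # (I ⋉₁ f)) # ((g ⋊₁ I) # alpha)) (h := g # f));
    [pasting|pasting; junction X| |].
  { apply invertible_hcomp; [boundary|apply invertible_id2|trivial]. }
  apply (invertible_vcomp (f := (uc_beta D # (I ⋉₁ f)) # ((g ⋊₁ I) # alpha))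
    (g := (g # uc_beta D) # ((I ⋉₁ f) # alpha)) (h := g # f));
    [pasting; junction X|pasting| |].
  { apply invertible_hcomp; [boundary|trivial|apply invertible_id2]. }
  apply (invertible_vcomp (f := (g # uc_beta D) # ((I ⋉₁ f) # alpha))
    (g := (g # uc_beta D) # (alpha # f)) (h := g # f)); [pasting|pasting| |].
  { apply invertible_hcomp; [boundary|apply invertible_id2|trivial]. }
  apply K; trivial; boundary.
Qed.
End Composite.

Lemma is_T_exists f g : is_arrow f I I -> is_arrow g I I ->
  exists t, is_T I alpha f g t.
Proof.
intros Hf Hg; destruct unit_choices_exist as [D _].
destruct (L_exists D Hf) as [L DL], (R_exists D Hg) as [R DR].
destruct (Lbar_exists D Hf) as [Lbar DLbar], (Rbar_exists D Hg) as [Rbar DRbar].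
pose proof DR as (_ & [Ri IR] & _); pose proof DLbar as (_ & [Lbari ILbar] & _).
eexists; exists D, L, R, Ri, Lbar, Lbari, Rbar; do 6 (split; [eassumption|]); reflexivity.
Qed.

(** A 2-cell satisfying [is_T] may have been built from another record of choices. The slide
    equation involves only [L] and [R], which are the same for all records, and so makes [T]
    unique. *)
Lemma is_T_slide D f g L R t : is_arrow f I I -> is_arrow g I I ->
  is_L D f L -> is_R D g R -> is_T I alpha f g t ->
  is_cell t (f # g) (g # f) /\ slide_eq f g L R t /\ invertible_cell t.
Proof.
intros Hf Hg DL DR (D' & L' & R' & Ri & Lbar & Lbari & Rbar & DL' & DR' & IR & DLb & IL & DRb & ->).
rewrite (L_unique Hf DL DL'), (R_unique Hg DR DR').
apply (composite_T Hf Hg DL' DR' IR DLb IL DRb).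
Qed.

Lemma is_T_unique f g t t' : is_arrow f I I -> is_arrow g I I ->
  is_T I alpha f g t -> is_T I alpha f g t' -> t = t'.
Proof.
intros Hf Hg Ht Ht'; destruct unit_choices_exist as [D _].
destruct (L_exists D Hf) as [L DL], (R_exists D Hg) as [R DR].
destruct (is_T_slide Hf Hg DL DR Ht) as (T1 & T2 & _).
destruct (is_T_slide Hf Hg DL DR Ht') as (T1' & T2' & _).
exact (slide_eq_unique Hf Hg DL DR T1 T1' T2 T2').
Qed.

(** Both sides are compared after [α] and after the invertible slide of [f] and [g]. The 2-cells [a]
    and [b] then travel through [L] and [R] by naturality, and the slide equation is used once for
    each pair of arrows. *)
Lemma T_natural f f' g g' a b t t' :
  is_arrow f I I -> is_arrow f' I I -> is_arrow g I I -> is_arrow g' I I ->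
  is_cell a f f' -> is_cell b g g' -> is_T I alpha f g t -> is_T I alpha f' g' t' ->
  (a ## b) ;; t' = t ;; (b ## a).
Proof.
intros Hf Hf' Hg Hg' Ha Hb HT HT'; destruct unit_choices_exist as [D _].
destruct (L_exists D Hf) as [L DL], (R_exists D Hg) as [R DR].
destruct (L_exists D Hf') as [L' DL'], (R_exists D Hg') as [R' DR'].
destruct (is_T_slide Hf Hg DL DR HT) as (Ht & St & _).
destruct (is_T_slide Hf' Hg' DL' DR' HT') as (Ht' & St' & _).
pose proof (L_natural Hf Hf' Ha DL DL') as NL; pose proof (R_natural Hg Hg' Hb DR DR') as NR.
destruct DL as (HL & IL & _), DL' as (HL' & IL' & _), DR as (HR & IR & _), DR' as (HR' & IR' & _).
arrow_facts Hf; arrow_facts Hg; arrow_facts Hf'; arrow_facts Hg'.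
pose proof (is_cell_left I Ha) as HIa; pose proof (is_cell_right I Hb) as HbI.
pose proof (exchange_ends Hf Hg) as X; pose proof (exchange_ends Hf' Hg') as X'.
(* Both composites are equal to [b ⊗₂ a], by strict functoriality of the tensor product. *)
assert (E : (I ⋉₂ a) ## (b ⋊₂ I) = (b ⋊₂ I) ## (I ⋉₂ a)).
{ pose proof Ha as [A1 A2]; pose proof Hb as [B1 B2].
  pose proof (src_dom a); pose proof (tgt_dom a); pose proof (src_dom b); pose proof (tgt_dom b).
  rewrite <- !tens_hcomp by boundary; f_equal; f_equal.
  - transitivity b; [|symmetry].
    + rewrite <- (hcomp_id_l b) at 2; f_equal; f_equal; f_equal; rewrite B1; symmetry; apply Hg.
    + rewrite <- (hcomp_id_r b) at 2; f_equal; f_equal; f_equal; rewrite B1; symmetry; apply Hg.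
  - transitivity a; [|symmetry].
    + rewrite <- (hcomp_id_r a) at 2; f_equal; f_equal; f_equal; rewrite A1; symmetry; apply Hf.
    + rewrite <- (hcomp_id_l a) at 2; f_equal; f_equal; f_equal; rewrite A1; symmetry; apply Hf. }
apply (whisker_l_faithful (f := f # g) (g := g' # f') (Z := I) Halpha Ealpha);
  try solve [split; boundary | pasting].
apply (@vcomp_cancel_l _ ((I ⋉₁ f) # (g ⋊₁ I) # alpha) (alpha # (f # g)) (alpha # (g' # f'))
  (((I ⋉₁ f) <| R) ;; (L |> g))); try solve [pasting].
{ apply (invertible_vcomp (f := (I ⋉₁ f) # ((g ⋊₁ I) # alpha)) (g := (I ⋉₁ f) # (alpha # g))
    (h := (alpha # f) # g)); try solve [pasting];
    (apply invertible_hcomp; [boundary| |]; trivial using invertible_id2). }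
transitivity ((((I ⋉₁ f) <| R) ;; ((L ;; (alpha <| a)) |> g)) ;; ((alpha # f') <| b) ;;
  (alpha <| t')); [pasting_interchange|].
rewrite <- NL.
transitivity (((I ⋉₂ a) |> ((g ⋊₁ I) # alpha)) ;; ((I ⋉₁ f') <| (R ;; (alpha <| b))) ;;
  (L' |> g') ;; (alpha <| t')); [pasting_interchange|].
rewrite <- NR.
transitivity ((((I ⋉₂ a) ## (b ⋊₂ I)) |> alpha) ;;
  (((I ⋉₁ f') <| R') ;; (L' |> g') ;; (alpha <| t'))); [pasting_interchange|].
unfold slide_eq in *; rewrite St', E.
transitivity ((((I ⋉₁ f) <| R) ;; (L |> g) ;; (alpha <| t)) ;; (alpha <| (b ## a))); [|pasting].
rewrite St.
transitivity (((b ⋊₂ I) |> ((I ⋉₁ f) # alpha)) ;;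
  ((g' ⋊₁ I) <| (((I ⋉₂ a) |> alpha) ;; L')) ;; (R' |> f')); [pasting_interchange|].
rewrite NL.
transitivity (((g ⋊₁ I) <| L) ;; ((((b ⋊₂ I) |> alpha) ;; R') |> f) ;; ((alpha # g') <| a));
  [pasting_interchange|].
rewrite NR; pasting_interchange.
Qed.

(** The right-hand side solves the slide equation of [f] and [g # h], in which [R_comp] splits the
    slide of [g # h]: first [f] is exchanged with [g], then with [h]. Uniqueness of the solution
    concludes. *)
Lemma T_hexagon_r f g h t t' t'' : is_arrow f I I -> is_arrow g I I -> is_arrow h I I ->
  is_T I alpha f (g # h) t -> is_T I alpha f g t' -> is_T I alpha f h t'' ->
  t = (t' |> h) ;; (g <| t'').
Proof.
intros Hf Hg Hh HT HT' HT''; destruct unit_choices_exist as [D _].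
destruct (L_exists D Hf) as [L DL], (R_exists D Hg) as [R DR], (R_exists D Hh) as [S DS].
assert (Hgh : is_arrow (g # h) I I) by (split; boundary).
pose proof (R_comp Hg Hh DR DS) as DRS.
destruct (is_T_slide Hf Hgh DL DRS HT) as (Ht & St & _).
destruct (is_T_slide Hf Hg DL DR HT') as (Ht' & St' & _).
destruct (is_T_slide Hf Hh DL DS HT'') as (Ht'' & St'' & _).
apply (slide_eq_unique Hf Hgh DL DRS); trivial; [pasting|].
destruct DL as (HL & IL & _), DR as (HR & IR & _), DS as (HS & IS & _).
arrow_facts Hf; arrow_facts Hg; arrow_facts Hh.
pose proof (exchange_ends Hf Hg) as X; unfold slide_eq in *.
rewrite right_comp by boundary.
transitivity ((((I ⋉₁ f) # (g ⋊₁ I)) <| S) ;;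
  ((((I ⋉₁ f) <| R) ;; (L |> g) ;; (alpha <| t')) |> h) ;; ((alpha # g) <| t'')); [pasting|].
rewrite St', X.
transitivity (((g ⋊₁ I) <| (((I ⋉₁ f) <| S) ;; (L |> h))) ;;
  ((R |> (f # h)) ;; ((alpha # g) <| t''))); [pasting; junction X|].
transitivity (((g ⋊₁ I) <| (((I ⋉₁ f) <| S) ;; (L |> h))) ;;
  ((((g ⋊₁ I) # alpha) <| t'') ;; (R |> (h # f)))); [f_equal; pasting_interchange|].
transitivity (((g ⋊₁ I) <| (((I ⋉₁ f) <| S) ;; (L |> h) ;; (alpha <| t''))) ;; (R |> (h # f)));
  [pasting|].
rewrite St''; pasting; apply (f_equal (comp (g ⋊₁ I))); junction (exchange_ends Hf Hh).
Qed.

(** As for [T_hexagon_r], with [L_comp] splitting the slide of [f # g]: here [h] is first exchanged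
    with [g], then with [f]. *)
Lemma T_hexagon_l f g h t t' t'' : is_arrow f I I -> is_arrow g I I -> is_arrow h I I ->
  is_T I alpha (f # g) h t -> is_T I alpha g h t' -> is_T I alpha f h t'' ->
  t = (f <| t') ;; (t'' |> g).
Proof.
intros Hf Hg Hh HT HT' HT''; destruct unit_choices_exist as [D _].
destruct (L_exists D Hf) as [L DL], (L_exists D Hg) as [M DM], (R_exists D Hh) as [S DS].
assert (Hfg : is_arrow (f # g) I I) by (split; boundary).
pose proof (L_comp Hf Hg DL DM) as DLM.
destruct (is_T_slide Hfg Hh DLM DS HT) as (Ht & St & _).
destruct (is_T_slide Hg Hh DM DS HT') as (Ht' & St' & _).
destruct (is_T_slide Hf Hh DL DS HT'') as (Ht'' & St'' & _).
apply (slide_eq_unique Hfg Hh DLM DS); trivial; [pasting|].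
destruct DL as (HL & IL & _), DM as (HM & IM & _), DS as (HS & IS & _).
arrow_facts Hf; arrow_facts Hg; arrow_facts Hh.
pose proof (exchange_ends Hf Hh) as X; unfold slide_eq in *.
rewrite left_comp by boundary.
transitivity (((I ⋉₁ f) <| (((I ⋉₁ g) <| S) ;; (M |> h))) ;;
  ((L |> (g # h)) ;; ((alpha # f) <| t')) ;; ((alpha <| t'') |> g)); [pasting|].
transitivity (((I ⋉₁ f) <| (((I ⋉₁ g) <| S) ;; (M |> h))) ;;
  ((((I ⋉₁ f) # alpha) <| t') ;; (L |> (h # g))) ;; ((alpha <| t'') |> g));
  [f_equal; f_equal; pasting_interchange|].
transitivity (((I ⋉₁ f) <| (((I ⋉₁ g) <| S) ;; (M |> h) ;; (alpha <| t'))) ;;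
  (L |> (h # g)) ;; ((alpha <| t'') |> g)); [pasting|].
rewrite St'.
transitivity ((((I ⋉₁ f) # (h ⋊₁ I)) <| M) ;;
  ((((I ⋉₁ f) <| S) ;; (L |> h) ;; (alpha <| t'')) |> g));
  [pasting; apply (f_equal (comp (I ⋉₁ f))); junction (exchange_ends Hg Hh)|].
rewrite St'', X; pasting; junction X.
Qed.

Lemma is_T_typed f g t : is_arrow f I I -> is_arrow g I I -> is_T I alpha f g t ->
  is_cell t (f # g) (g # f) /\ invertible_cell t.
Proof.
intros Hf Hg HT; destruct unit_choices_exist as [D _].
destruct (L_exists D Hf) as [L DL], (R_exists D Hg) as [R DR].
now destruct (is_T_slide Hf Hg DL DR HT) as (? & _ & ?).
Qed.

Lemma weak_unit_braiding : exists T : forall f g : end_monoidal I, f ⊗ g ⟶ g ⊗ f,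
  is_T_family alpha T /\ is_braiding T.
Proof.
(* Choice turns the existence of [T f g] for each pair into a family. By uniqueness the family does
   not depend on what is chosen. *)
assert (ET : forall f g : hom_category I I, { t | is_T I alpha (proj1_sig f) (proj1_sig g) t }).
{ intros [f Hf] [g Hg]; apply constructive_indefinite_description; now apply is_T_exists. }
exists (fun f g : hom_category I I => exist _ (proj1_sig (ET f g))
  (proj1 (is_T_typed (proj2_sig f) (proj2_sig g) (proj2_sig (ET f g))))).
split.
- intros f g t; simpl; split.
  + intros HT; apply (is_T_unique (proj2_sig f) (proj2_sig g) HT (proj2_sig (ET f g))).
  + intros ->; apply proj2_sig.
- constructor; simpl.
  + intros f g; destruct (ET f g) as [t HT].
    destruct (is_T_typed (proj2_sig f) (proj2_sig g) HT) as [Ht It].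
    destruct (invertible_cell_inverse Ht It) as (t' & Ht' & E1 & E2).
    exists (exist _ t' Ht'); split; apply sig_ext; assumption.
  + intros f f' g g' [a Ha] [b Hb]; apply sig_ext; simpl.
    destruct (ET f g) as [t HT], (ET f' g') as [t' HT']; simpl.
    apply (T_natural (proj2_sig f) (proj2_sig f') (proj2_sig g) (proj2_sig g') Ha Hb HT HT').
  (* The associators of [end_monoidal] are identity 2-cells, so each hexagon is one of the two
     lemmas up to pasting. *)
  + intros f g h; apply sig_ext; simpl.
    pose proof (T_hexagon_r (proj2_sig f) (proj2_sig g) (proj2_sig h)
      (proj2_sig (ET f (end_comp I (g, h)))) (proj2_sig (ET f g)) (proj2_sig (ET f h))) as E.
    simpl in E; rewrite E; clear E.
    destruct (is_T_typed (proj2_sig f) (proj2_sig g) (proj2_sig (ET f g))) as [H1 _].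
    destruct (is_T_typed (proj2_sig f) (proj2_sig h) (proj2_sig (ET f h))) as [H2 _].
    pose proof (proj2_sig f : is_arrow _ I I); pose proof (proj2_sig g : is_arrow _ I I);
    pose proof (proj2_sig h : is_arrow _ I I).
    pasting.
  + intros f g h; apply sig_ext; simpl.
    pose proof (T_hexagon_l (proj2_sig f) (proj2_sig g) (proj2_sig h)
      (proj2_sig (ET (end_comp I (f, g)) h)) (proj2_sig (ET g h)) (proj2_sig (ET f h))) as E.
    simpl in E; rewrite E; clear E.
    destruct (is_T_typed (proj2_sig g) (proj2_sig h) (proj2_sig (ET g h))) as [H1 _].
    destruct (is_T_typed (proj2_sig f) (proj2_sig h) (proj2_sig (ET f h))) as [H2 _].
    pose proof (proj2_sig f : is_arrow _ I I); pose proof (proj2_sig g : is_arrow _ I I);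
    pose proof (proj2_sig h : is_arrow _ I I).
    pasting.
Qed.
End Unit.

(** * Strict braided monoidal categories *)

(** A strict monoidal category is a 2-category with a single object. *)
Record strict_braided := StrictBraided {
  sb_cat :> two_category;
  sb_point : obj sb_cat;
  sb_single : forall X Y : obj sb_cat, X = Y;
  sb_braid : arr sb_cat -> arr sb_cat -> cel sb_cat;
  sb_braid_cell : forall f g, is_cell (sb_braid f g) (f # g) (g # f);
  sb_braid_invertible : forall f g, invertible_cell (sb_braid f g);
  sb_braid_natural : forall f f' g g' a b, is_cell a f f' -> is_cell b g g' ->
    (a ## b) ;; sb_braid f' g' = sb_braid f g ;; (b ## a);
  sb_hexagon_r : forall f g h,
    sb_braid f (g # h) = (sb_braid f g |> h) ;; (g <| sb_braid f h);
  sb_hexagon_l : forall f g h,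
    sb_braid (f # g) h = (f <| sb_braid g h) ;; (sb_braid f h |> g)
}.

(** An inverse as a total function, so that it can be written inside the structure 2-cells of
    composites before their invertibility is known. On a 2-cell without inverse the value is
    arbitrary. *)
Definition vinv (C : two_category) (a : cel C) : cel C :=
  epsilon (inhabits a) (inverse_cells a).

Lemma vinvP (C : two_category) (a : cel C) : invertible_cell a -> inverse_cells a (vinv a).
Proof. intros H; exact (epsilon_spec (inhabits a) _ H). Qed.

Lemma vinv_elim (C : two_category) (f g : arr C) (a : cel C) :
  is_cell a f g -> invertible_cell a ->
  is_cell (vinv a) g f /\ a ;; vinv a = id2 f /\ vinv a ;; a = id2 g.
Proof. intros H I; exact (inverse_cells_elim H (vinvP I)). Qed.

Lemma vinv_unique (C : two_category) (f g : arr C) (a b : cel C) :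
  is_cell a f g -> is_cell b g f -> a ;; b = id2 f -> b ;; a = id2 g -> vinv a = b.
Proof.
intros Ha Hb E1 E2; pose proof (inverse_cells_intro Ha Hb E1 E2) as I.
apply (inverse_cells_unique (vinvP (ex_intro _ b I)) I).
Qed.

Lemma vinv_id2 (C : two_category) (f : arr C) : vinv (id2 f) = id2 f.
Proof. apply vinv_unique with f f; trivial using is_cell_id2, id2_vcomp. Qed.

(** Compositions must be total on the subtypes of well-formed data; for arguments that do not
    compose, the default [d] is returned. *)
Definition guard (A : Type) (P : A -> Prop) (x : A) (d : {x : A | P x}) : {x : A | P x} :=
  match excluded_middle_informative (P x) with left p => exist _ x p | right _ => d end.

Lemma guardE (A : Type) (P : A -> Prop) (x : A) (d : {x : A | P x}) :
  P x -> proj1_sig (guard x d) = x.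
Proof.
intros H; unfold guard; now destruct (excluded_middle_informative (P x)).
Qed.

(** * Strand maps *)

Section Strands.
Variable M : strict_braided.
Let single : forall X Y : obj M, X = Y := @sb_single M.
Implicit Types (x y z f g h : arr M) (a b c : cel M) (l s : list (arr M)).

Ltac object_eq ::= match goal with |- ?X = ?Y => exact (single X Y) end.

Definition one : arr M := id1 (sb_point M).

Lemma mul_assoc f g h : f # (g # h) = f # g # h.
Proof. apply compA; object_eq. Qed.

Lemma mul_1_l f : one # f = f.
Proof. unfold one; rewrite (single (sb_point M) (src f)); apply comp_id_l. Qed.

Lemma mul_1_r f : f # one = f.
Proof. unfold one; rewrite (single (sb_point M) (tgt f)); apply comp_id_r. Qed.

(** An object of the 2-category is a number [k], standing for [k + 1] strands; a
    state of [k] is a list of [k + 1] objects of [M]. *)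
Fixpoint total l : arr M :=
  match l with nil => one | x :: l => x # total l end.

Lemma total_app l s : total (l ++ s) = total l # total s.
Proof. induction l as [|x l IH]; simpl; [now rewrite mul_1_l | now rewrite IH, mul_assoc]. Qed.

Definition units k : list (arr M) := repeat one (S k).

Arguments units : simpl never.

Lemma total_repeat_one k : total (repeat one k) = one.
Proof. induction k as [|k IH]; simpl; trivial; now rewrite IH, mul_1_l. Qed.

Lemma total_units k : total (units k) = one.
Proof. apply total_repeat_one. Qed.

Lemma length_units k : length (units k) = S k.
Proof. apply repeat_length. Qed.

(** The shift by one: [k + 1] strands next to [m + 1] strands are [S (k + m) + 1] strands, so the
    tensor product of objects is [S (k + m)]. *)
Lemma units_app k m : units (S (k + m)) = units k ++ units m.
Proof.
unfold units; rewrite <- repeat_app; f_equal; lia.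
Qed.

(** [sm_str l] identifies the total of [sm_fun l] with the total of [l] times a
    fixed object, the total of the image of the state of units.  The components are
    [nil] and [id2 one] outside the states of [sm_src]. *)
Record strand_map := StrandMap {
  sm_src : nat;
  sm_tgt : nat;
  sm_fun : list (arr M) -> list (arr M);
  sm_str : list (arr M) -> cel M
}.
Implicit Types F G H : strand_map.

Definition sm_ev F : arr M := total (sm_fun F (units (sm_src F))).

(** [ok_units] is a normalisation without which composition would not have strict identities.
    [ok_outside] fixes the junk values, so that strand maps agreeing on all states are equal. *)
Record strand_map_ok F : Prop := StrandMapOk {
  ok_length : forall l, length l = S (sm_src F) ->
    length (sm_fun F l) = S (sm_tgt F);
  ok_cell : forall l, length l = S (sm_src F) ->
    is_cell (sm_str F l) (total (sm_fun F l)) (total l # sm_ev F);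
  ok_invertible : forall l, length l = S (sm_src F) ->
    invertible_cell (sm_str F l);
  ok_units : sm_str F (units (sm_src F)) = id2 (sm_ev F);
  ok_outside : forall l, length l <> S (sm_src F) ->
    sm_fun F l = nil /\ sm_str F l = id2 one
}.

Lemma strand_map_ext F G : strand_map_ok F -> strand_map_ok G ->
  sm_src F = sm_src G -> sm_tgt F = sm_tgt G ->
  (forall l, length l = S (sm_src F) ->
    sm_fun F l = sm_fun G l /\ sm_str F l = sm_str G l) -> F = G.
Proof.
intros HF HG; destruct F as [k m f t] eqn:EF, G as [k' m' f' t'] eqn:EG; simpl; intros <- <- E.
assert (E' : forall l, f l = f' l /\ t l = t' l).
{ intros l; destruct (Nat.eq_dec (length l) (S k)) as [e|e]; [now apply E|].
  destruct (ok_outside HF e) as [E1 E2], (ok_outside HG e) as [E3 E4]; simpl in *.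
  now rewrite E1, E2, E3, E4. }
f_equal; apply functional_extensionality; intros l; apply E'.
Qed.

Definition restrict k m (f : list (arr M) -> list (arr M)) (t : list (arr M) -> cel M) :=
  StrandMap k m
    (fun l => if length l =? S k then f l else nil)
    (fun l => if length l =? S k then t l else id2 one).

Lemma restrictE k m (f : list (arr M) -> list (arr M)) (t : list (arr M) -> cel M) l : length l = S k ->
  sm_fun (restrict k m f t) l = f l /\ sm_str (restrict k m f t) l = t l.
Proof. simpl; intros ->; now rewrite Nat.eqb_refl. Qed.

Lemma restrict_ev k m (f : list (arr M) -> list (arr M)) t : sm_ev (restrict k m f t) = total (f (units k)).
Proof.
unfold sm_ev; unfold restrict; cbn [sm_fun sm_src]; now rewrite length_units, Nat.eqb_refl.
Qed.

Lemma restrict_ok k m (f : list (arr M) -> list (arr M)) t :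
  (forall l, length l = S k -> length (f l) = S m /\
    is_cell (t l) (total (f l)) (total l # total (f (units k))) /\ invertible_cell (t l)) ->
  t (units k) = id2 (total (f (units k))) -> strand_map_ok (restrict k m f t).
Proof.
intros E E'; constructor; try rewrite restrict_ev; unfold restrict; cbn [sm_fun sm_src sm_tgt sm_str]; try intros l.
1-3: intros e; rewrite e, Nat.eqb_refl; apply (E l e).
- rewrite length_units, Nat.eqb_refl; exact E'.
- intros e; now apply Nat.eqb_neq in e as ->.
Qed.

Definition sm_id k : strand_map := restrict k k (fun l => l) (fun l => id2 (total l)).

(** The image of the units under [F] is a state of total [sm_ev F]. The structure 2-cell of [G]
    there compares the value of the composite with [sm_ev F # sm_ev G]; values are multiplicative
    only up to this 2-cell. *)
Definition sm_phi F G : cel M := sm_str G (sm_fun F (units (sm_src F))).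

(** The first two factors lead to [total l # sm_ev F # sm_ev G]. The fixed object has to be the
    value of the composite instead, hence the correction by the inverse of [sm_phi], which also
    makes the structure 2-cell an identity on the units. *)
Definition sm_comp F G : strand_map :=
  restrict (sm_src F) (sm_tgt G) (fun l => sm_fun G (sm_fun F l))
    (fun l => sm_str G (sm_fun F l) ;; (sm_str F l |> sm_ev G) ;;
       (total l <| vinv (sm_phi F G))).

(** The object [sm_ev F] has to move past the total of the second half of the
    state: this is the only place where the braiding enters. *)
Definition sm_tens F G : strand_map :=
  let n := S (sm_src F) in
  restrict (S (sm_src F + sm_src G)) (S (sm_tgt F + sm_tgt G))
    (fun l => sm_fun F (firstn n l) ++ sm_fun G (skipn n l))
    (fun l => (sm_str F (firstn n l) ## sm_str G (skipn n l)) ;;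
       ((total (firstn n l) <| sb_braid (sm_ev F) (total (skipn n l))) |> sm_ev G)).

Lemma sm_ev_units F : strand_map_ok F ->
  length (sm_fun F (units (sm_src F))) = S (sm_tgt F).
Proof. intros HF; apply (ok_length HF), length_units. Qed.

Lemma sm_phi_cell F G : strand_map_ok F -> strand_map_ok G -> sm_tgt F = sm_src G ->
  is_cell (sm_phi F G) (total (sm_fun G (sm_fun F (units (sm_src F))))) (sm_ev F # sm_ev G) /\
  invertible_cell (sm_phi F G).
Proof.
intros HF HG e; pose proof (sm_ev_units HF) as L; rewrite e in L.
split; [apply (ok_cell HG L) | apply (ok_invertible HG L)].
Qed.

Lemma sm_id_ok k : strand_map_ok (sm_id k).
Proof.
apply restrict_ok; trivial; intros l e; split; trivial.
rewrite total_units, mul_1_r; split; [apply is_cell_id2 | apply invertible_id2].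
Qed.

Lemma sm_comp_ok F G : strand_map_ok F -> strand_map_ok G -> sm_tgt F = sm_src G ->
  strand_map_ok (sm_comp F G).
Proof.
intros HF HG e; destruct (sm_phi_cell HF HG e) as [Hp Ip].
destruct (vinv_elim Hp Ip) as (Hp' & E1 & E2).
apply restrict_ok.
- intros l el; pose proof (ok_length HF el) as eF; rewrite e in eF.
  pose proof (ok_cell HF el) as C1; pose proof (ok_cell HG eF) as C2.
  split; [now apply (ok_length HG)|split].
  + pasting.
  + apply (invertible_vcomp (f := total (sm_fun G (sm_fun F l)))
      (g := total (sm_fun F l) # sm_ev G)
      (h := total l # total (sm_fun G (sm_fun F (units (sm_src F)))))); [pasting|pasting| |].
    * apply (ok_invertible HG eF).
    * apply (invertible_vcomp (f := total (sm_fun F l) # sm_ev G)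
        (g := (total l # sm_ev F) # sm_ev G)
        (h := total l # total (sm_fun G (sm_fun F (units (sm_src F)))))); [pasting|pasting| |].
      -- apply invertible_hcomp; [object_eq|apply (ok_invertible HF el)|apply invertible_id2].
      -- apply invertible_hcomp; [object_eq|apply invertible_id2|].
         apply invertible_inverse with (sm_phi F G); now apply vinvP.
- rewrite (ok_units HF), total_units; fold (sm_phi F G).
  rewrite <- E1; unfold one; pasting.
Qed.

Lemma sm_ev_comp F G :
  sm_ev (sm_comp F G) = total (sm_fun G (sm_fun F (units (sm_src F)))).
Proof. apply restrict_ev. Qed.

Lemma sm_ev_id k : sm_ev (sm_id k) = one.
Proof. unfold sm_id; rewrite restrict_ev; apply total_units. Qed.

Lemma sm_idE k l : length l = S k ->
  sm_fun (sm_id k) l = l /\ sm_str (sm_id k) l = id2 (total l).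
Proof. intros e; exact (restrictE _ _ _ e). Qed.

Lemma sm_compE F G l : length l = S (sm_src F) ->
  sm_fun (sm_comp F G) l = sm_fun G (sm_fun F l) /\
  sm_str (sm_comp F G) l = sm_str G (sm_fun F l) ;; (sm_str F l |> sm_ev G) ;;
    (total l <| vinv (sm_phi F G)).
Proof. intros e; exact (restrictE _ _ _ e). Qed.

Lemma sm_phi_comp_cell F G : strand_map_ok F -> strand_map_ok G -> sm_tgt F = sm_src G ->
  is_cell (sm_phi F G) (sm_ev (sm_comp F G)) (sm_ev F # sm_ev G) /\
  invertible_cell (sm_phi F G).
Proof. rewrite sm_ev_comp; apply sm_phi_cell. Qed.

(** The comparison of [F] with [sm_comp G H] is the structure 2-cell of that composite, which ends
    with the inverse of [sm_phi G H]. The last factor on the right cancels it. *)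
Lemma sm_phi_assoc F G H : strand_map_ok F -> strand_map_ok G -> strand_map_ok H ->
  sm_tgt F = sm_src G -> sm_tgt G = sm_src H ->
  sm_phi (sm_comp F G) H ;; (sm_phi F G |> sm_ev H) =
  sm_phi F (sm_comp G H) ;; (sm_ev F <| sm_phi G H).
Proof.
intros HF HG HH e1 e2.
pose proof (sm_ev_units HF) as LF; rewrite e1 in LF.
pose proof (ok_length HG LF) as LG; rewrite e2 in LG.
destruct (sm_compE (F := F) G (length_units _)) as [E1 _].
destruct (sm_compE H LF) as [_ E2].
unfold sm_phi at 1 3; rewrite E2; cbn [sm_src sm_comp restrict]; rewrite E1; clear E1 E2.
destruct (sm_phi_comp_cell HF HG e1) as [C1 _], (sm_phi_comp_cell HG HH e2) as [C2 I2].
destruct (vinv_elim C2 I2) as (C3 & _ & V).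
pose proof (ok_cell HH LG) as C4; pose proof (ok_cell HG LF) as C5.
fold (sm_phi F G) in C5; fold (sm_ev F) in C5; fold (sm_phi F G); fold (sm_ev F).
transitivity (sm_str H (sm_fun G (sm_fun F (units (sm_src F)))) ;;
  (sm_phi F G |> sm_ev H) ;; (sm_ev F <| (vinv (sm_phi G H) ;; sm_phi G H))); [|pasting].
rewrite V; pasting.
Qed.

Lemma sm_phi_id_l k G : strand_map_ok G -> k = sm_src G -> sm_phi (sm_id k) G = id2 (sm_ev G).
Proof.
intros HG ->; unfold sm_phi; cbn [sm_src sm_id restrict].
rewrite (proj1 (sm_idE (length_units _))); apply (ok_units HG).
Qed.

Lemma sm_phi_id_r F k : strand_map_ok F -> k = sm_tgt F -> sm_phi F (sm_id k) = id2 (sm_ev F).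
Proof.
intros HF ->; unfold sm_phi; now rewrite (proj2 (sm_idE (sm_ev_units HF))).
Qed.

Lemma sm_comp_id_l F : strand_map_ok F -> sm_comp (sm_id (sm_src F)) F = F.
Proof.
intros HF; apply strand_map_ext; trivial; [now apply sm_comp_ok; [apply sm_id_ok| |]|].
intros l e; cbn in e; destruct (sm_compE (F := sm_id (sm_src F)) F e) as [E1 E2].
destruct (sm_idE e) as [E3 E4].
rewrite E1, E2, E3, E4; split; trivial.
rewrite sm_phi_id_l, vinv_id2 by trivial.
pose proof (ok_cell HF e); pasting.
Qed.

Lemma sm_comp_id_r F : strand_map_ok F -> sm_comp F (sm_id (sm_tgt F)) = F.
Proof.
intros HF; apply strand_map_ext; trivial; [now apply sm_comp_ok; [|apply sm_id_ok|]|].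
intros l e; cbn in e; destruct (sm_compE (F := F) (sm_id (sm_tgt F)) e) as [E1 E2].
pose proof (ok_length HF e) as e'.
destruct (sm_idE e') as [E3 E4].
rewrite E1, E2, E3, E4; split; trivial.
rewrite sm_phi_id_r, vinv_id2, sm_ev_id by trivial; unfold one.
pose proof (ok_cell HF e); pasting.
Qed.

Lemma sm_comp_assoc F G H : strand_map_ok F -> strand_map_ok G -> strand_map_ok H ->
  sm_tgt F = sm_src G -> sm_tgt G = sm_src H ->
  sm_comp F (sm_comp G H) = sm_comp (sm_comp F G) H.
Proof.
intros HF HG HH e1 e2.
pose proof (sm_comp_ok HF HG e1) as HFG; pose proof (sm_comp_ok HG HH e2) as HGH.
pose proof (sm_comp_ok HF HGH e1) as H1; pose proof (sm_comp_ok HFG HH e2) as H2.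
apply strand_map_ext; trivial; intros l e; cbn in e.
pose proof (ok_length HF e) as eF; rewrite e1 in eF.
pose proof (ok_length HG eF) as eG; rewrite e2 in eG.
destruct (sm_compE (sm_comp G H) e) as [E1 E2], (sm_compE H eF) as [E3 E4].
destruct (sm_compE (F := sm_comp F G) H e) as [E5 E6], (sm_compE G e) as [E7 E8].
rewrite E1, E2, E3, E4, E5, E6, E7, E8; split; trivial.
destruct (sm_phi_comp_cell HF HG e1) as [C1 I1], (sm_phi_comp_cell HG HH e2) as [C2 I2].
destruct (sm_phi_comp_cell HF HGH e1) as [C3 I3], (sm_phi_comp_cell HFG HH e2) as [C4 I4].
destruct (vinv_elim C1 I1) as (D1 & V1 & W1), (vinv_elim C2 I2) as (D2 & V2 & W2).
destruct (vinv_elim C3 I3) as (D3 & V3 & W3), (vinv_elim C4 I4) as (D4 & V4 & W4).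
pose proof (ok_cell HF e) as K1; pose proof (ok_cell HG eF) as K2; pose proof (ok_cell HH eG) as K3.
pose proof (sm_phi_assoc HF HG HH e1 e2) as A.
assert (EV : sm_ev (sm_comp F (sm_comp G H)) = sm_ev (sm_comp (sm_comp F G) H)).
{ rewrite !sm_ev_comp; cbn [sm_src sm_comp restrict].
  pose proof (sm_ev_units HF) as LF; rewrite e1 in LF.
  destruct (sm_compE H LF) as [-> _], (sm_compE (F := F) G (length_units _)) as [-> _].
  reflexivity. }
rewrite EV in C3, D3, V3.
(* This is [sm_phi_assoc] read for the inverses, which are what the structure 2-cells of composites
   contain. *)
assert (B : (sm_ev F <| vinv (sm_phi G H)) ;; vinv (sm_phi F (sm_comp G H)) =
  (vinv (sm_phi F G) |> sm_ev H) ;; vinv (sm_phi (sm_comp F G) H)).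
{ apply (@vcomp_cancel_l _ (sm_ev (sm_comp (sm_comp F G) H)) (sm_ev F # (sm_ev G # sm_ev H))
    (sm_ev (sm_comp (sm_comp F G) H)) (sm_phi F (sm_comp G H) ;; (sm_ev F <| sm_phi G H)));
    try solve [pasting].
  - rewrite <- A; apply (invertible_vcomp C4 (h := sm_ev F # sm_ev G # sm_ev H)); trivial.
    + pasting.
    + apply invertible_hcomp; [object_eq|trivial|apply invertible_id2].
  - transitivity (sm_phi F (sm_comp G H) ;; (sm_ev F <| (sm_phi G H ;; vinv (sm_phi G H))) ;;
      vinv (sm_phi F (sm_comp G H))); [pasting|].
    rewrite V2; transitivity (sm_phi F (sm_comp G H) ;; vinv (sm_phi F (sm_comp G H))); [pasting|].
    rewrite V3, <- A; symmetry.
    transitivity (sm_phi (sm_comp F G) H ;; ((sm_phi F G ;; vinv (sm_phi F G)) |> sm_ev H) ;;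
      vinv (sm_phi (sm_comp F G) H)); [pasting|].
    rewrite V1; transitivity (sm_phi (sm_comp F G) H ;; vinv (sm_phi (sm_comp F G) H)); [pasting|].
    exact V4. }
set (h3 := sm_str H _) in *; set (h2 := sm_str G _) in *; set (h1 := sm_str F _) in *.
transitivity (h3 ;; (h2 |> sm_ev H) ;; (h1 |> (sm_ev G # sm_ev H)) ;;
  (total l <| ((sm_ev F <| vinv (sm_phi G H)) ;; vinv (sm_phi F (sm_comp G H)))));
  [pasting_interchange|].
rewrite B; pasting_interchange.
Qed.

(** With units in the last two places the hexagon says that the braiding is idempotent, and an
    invertible idempotent is an identity. *)
Lemma braid_one_r f : sb_braid f one = id2 f.
Proof.
pose proof (sb_braid_cell f one) as H; pose proof (sb_hexagon_r f one one) as E.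
rewrite !mul_1_r in E; rewrite mul_1_r, mul_1_l in H.
apply (@vcomp_cancel_l _ f f f (sb_braid f one)); trivial using is_cell_id2.
- apply sb_braid_invertible.
- transitivity (sb_braid f one); [|unfold one in *; pasting].
  rewrite E at 3; unfold one in *; pasting.
Qed.

Lemma braid_one_l f : sb_braid one f = id2 f.
Proof.
pose proof (sb_braid_cell one f) as H; pose proof (sb_hexagon_l one one f) as E.
rewrite !mul_1_r in E; rewrite mul_1_r, mul_1_l in H.
apply (@vcomp_cancel_l _ f f f (sb_braid one f)); trivial using is_cell_id2.
- apply sb_braid_invertible.
- transitivity (sb_braid one f); [|unfold one in *; pasting].
  rewrite E at 3; unfold one in *; pasting.
Qed.

Lemma firstn_exact n l s : length l = n -> firstn n (l ++ s) = l.
Proof. intros <-; now rewrite firstn_app, firstn_all, Nat.sub_diag, app_nil_r. Qed.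

Lemma skipn_exact n l s : length l = n -> skipn n (l ++ s) = s.
Proof. intros <-; now rewrite skipn_app, skipn_all, Nat.sub_diag. Qed.

Lemma state_split l k m : length l = S (S (k + m)) ->
  exists l1 l2, l = l1 ++ l2 /\ length l1 = S k /\ length l2 = S m.
Proof.
intros e; exists (firstn (S k) l), (skipn (S k) l).
rewrite firstn_skipn, length_firstn, length_skipn; repeat split; lia.
Qed.

Lemma sm_tensE F G l1 l2 : length l1 = S (sm_src F) -> length l2 = S (sm_src G) ->
  sm_fun (sm_tens F G) (l1 ++ l2) = sm_fun F l1 ++ sm_fun G l2 /\
  sm_str (sm_tens F G) (l1 ++ l2) = (sm_str F l1 ## sm_str G l2) ;;
    ((total l1 <| sb_braid (sm_ev F) (total l2)) |> sm_ev G).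
Proof.
intros e1 e2.
assert (e : length (l1 ++ l2) = S (S (sm_src F + sm_src G))) by (rewrite length_app; lia).
unfold sm_tens; destruct (restrictE (S (sm_tgt F + sm_tgt G))
  (fun l => sm_fun F (firstn (S (sm_src F)) l) ++ sm_fun G (skipn (S (sm_src F)) l))
  (fun l => (sm_str F (firstn (S (sm_src F)) l) ## sm_str G (skipn (S (sm_src F)) l)) ;;
       ((total (firstn (S (sm_src F)) l) <|
         sb_braid (sm_ev F) (total (skipn (S (sm_src F)) l))) |> sm_ev G)) e) as [-> ->].
rewrite (firstn_exact _ e1), (skipn_exact _ e1); now split.
Qed.

Lemma sm_ev_tens F G : sm_ev (sm_tens F G) = sm_ev F # sm_ev G.
Proof.
unfold sm_ev at 1; cbn [sm_src sm_tens restrict]; rewrite units_app.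
rewrite (proj1 (sm_tensE (F := F) (G := G) (length_units _) (length_units _))).
apply total_app.
Qed.

Lemma sm_tens_ok F G : strand_map_ok F -> strand_map_ok G -> strand_map_ok (sm_tens F G).
Proof.
intros HF HG; pose proof (sm_ev_tens F G) as EV; unfold sm_tens in EV; rewrite restrict_ev in EV.
apply restrict_ok; rewrite EV; clear EV.
- intros l e; destruct (state_split e) as (l1 & l2 & -> & e1 & e2).
  rewrite (firstn_exact _ e1), (skipn_exact _ e1).
  pose proof (ok_cell HF e1) as K1; pose proof (ok_cell HG e2) as K2.
  pose proof (sb_braid_cell (sm_ev F) (total l2)) as K3.
  split; [rewrite length_app, (ok_length HF e1), (ok_length HG e2); lia|].
  rewrite !total_app; split; [pasting|].
  apply (invertible_vcomp (f := total (sm_fun F l1) # total (sm_fun G l2))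
    (g := (total l1 # sm_ev F) # (total l2 # sm_ev G))
    (h := (total l1 # total l2) # (sm_ev F # sm_ev G))); [pasting|pasting| |].
  + apply invertible_hcomp; [object_eq|apply (ok_invertible HF e1)|apply (ok_invertible HG e2)].
  + apply invertible_hcomp; [object_eq| |apply invertible_id2].
    apply invertible_hcomp; [object_eq|apply invertible_id2|apply sb_braid_invertible].
- rewrite units_app, (firstn_exact _ (length_units _)), (skipn_exact _ (length_units _)).
  rewrite (ok_units HF), (ok_units HG), !total_units, braid_one_r; unfold one; pasting.
Qed.

(** The functions agree by associativity of concatenation. For the structure 2-cells, one bracketing
    moves [sm_ev F # sm_ev G] past the third block and the other moves [sm_ev F] past the last two
    blocks together; the two hexagons split both into the same three crossings. *)
Lemma sm_tens_assoc F G H : strand_map_ok F -> strand_map_ok G -> strand_map_ok H ->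
  sm_tens (sm_tens F G) H = sm_tens F (sm_tens G H).
Proof.
intros HF HG HH.
pose proof (sm_tens_ok HF HG) as HFG; pose proof (sm_tens_ok HG HH) as HGH.
apply strand_map_ext; [now apply sm_tens_ok|now apply sm_tens_ok|cbn; lia|cbn; lia|].
intros l e; destruct (state_split e) as (l' & l3 & -> & e' & e3).
destruct (state_split e') as (l1 & l2 & -> & e1 & e2).
destruct (sm_tensE (F := sm_tens F G) e' e3) as [-> ->], (sm_tensE e1 e2) as [-> ->].
rewrite <- !app_assoc.
assert (e4 : length (l2 ++ l3) = S (sm_src (sm_tens G H))) by (cbn; rewrite length_app; lia).
destruct (sm_tensE e1 e4) as [-> ->], (sm_tensE e2 e3) as [-> ->].
split; trivial; rewrite !sm_ev_tens, !total_app, sb_hexagon_l, sb_hexagon_r.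
pose proof (ok_cell HF e1); pose proof (ok_cell HG e2); pose proof (ok_cell HH e3).
pose proof (sb_braid_cell (sm_ev F) (total l2)); pose proof (sb_braid_cell (sm_ev F) (total l3)).
pose proof (sb_braid_cell (sm_ev G) (total l3)); pasting_interchange.
Qed.

Lemma sm_tens_id k m : sm_tens (sm_id k) (sm_id m) = sm_id (S (k + m)).
Proof.
apply strand_map_ext; [apply sm_tens_ok; apply sm_id_ok|apply sm_id_ok|cbn; lia|cbn; lia|].
intros l e; cbn [sm_src sm_tens restrict sm_id] in e.
destruct (state_split e) as (l1 & l2 & -> & e1 & e2).
destruct (sm_tensE (F := sm_id k) (G := sm_id m) e1 e2) as [-> ->], (sm_idE e1) as [-> ->], (sm_idE e2) as [-> ->].
destruct (sm_idE (k := S (k + m)) e) as [-> ->].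
split; trivial; rewrite !sm_ev_id, braid_one_l, total_app; unfold one; pasting.
Qed.

(** The state reached after [sm_tens F G] has a second block of total [sm_ev G], which the value of
    [F'] must cross. This crossing is the failure of the values to satisfy the interchange law
    strictly. *)
Lemma sm_phi_tens F F' G G' : strand_map_ok F -> strand_map_ok F' -> strand_map_ok G ->
  strand_map_ok G' -> sm_tgt F = sm_src F' -> sm_tgt G = sm_src G' ->
  sm_phi (sm_tens F G) (sm_tens F' G') = (sm_phi F F' ## sm_phi G G') ;;
    ((sm_ev F <| sb_braid (sm_ev F') (sm_ev G)) |> sm_ev G').
Proof.
intros HF HF' HG HG' e e'; unfold sm_phi at 1; cbn [sm_src sm_tens restrict].
rewrite units_app.
rewrite (proj1 (sm_tensE (F := F) (G := G) (length_units _) (length_units _))).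
pose proof (sm_ev_units HF) as LF; pose proof (sm_ev_units HG) as LG; rewrite e in LF; rewrite e' in LG.
exact (proj2 (sm_tensE LF LG)).
Qed.

(** The strict interchange law. The two functions are the same; only the structure 2-cells need an
    argument. On the right the value of [F'] crosses the image of the second block under [G], hence
    [total l2] and [sm_ev G]. The second of these crossings is undone by the inverse of the
    comparison [sm_phi_tens]. *)
Lemma sm_tens_comp F F' G G' : strand_map_ok F -> strand_map_ok F' -> strand_map_ok G ->
  strand_map_ok G' -> sm_tgt F = sm_src F' -> sm_tgt G = sm_src G' ->
  sm_tens (sm_comp F F') (sm_comp G G') = sm_comp (sm_tens F G) (sm_tens F' G').
Proof.
intros HF HF' HG HG' e e'.
pose proof (sm_tens_ok HF HG) as T; pose proof (sm_tens_ok HF' HG') as T'.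
pose proof (sm_comp_ok HF HF' e) as K; pose proof (sm_comp_ok HG HG' e') as K'.
assert (e'' : sm_tgt (sm_tens F G) = sm_src (sm_tens F' G')) by (cbn; lia).
apply strand_map_ext; [now apply sm_tens_ok|now apply sm_comp_ok|reflexivity|reflexivity|].
intros l el; destruct (state_split el) as (l1 & l2 & -> & e1 & e2).
cbn [sm_src sm_comp restrict] in e1, e2.
destruct (sm_tensE (F := sm_comp F F') (G := sm_comp G G') e1 e2) as [-> ->].
destruct (sm_compE (F := sm_tens F G) (sm_tens F' G') el) as [-> ->].
destruct (sm_compE F' e1) as [-> ->], (sm_compE G' e2) as [-> ->], (sm_tensE e1 e2) as [-> ->].
pose proof (ok_length HF e1) as L1; pose proof (ok_length HG e2) as L2; rewrite e in L1; rewrite e' in L2.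
destruct (sm_tensE L1 L2) as [-> ->]; split; trivial.
destruct (sm_phi_comp_cell HF HF' e) as [C1 I1], (sm_phi_comp_cell HG HG' e') as [C2 I2].
destruct (vinv_elim C1 I1) as (D1 & V1 & W1), (vinv_elim C2 I2) as (D2 & V2 & W2).
pose proof (ok_cell HF e1) as K1; pose proof (ok_cell HG e2) as K2.
pose proof (ok_cell HF' L1) as K3; pose proof (ok_cell HG' L2) as K4.
pose proof (sb_braid_cell (sm_ev F') (sm_ev G)) as B1.
destruct (vinv_elim B1 (sb_braid_invertible _ _)) as (B2 & V3 & W3).
(* The inverse of the formula in [sm_phi_tens], with the inverse crossing now in front. *)
assert (EV : vinv (sm_phi (sm_tens F G) (sm_tens F' G')) =
  ((sm_ev F <| vinv (sb_braid (sm_ev F') (sm_ev G))) |> sm_ev G') ;;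
  (vinv (sm_phi F F') ## vinv (sm_phi G G'))).
{ rewrite sm_phi_tens by trivial.
  apply (vinv_unique (f := sm_ev (sm_comp F F') # sm_ev (sm_comp G G'))
    (g := (sm_ev F # sm_ev G) # (sm_ev F' # sm_ev G'))); [pasting|pasting| |].
  - transitivity ((sm_phi F F' ## sm_phi G G') ;;
      (sm_ev F <| (sb_braid (sm_ev F') (sm_ev G) ;; vinv (sb_braid (sm_ev F') (sm_ev G)))) |> sm_ev G'
      ;; (vinv (sm_phi F F') ## vinv (sm_phi G G'))); [pasting|].
    rewrite V3; transitivity ((sm_phi F F' ;; vinv (sm_phi F F')) ## (sm_phi G G' ;; vinv (sm_phi G G')));
      [pasting_interchange|].
    rewrite V1, V2; pasting.
  - transitivity (((sm_ev F <| vinv (sb_braid (sm_ev F') (sm_ev G))) |> sm_ev G') ;;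
      ((vinv (sm_phi F F') ;; sm_phi F F') ## (vinv (sm_phi G G') ;; sm_phi G G')) ;;
      ((sm_ev F <| sb_braid (sm_ev F') (sm_ev G)) |> sm_ev G')); [pasting_interchange|].
    rewrite W1, W2.
    transitivity ((sm_ev F <| (vinv (sb_braid (sm_ev F') (sm_ev G)) ;; sb_braid (sm_ev F') (sm_ev G)))
      |> sm_ev G'); [pasting|].
    rewrite W3; pasting. }
rewrite EV, !sm_ev_tens, !total_app.
pose proof (sb_braid_cell (sm_ev F') (total l2)) as B3.
pose proof (sb_braid_cell (sm_ev F) (total l2)) as B4.
pose proof (sb_braid_cell (sm_ev (sm_comp F F')) (total l2)) as B5.
(* Naturality replaces the value of the composite by the product of values, and the hexagon then
   lets [F'] and [F] cross the second block one after the other. *)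
assert (N : (vinv (sm_phi F F') |> total l2) ;; sb_braid (sm_ev (sm_comp F F')) (total l2) =
  ((sm_ev F <| sb_braid (sm_ev F') (total l2)) ;; (sb_braid (sm_ev F) (total l2) |> sm_ev F')) ;;
  (total l2 <| vinv (sm_phi F F'))).
{ rewrite <- sb_hexagon_l; apply (sb_braid_natural D1 (is_cell_id2 _)). }
set (f1 := sm_str F l1) in *; set (g1 := sm_str G l2) in *.
set (f2 := sm_str F' _) in *; set (g2 := sm_str G' _) in *.
transitivity ((f2 ## g2) ;; ((f1 |> sm_ev F') ## (g1 |> sm_ev G')) ;;
  ((total l1 <| ((vinv (sm_phi F F') |> total l2) ;; sb_braid (sm_ev (sm_comp F F')) (total l2)))
    |> (sm_ev G # sm_ev G')) ;;
  ((total l1 # total l2 # sm_ev (sm_comp F F')) <| vinv (sm_phi G G'))); [pasting_interchange|].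
rewrite N; symmetry.
pose proof (sb_braid_cell (sm_ev F') (total (sm_fun G l2))) as B6.
(* Naturality in the second block: crossing the image of [l2] under [G] becomes crossing [total l2]
   and then [sm_ev G]. *)
assert (N' : sb_braid (sm_ev F') (total (sm_fun G l2)) ;; (g1 |> sm_ev F') =
  (sm_ev F' <| g1) ;; ((sb_braid (sm_ev F') (total l2) |> sm_ev G) ;;
    (total l2 <| sb_braid (sm_ev F') (sm_ev G)))).
{ rewrite <- sb_hexagon_r; symmetry; apply (sb_braid_natural (is_cell_id2 _) K2). }
transitivity ((f2 ## g2) ;; (f1 |> (sm_ev F' # total (sm_fun G l2) # sm_ev G')) ;;
  (((total l1 # sm_ev F) <| (sb_braid (sm_ev F') (total (sm_fun G l2)) ;; (g1 |> sm_ev F')))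
    |> sm_ev G') ;;
  ((total l1 <| sb_braid (sm_ev F) (total l2)) |> (sm_ev G # sm_ev F' # sm_ev G')) ;;
  (((total l1 # total l2 # sm_ev F) <| vinv (sb_braid (sm_ev F') (sm_ev G))) |> sm_ev G') ;;
  ((total l1 # total l2) <| (vinv (sm_phi F F') ## vinv (sm_phi G G')))).
{ pasting_interchange. }
rewrite N'.
transitivity ((f2 ## g2) ;; ((f1 |> sm_ev F') ## (g1 |> sm_ev G')) ;;
  (((total l1 # sm_ev F) <| sb_braid (sm_ev F') (total l2)) |> (sm_ev G # sm_ev G')) ;;
  ((total l1 <| sb_braid (sm_ev F) (total l2)) |> (sm_ev F' # sm_ev G # sm_ev G')) ;;
  (((total l1 # total l2 # sm_ev F) <|
    (sb_braid (sm_ev F') (sm_ev G) ;; vinv (sb_braid (sm_ev F') (sm_ev G)))) |> sm_ev G') ;;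
  ((total l1 # total l2) <| (vinv (sm_phi F F') ## vinv (sm_phi G G'))));
  [pasting_interchange|].
rewrite V3; pasting_interchange.
Qed.

(** * The 2-category of strands *)

Definition smap := {F : strand_map | strand_map_ok F}.
Implicit Types A B D : smap.

Definition smap_src A := sm_src (proj1_sig A).
Definition smap_tgt A := sm_tgt (proj1_sig A).
Definition smap_ev A := sm_ev (proj1_sig A).
Definition smap_phi A B := sm_phi (proj1_sig A) (proj1_sig B).
Definition smap_id k : smap := exist _ (sm_id k) (sm_id_ok k).
Definition smap_comp A B : smap := guard (sm_comp (proj1_sig A) (proj1_sig B)) A.
Definition smap_tens A B : smap :=
  exist _ (sm_tens (proj1_sig A) (proj1_sig B)) (sm_tens_ok (proj2_sig A) (proj2_sig B)).

Lemma smap_compE A B : smap_tgt A = smap_src B ->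
  proj1_sig (smap_comp A B) = sm_comp (proj1_sig A) (proj1_sig B).
Proof. intros e; apply guardE, sm_comp_ok; trivial; apply proj2_sig. Qed.

Lemma smap_src_comp A B : smap_tgt A = smap_src B -> smap_src (smap_comp A B) = smap_src A.
Proof. intros e; unfold smap_src at 1; now rewrite smap_compE. Qed.

Lemma smap_tgt_comp A B : smap_tgt A = smap_src B -> smap_tgt (smap_comp A B) = smap_tgt B.
Proof. intros e; unfold smap_tgt at 1; now rewrite smap_compE. Qed.

Lemma smap_comp_id_l A : smap_comp (smap_id (smap_src A)) A = A.
Proof. apply sig_ext; rewrite smap_compE by reflexivity; apply sm_comp_id_l, proj2_sig. Qed.

Lemma smap_comp_id_r A : smap_comp A (smap_id (smap_tgt A)) = A.
Proof. apply sig_ext; rewrite smap_compE by reflexivity; apply sm_comp_id_r, proj2_sig. Qed.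

Lemma smap_comp_assoc A B D : smap_tgt A = smap_src B -> smap_tgt B = smap_src D ->
  smap_comp A (smap_comp B D) = smap_comp (smap_comp A B) D.
Proof.
intros e1 e2; apply sig_ext.
rewrite !smap_compE; rewrite ?smap_src_comp, ?smap_tgt_comp; trivial.
apply sm_comp_assoc; trivial; apply proj2_sig.
Qed.

Lemma smap_phi_cell A B : smap_tgt A = smap_src B ->
  is_cell (smap_phi A B) (smap_ev (smap_comp A B)) (smap_ev A # smap_ev B) /\
  invertible_cell (smap_phi A B).
Proof.
intros e; unfold smap_ev at 1; rewrite smap_compE by trivial.
apply sm_phi_comp_cell; trivial; apply proj2_sig.
Qed.

Lemma smap_phi_assoc A B D : smap_tgt A = smap_src B -> smap_tgt B = smap_src D ->
  smap_phi (smap_comp A B) D ;; (smap_phi A B |> smap_ev D) =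
  smap_phi A (smap_comp B D) ;; (smap_ev A <| smap_phi B D).
Proof.
intros e1 e2; unfold smap_phi; rewrite !smap_compE by trivial.
apply sm_phi_assoc; trivial; apply proj2_sig.
Qed.

Lemma smap_phi_id_l k A : k = smap_src A -> smap_phi (smap_id k) A = id2 (smap_ev A).
Proof. apply sm_phi_id_l, proj2_sig. Qed.

Lemma smap_phi_id_r A k : k = smap_tgt A -> smap_phi A (smap_id k) = id2 (smap_ev A).
Proof. apply sm_phi_id_r, proj2_sig. Qed.

Lemma smap_ev_id k : smap_ev (smap_id k) = one.
Proof. apply sm_ev_id. Qed.

Lemma smap_ev_tens A B : smap_ev (smap_tens A B) = smap_ev A # smap_ev B.
Proof. apply sm_ev_tens. Qed.

Record strand_cell := StrandCell { sc_dom : smap; sc_cod : smap; sc_mor : cel M }.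

Definition strand_cell_ok (u : strand_cell) : Prop :=
  smap_src (sc_dom u) = smap_src (sc_cod u) /\ smap_tgt (sc_dom u) = smap_tgt (sc_cod u) /\
  is_cell (sc_mor u) (smap_ev (sc_dom u)) (smap_ev (sc_cod u)).

Definition scell := {u : strand_cell | strand_cell_ok u}.
Implicit Types u v w : scell.

Definition cdom u := sc_dom (proj1_sig u).
Definition ccod u := sc_cod (proj1_sig u).
Definition cmor u := sc_mor (proj1_sig u).

Lemma scell_ext u v : cdom u = cdom v -> ccod u = ccod v -> cmor u = cmor v -> u = v.
Proof.
intros e1 e2 e3; apply sig_ext; destruct u as [[] ?], v as [[] ?]; cbv in e1, e2, e3.
simpl; congruence.
Qed.

Lemma cmor_cell u : is_cell (cmor u) (smap_ev (cdom u)) (smap_ev (ccod u)).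
Proof. exact (proj2 (proj2 (proj2_sig u))). Qed.

Lemma scell_src u : smap_src (cdom u) = smap_src (ccod u).
Proof. exact (proj1 (proj2_sig u)). Qed.

Lemma scell_tgt u : smap_tgt (cdom u) = smap_tgt (ccod u).
Proof. exact (proj1 (proj2 (proj2_sig u))). Qed.

Definition scell_id A : scell :=
  exist strand_cell_ok (StrandCell A A (id2 (smap_ev A)))
    (conj eq_refl (conj eq_refl (is_cell_id2 _))).
Definition scell_vcomp u v : scell :=
  guard (StrandCell (cdom u) (ccod v) (cmor u ;; cmor v)) u.
(** The product of the two morphisms goes between products of values; [smap_phi] carries it to the
    values of the composites. *)
Definition scell_hcomp u v : scell :=
  guard (StrandCell (smap_comp (cdom u) (cdom v)) (smap_comp (ccod u) (ccod v))
    (smap_phi (cdom u) (cdom v) ;; (cmor u ## cmor v) ;; vinv (smap_phi (ccod u) (ccod v)))) u.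

Lemma scell_vcompE u v : ccod u = cdom v ->
  cdom (scell_vcomp u v) = cdom u /\ ccod (scell_vcomp u v) = ccod v /\
  cmor (scell_vcomp u v) = cmor u ;; cmor v.
Proof.
intros e; unfold cdom at 1, ccod at 1, cmor at 1, scell_vcomp; rewrite guardE.
- now repeat split.
- pose proof (cmor_cell u) as Hu; pose proof (cmor_cell v) as Hv; rewrite e in Hu.
  split; [|split]; simpl.
  + now rewrite scell_src, e, scell_src.
  + now rewrite scell_tgt, e, scell_tgt.
  + exact (is_cell_vcomp Hu Hv).
Qed.

Lemma scell_hcompE u v : smap_tgt (cdom u) = smap_src (cdom v) ->
  cdom (scell_hcomp u v) = smap_comp (cdom u) (cdom v) /\
  ccod (scell_hcomp u v) = smap_comp (ccod u) (ccod v) /\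
  cmor (scell_hcomp u v) =
    smap_phi (cdom u) (cdom v) ;; (cmor u ## cmor v) ;; vinv (smap_phi (ccod u) (ccod v)).
Proof.
intros e; unfold cdom at 1, ccod at 1, cmor at 1, scell_hcomp; rewrite guardE.
- now repeat split.
- assert (e' : smap_tgt (ccod u) = smap_src (ccod v)) by now rewrite <- scell_tgt, <- scell_src.
  pose proof (cmor_cell u) as Hu; pose proof (cmor_cell v) as Hv.
  destruct (smap_phi_cell e) as [C1 _], (smap_phi_cell e') as [C2 I2].
  destruct (vinv_elim C2 I2) as (D2 & _).
  split; [|split]; simpl.
  + rewrite !smap_src_comp; trivial; apply scell_src.
  + rewrite !smap_tgt_comp; trivial; apply scell_tgt.
  + pasting.
Qed.

Definition strand_two_category : two_category.
Proof.
refine (@TwoCategory nat smap scell smap_src smap_tgt cdom ccod scell_src scell_tgt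
  smap_id smap_comp scell_id scell_vcomp scell_hcomp
  (fun _ => eq_refl) (fun _ => eq_refl) smap_src_comp smap_tgt_comp
  smap_comp_id_l smap_comp_id_r smap_comp_assoc (fun _ => eq_refl) (fun _ => eq_refl)
  (fun u v e => proj1 (scell_vcompE e)) (fun u v e => proj1 (proj2 (scell_vcompE e)))
  _ _ _
  (fun u v e => proj1 (scell_hcompE e)) (fun u v e => proj1 (proj2 (scell_hcompE e)))
  _ _ _ _ _).
- intros u; destruct (scell_vcompE (u := scell_id (cdom u)) (v := u) eq_refl) as (E1 & E2 & E3).
  apply scell_ext; trivial; rewrite E3; apply (vcomp_id_left (cmor_cell u)).
- intros u; destruct (scell_vcompE (u := u) (v := scell_id (ccod u)) eq_refl) as (E1 & E2 & E3).
  apply scell_ext; trivial; rewrite E3; apply (vcomp_id_right (cmor_cell u)).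
- intros u v w e1 e2.
  destruct (scell_vcompE e1) as (E1 & E2 & E3), (scell_vcompE e2) as (E4 & E5 & E6).
  rewrite <- E4 in e1; destruct (scell_vcompE e1) as (E7 & E8 & E9).
  rewrite <- E2 in e2; destruct (scell_vcompE e2) as (E10 & E11 & E12).
  apply scell_ext; try congruence; rewrite E9, E12, E3, E6.
  pose proof (cmor_cell u) as H1; pose proof (cmor_cell v) as H2; pose proof (cmor_cell w) as H3.
  rewrite E4 in e1; rewrite E2 in e2; rewrite e1 in H1; rewrite e2 in H2.
  exact (vcomp_assoc H1 H2 H3).
- intros u; destruct (scell_hcompE (u := scell_id (smap_id (smap_src (cdom u)))) (v := u) eq_refl)
    as (E1 & E2 & E3).
  apply scell_ext; [rewrite E1; apply smap_comp_id_l
    |rewrite E2; cbn [cdom ccod cmor scell_id proj1_sig sc_dom sc_cod sc_mor]; rewrite scell_src; apply smap_comp_id_l|].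
  rewrite E3; cbn [cdom ccod cmor scell_id proj1_sig sc_dom sc_cod sc_mor]; rewrite !smap_phi_id_l, vinv_id2, smap_ev_id by (trivial; apply scell_src).
  pose proof (cmor_cell u); unfold one; pasting.
- intros u; destruct (scell_hcompE (u := u) (v := scell_id (smap_id (smap_tgt (cdom u)))) eq_refl)
    as (E1 & E2 & E3).
  apply scell_ext; [rewrite E1; apply smap_comp_id_r
    |rewrite E2; cbn [cdom ccod cmor scell_id proj1_sig sc_dom sc_cod sc_mor]; rewrite scell_tgt; apply smap_comp_id_r|].
  rewrite E3; cbn [cdom ccod cmor scell_id proj1_sig sc_dom sc_cod sc_mor]; rewrite !smap_phi_id_r, vinv_id2, smap_ev_id by (trivial; apply scell_tgt).
  pose proof (cmor_cell u); unfold one; pasting.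
- intros u v w e1 e2.
  destruct (scell_hcompE e1) as (E1 & E2 & E3), (scell_hcompE e2) as (E4 & E5 & E6).
  assert (e3 : smap_tgt (cdom u) = smap_src (cdom (scell_hcomp v w)))
    by now rewrite E4, smap_src_comp.
  assert (e4 : smap_tgt (cdom (scell_hcomp u v)) = smap_src (cdom w))
    by now rewrite E1, smap_tgt_comp.
  destruct (scell_hcompE e3) as (E7 & E8 & E9), (scell_hcompE e4) as (E10 & E11 & E12).
  assert (e1' : smap_tgt (ccod u) = smap_src (ccod v)) by now rewrite <- scell_tgt, <- scell_src.
  assert (e2' : smap_tgt (ccod v) = smap_src (ccod w)) by now rewrite <- scell_tgt, <- scell_src.
  apply scell_ext; [rewrite E7, E10, E1, E4; now apply smap_comp_assoc
    |rewrite E8, E11, E2, E5; now apply smap_comp_assoc|].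
  rewrite E9, E12, E1, E2, E3, E4, E5, E6.
  pose proof (cmor_cell u) as Hu; pose proof (cmor_cell v) as Hv; pose proof (cmor_cell w) as Hw.
  assert (X1 : smap_tgt (cdom u) = smap_src (smap_comp (cdom v) (cdom w))) by now rewrite smap_src_comp.
  assert (X2 : smap_tgt (smap_comp (cdom u) (cdom v)) = smap_src (cdom w)) by now rewrite smap_tgt_comp.
  assert (X3 : smap_tgt (ccod u) = smap_src (smap_comp (ccod v) (ccod w))) by now rewrite smap_src_comp.
  assert (X4 : smap_tgt (smap_comp (ccod u) (ccod v)) = smap_src (ccod w)) by now rewrite smap_tgt_comp.
  pose proof (smap_phi_assoc e1 e2) as A1; pose proof (smap_phi_assoc e1' e2') as A2.
  pose proof (smap_comp_assoc e1 e2) as Q1; pose proof (smap_comp_assoc e1' e2') as Q2.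
  destruct (smap_phi_cell e1) as [C1 I1], (smap_phi_cell e2) as [C2 I2].
  destruct (smap_phi_cell X1) as [C3 I3], (smap_phi_cell X2) as [C4 I4].
  destruct (smap_phi_cell e1') as [C1' I1'], (smap_phi_cell e2') as [C2' I2'].
  destruct (smap_phi_cell X3) as [C3' I3'], (smap_phi_cell X4) as [C4' I4'].
  destruct (vinv_elim C1' I1') as (D1 & V1 & W1), (vinv_elim C2' I2') as (D2 & V2 & W2).
  destruct (vinv_elim C3' I3') as (D3 & V3 & W3), (vinv_elim C4' I4') as (D4 & V4 & W4).
  rewrite Q1 in C3; rewrite Q2 in C3', D3, V3.
  set (p := smap_phi (cdom u) (cdom v)) in *; set (q := smap_phi (cdom v) (cdom w)) in *.
  set (p' := smap_phi (ccod u) (ccod v)) in *; set (q' := smap_phi (ccod v) (ccod w)) in *.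
  set (r := smap_phi (cdom u) (smap_comp (cdom v) (cdom w))) in *.
  set (r' := smap_phi (ccod u) (smap_comp (ccod v) (ccod w))) in *.
  set (s := smap_phi (smap_comp (cdom u) (cdom v)) (cdom w)) in *.
  set (s' := smap_phi (smap_comp (ccod u) (ccod v)) (ccod w)) in *.
  (* Composing with the comparison for the triple composite of codomains cancels all the inverses.
     By [smap_phi_assoc] for the domains and for the codomains, both bracketings then become the
     same composite. *)
  apply (@vcomp_cancel_r _ (smap_ev (smap_comp (smap_comp (cdom u) (cdom v)) (cdom w)))
    (smap_ev (smap_comp (smap_comp (ccod u) (ccod v)) (ccod w)))
    (smap_ev (ccod u) # smap_ev (ccod v) # smap_ev (ccod w)) (r' ;; (smap_ev (ccod u) <| q'))).
  + pasting.
  + pasting.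
  + pasting.
  + apply (invertible_vcomp C3'
      (h := smap_ev (ccod u) # (smap_ev (ccod v) # smap_ev (ccod w)))); trivial.
    * pasting.
    * apply invertible_hcomp; [object_eq|apply invertible_id2|trivial].
  + transitivity (r ;; (cmor u ## (q ;; (cmor v ## cmor w) ;; vinv q')) ;; (vinv r' ;; r') ;;
      (smap_ev (ccod u) <| q')); [pasting|].
    rewrite W3.
    transitivity ((r ;; (smap_ev (cdom u) <| q)) ;; (cmor u ## (cmor v ## cmor w)) ;;
      (smap_ev (ccod u) <| (vinv q' ;; q'))); [pasting_interchange|].
    rewrite W2, <- A1, <- A2; symmetry.
    transitivity (s ;; ((p ;; (cmor u ## cmor v) ;; vinv p') ## cmor w) ;; (vinv s' ;; s') ;;
      (p' |> smap_ev (ccod w))); [pasting|].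
    rewrite W4.
    transitivity ((s ;; (p |> smap_ev (cdom w))) ;; ((cmor u ## cmor v) ## cmor w) ;;
      ((vinv p' ;; p') |> smap_ev (ccod w))); [pasting_interchange|].
    rewrite W1; pasting_interchange.
- intros A B e.
  destruct (scell_hcompE (u := scell_id A) (v := scell_id B) e) as (E1 & E2 & E3).
  apply scell_ext; trivial; rewrite E3; cbn [cdom ccod cmor scell_id proj1_sig sc_dom sc_cod sc_mor].
  destruct (smap_phi_cell e) as [C1 I1]; destruct (vinv_elim C1 I1) as (D1 & V1 & W1).
  transitivity (smap_phi A B ;; vinv (smap_phi A B)); [pasting|exact V1].
- intros u u' v v' e1 e2 e3.
  destruct (scell_vcompE e1) as (E1 & E2 & E3), (scell_vcompE e2) as (E4 & E5 & E6).
  assert (e3' : smap_tgt (cdom u') = smap_src (cdom v'))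
    by now rewrite <- e1, <- e2, <- scell_tgt, <- scell_src.
  assert (e3'' : smap_tgt (ccod u') = smap_src (ccod v')) by now rewrite <- scell_tgt, <- scell_src.
  destruct (scell_hcompE e3) as (E7 & E8 & E9), (scell_hcompE e3') as (E10 & E11 & E12).
  assert (e4 : smap_tgt (cdom (scell_vcomp u u')) = smap_src (cdom (scell_vcomp v v')))
    by now rewrite E1, E4.
  destruct (scell_hcompE e4) as (E13 & E14 & E15).
  assert (e5 : ccod (scell_hcomp u v) = cdom (scell_hcomp u' v'))
    by now rewrite E8, E10, e1, e2.
  destruct (scell_vcompE e5) as (E16 & E17 & E18).
  apply scell_ext; [congruence|congruence|].
  rewrite E15, E18, E9, E12, E1, E2, E3, E4, E5, E6, e1, e2.
  pose proof (cmor_cell u) as Hu; pose proof (cmor_cell v) as Hv.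
  pose proof (cmor_cell u') as Hu'; pose proof (cmor_cell v') as Hv'.
  rewrite e1 in Hu; rewrite e2 in Hv.
  destruct (smap_phi_cell e3) as [C1 I1], (smap_phi_cell e3') as [C2 I2], (smap_phi_cell e3'') as [C3 I3].
  destruct (vinv_elim C2 I2) as (D2 & V2 & W2), (vinv_elim C3 I3) as (D3 & V3 & W3).
  symmetry.
  transitivity (smap_phi (cdom u) (cdom v) ;; (cmor u ## cmor v) ;;
    (vinv (smap_phi (cdom u') (cdom v')) ;; smap_phi (cdom u') (cdom v')) ;;
    (cmor u' ## cmor v') ;; vinv (smap_phi (ccod u') (ccod v'))); [pasting|].
  rewrite W2; pasting_interchange.
Defined.

Definition scell_tens u v : scell.
Proof.
refine (exist strand_cell_ok (StrandCell (smap_tens (cdom u) (cdom v))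
  (smap_tens (ccod u) (ccod v)) (cmor u ## cmor v)) _).
pose proof (scell_src u) as e1; pose proof (scell_src v) as e2.
pose proof (scell_tgt u) as e3; pose proof (scell_tgt v) as e4.
split; [|split]; cbn [sc_dom sc_cod sc_mor].
- change (S (smap_src (cdom u) + smap_src (cdom v)) = S (smap_src (ccod u) + smap_src (ccod v))).
  congruence.
- change (S (smap_tgt (cdom u) + smap_tgt (cdom v)) = S (smap_tgt (ccod u) + smap_tgt (ccod v))).
  congruence.
- rewrite !smap_ev_tens; apply (is_cell_hcomp (cmor_cell u) (cmor_cell v)); object_eq.
Defined.

Lemma smap_tens_comp A A' B B' : smap_tgt A = smap_src A' -> smap_tgt B = smap_src B' ->
  smap_tens (smap_comp A A') (smap_comp B B') =
  smap_comp (smap_tens A B) (smap_tens A' B').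
Proof.
intros e e'; apply sig_ext; cbn [smap_tens proj1_sig]; rewrite !smap_compE; trivial.
- cbn [smap_tens proj1_sig]; apply sm_tens_comp; trivial; apply proj2_sig.
- unfold smap_tgt, smap_src in *; cbn; lia.
Qed.

Lemma smap_phi_tens A A' B B' : smap_tgt A = smap_src A' -> smap_tgt B = smap_src B' ->
  smap_phi (smap_tens A B) (smap_tens A' B') = (smap_phi A A' ## smap_phi B B') ;;
    ((smap_ev A <| sb_braid (smap_ev A') (smap_ev B)) |> smap_ev B').
Proof. apply sm_phi_tens; apply proj2_sig. Qed.

(** By [smap_phi_tens] the comparisons for domains and codomains each contain a crossing. Naturality
    of the braiding in [cmor u'] and [cmor v] carries one to the other. The inverse is cancelled by
    composing with the codomain comparison [phi']. *)
Lemma scell_tens_hcomp u u' v v' : smap_tgt (cdom u) = smap_src (cdom u') ->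
  smap_tgt (cdom v) = smap_src (cdom v') ->
  scell_tens (scell_hcomp u u') (scell_hcomp v v') =
  scell_hcomp (scell_tens u v) (scell_tens u' v').
Proof.
intros e e'.
destruct (scell_hcompE e) as (E1 & E2 & E3), (scell_hcompE e') as (E4 & E5 & E6).
assert (e'' : smap_tgt (cdom (scell_tens u v)) = smap_src (cdom (scell_tens u' v'))).
{ change (S (smap_tgt (cdom u) + smap_tgt (cdom v)) = S (smap_src (cdom u') + smap_src (cdom v'))).
  congruence. }
assert (f : smap_tgt (ccod u) = smap_src (ccod u')) by now rewrite <- scell_tgt, <- scell_src.
assert (f' : smap_tgt (ccod v) = smap_src (ccod v')) by now rewrite <- scell_tgt, <- scell_src.
destruct (scell_hcompE e'') as (E7 & E8 & E9).
apply scell_ext.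
- rewrite E7; cbn [cdom scell_tens sc_dom proj1_sig] in *; rewrite E1, E4; now apply smap_tens_comp.
- rewrite E8; cbn [ccod scell_tens sc_cod proj1_sig] in *; rewrite E2, E5; now apply smap_tens_comp.
- rewrite E9.
  change (cmor (scell_hcomp u u') ## cmor (scell_hcomp v v') =
    smap_phi (smap_tens (cdom u) (cdom v)) (smap_tens (cdom u') (cdom v')) ;;
    ((cmor u ## cmor v) ## (cmor u' ## cmor v')) ;;
    vinv (smap_phi (smap_tens (ccod u) (ccod v)) (smap_tens (ccod u') (ccod v')))).
  rewrite E3, E6, !smap_phi_tens by trivial.
  pose proof (cmor_cell u) as H1; pose proof (cmor_cell u') as H1'.
  pose proof (cmor_cell v) as H2; pose proof (cmor_cell v') as H2'.
  destruct (smap_phi_cell e) as [C1 I1], (smap_phi_cell e') as [C2 I2].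
  destruct (smap_phi_cell f) as [C3 I3], (smap_phi_cell f') as [C4 I4].
  destruct (vinv_elim C3 I3) as (D3 & V3 & W3), (vinv_elim C4 I4) as (D4 & V4 & W4).
  pose proof (sb_braid_cell (smap_ev (cdom u')) (smap_ev (cdom v))) as B1.
  pose proof (sb_braid_cell (smap_ev (ccod u')) (smap_ev (ccod v))) as B2.
  pose proof (sb_braid_natural H1' H2) as N.
  set (p := smap_phi (cdom u) (cdom u')) in *; set (q := smap_phi (cdom v) (cdom v')) in *.
  set (p' := smap_phi (ccod u) (ccod u')) in *; set (q' := smap_phi (ccod v) (ccod v')) in *.
  set (b := sb_braid (smap_ev (cdom u')) _) in *; set (b' := sb_braid (smap_ev (ccod u')) _) in *.
  pose (phi' := (p' ## q') ;; ((smap_ev (ccod u) <| b') |> smap_ev (ccod v'))); fold phi'.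
  assert (Hphi : is_cell phi' (smap_ev (smap_comp (ccod u) (ccod u')) #
      smap_ev (smap_comp (ccod v) (ccod v')))
    (smap_ev (ccod u) # smap_ev (ccod v) # smap_ev (ccod u') # smap_ev (ccod v')))
    by (unfold phi'; pasting).
  assert (Iphi : invertible_cell phi').
  { apply (invertible_vcomp (f := smap_ev (smap_comp (ccod u) (ccod u')) #
      smap_ev (smap_comp (ccod v) (ccod v')))
      (g := (smap_ev (ccod u) # smap_ev (ccod u')) # (smap_ev (ccod v) # smap_ev (ccod v')))
      (h := smap_ev (ccod u) # smap_ev (ccod v) # smap_ev (ccod u') # smap_ev (ccod v')));
      [pasting|pasting| |].
    - apply invertible_hcomp; [object_eq|trivial|trivial].
    - apply invertible_hcomp; [object_eq| |apply invertible_id2].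
      apply invertible_hcomp; [object_eq|apply invertible_id2|apply sb_braid_invertible]. }
  destruct (vinv_elim Hphi Iphi) as (Dphi & Vphi & Wphi).
  apply (@vcomp_cancel_r _ (smap_ev (smap_comp (cdom u) (cdom u')) #
      smap_ev (smap_comp (cdom v) (cdom v'))) (smap_ev (smap_comp (ccod u) (ccod u')) #
      smap_ev (smap_comp (ccod v) (ccod v')))
    (smap_ev (ccod u) # smap_ev (ccod v) # smap_ev (ccod u') # smap_ev (ccod v')) phi');
    trivial; try solve [pasting].
  symmetry.
  transitivity (((p ## q) ;; ((smap_ev (cdom u) <| b) |> smap_ev (cdom v'))) ;;
    ((cmor u ## cmor v) ## (cmor u' ## cmor v')) ;; (vinv phi' ;; phi')); [pasting|].
  rewrite Wphi.
  transitivity ((p ## q) ;; (cmor u ## (b ;; (cmor v ## cmor u')) ## cmor v'));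
    [pasting_interchange|].
  rewrite <- N; symmetry; unfold phi'.
  transitivity (((p ;; (cmor u ## cmor u')) ## (q ;; (cmor v ## cmor v'))) ;;
    ((vinv p' ;; p') ## (vinv q' ;; q')) ;; ((smap_ev (ccod u) <| b') |> smap_ev (ccod v')));
    [pasting_interchange|].
  rewrite W3, W4; pasting_interchange.
Qed.

Definition strand_tensor :
  two_functor (prod_two_category strand_two_category strand_two_category) strand_two_category.
Proof.
refine (@TwoFunctor (prod_two_category strand_two_category strand_two_category)
  strand_two_category (fun k : nat * nat => S (fst k + snd k))
  (fun A : smap * smap => smap_tens (fst A) (snd A))
  (fun u : scell * scell => scell_tens (fst u) (snd u))
  (fun _ => eq_refl) (fun _ => eq_refl) (fun _ => eq_refl) (fun _ => eq_refl) _ _ _ _ _).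
- intros [k m]; apply sig_ext, sm_tens_id.
- intros [A B] [A' B'] e; injection e; intros e2 e1; now apply smap_tens_comp.
- intros [A B]; apply scell_ext; trivial.
  change (id2 (smap_ev A) ## id2 (smap_ev B) = id2 (smap_ev (smap_tens A B))).
  rewrite smap_ev_tens; apply hcomp_id2; object_eq.
- intros [u v] [u' v'] e; injection e; intros e2 e1; simpl in *.
  destruct (scell_vcompE e1) as (E1 & E2 & E3), (scell_vcompE e2) as (E4 & E5 & E6).
  assert (e3 : ccod (scell_tens u v) = cdom (scell_tens u' v'))
    by (change (smap_tens (ccod u) (ccod v) = smap_tens (cdom u') (cdom v')); congruence).
  destruct (scell_vcompE e3) as (E7 & E8 & E9).
  apply scell_ext; [rewrite E7|rewrite E8|rewrite E9].
  + change (smap_tens (cdom (scell_vcomp u u')) (cdom (scell_vcomp v v')) =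
      smap_tens (cdom u) (cdom v)); congruence.
  + change (smap_tens (ccod (scell_vcomp u u')) (ccod (scell_vcomp v v')) =
      smap_tens (ccod u') (ccod v')); congruence.
  + change (cmor (scell_vcomp u u') ## cmor (scell_vcomp v v') =
      (cmor u ## cmor v) ;; (cmor u' ## cmor v')).
    rewrite E3, E6; apply interchange; [| |object_eq].
    * rewrite (proj2 (cmor_cell u)), (proj1 (cmor_cell u')); now rewrite e1.
    * rewrite (proj2 (cmor_cell v)), (proj1 (cmor_cell v')); now rewrite e2.
- intros [u v] [u' v'] e; injection e; intros e2 e1; now apply scell_tens_hcomp.
Defined.

Definition strand_semimonoidal : semimonoidal_two_category.
Proof.
refine (@SemimonoidalTwoCategory strand_two_category strand_tensor _ _ _).
- intros k m n; simpl; lia.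
- intros A B D; apply sig_ext; apply sm_tens_assoc; apply proj2_sig.
- intros u v w; apply scell_ext.
  + apply sig_ext; apply sm_tens_assoc; apply proj2_sig.
  + apply sig_ext; apply sm_tens_assoc; apply proj2_sig.
  + change ((cmor u ## cmor v) ## cmor w = cmor u ## (cmor v ## cmor w)).
    symmetry; apply hcompA; object_eq.
Defined.
End Strands.

(** * The weak unit of one strand *)

(** Fully faithful and essentially surjective: the inverse functor that [is_equivalence] asks for is
    obtained by choosing preimages of objects, isomorphisms and morphisms. *)
Lemma equivalence_intro (A B : category) (F : functor A B) :
  (forall (x y : A) (f g : x ⟶ y), fmap F f = fmap F g -> f = g) ->
  (forall (x y : A) (h : F x ⟶ F y), exists f : x ⟶ y, fmap F f = h) ->
  (forall y : B, exists x : A, inhabited (iso (F x) y)) -> is_equivalence F.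
Proof.
intros Hfaith Hfull Hsurj.
assert (CH : forall y : B, {x : A & iso (F x) y}).
{ intros y; destruct (constructive_indefinite_description _ (Hsurj y)) as [x Hx].
  exists x; exact (epsilon Hx (fun _ => True)). }
assert (CF : forall (x y : A) (h : F x ⟶ F y), {f : x ⟶ y | fmap F f = h})
  by (intros; now apply constructive_indefinite_description).
pose (G0 := fun y => projT1 (CH y)).
pose (s := fun y => projT2 (CH y) : iso (F (G0 y)) y).
pose (G1 := fun y y' (g : y ⟶ y') => proj1_sig (CF _ _ (s y ⨟ (g ⨟ iso_inv (s y'))))).
assert (E1 : forall y y' (g : y ⟶ y'), fmap F (G1 y y' g) = s y ⨟ (g ⨟ iso_inv (s y')))
  by (intros; exact (proj2_sig (CF _ _ _))).
unshelve eexists (@Functor B A G0 G1 _ _); [..|split].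
- intros y; apply Hfaith; rewrite E1, fmap_id, cid_l; apply iso_hom_inv.
- intros x y z f g; apply Hfaith; rewrite fmap_comp, !E1, <- !ccompA.
  now rewrite (ccompA (iso_inv (s y))), iso_inv_hom, cid_l.
- assert (CI : forall x : A, {t : iso (G0 (F x)) x | fmap F t = s (F x)}).
  { intros x; destruct (CF (G0 (F x)) x (s (F x))) as [t Et].
    destruct (CF x (G0 (F x)) (iso_inv (s (F x)))) as [t' Et'].
    unshelve eexists (@Iso _ _ _ t t' _ _); trivial; apply Hfaith;
      rewrite fmap_comp, Et, Et', fmap_id; [apply iso_hom_inv|apply iso_inv_hom]. }
  exists (fun x => proj1_sig (CI x)); intros x y f; apply Hfaith; simpl.
  rewrite !fmap_comp, E1, (proj2_sig (CI x)), (proj2_sig (CI y)).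
  now rewrite <- !ccompA, iso_inv_hom, cid_r.
- exists s; intros x y f; simpl; now rewrite E1, <- !ccompA, iso_inv_hom, cid_r.
Qed.

Section Unit.
Variable M : strict_braided.
Let single : forall X Y : obj M, X = Y := @sb_single M.
Implicit Types (x y z f g h : arr M) (l s : list (arr M)) (A B D : smap M) (u v w : scell M).

Ltac object_eq ::= match goal with |- ?X = ?Y => exact (single X Y) end.

Notation C := (strand_semimonoidal M).
Notation one := (one M).

Definition smap_fun A := sm_fun (proj1_sig A).
Definition smap_str A := sm_str (proj1_sig A).

Lemma smap_fun_id k l : length l = S k -> smap_fun (smap_id M k) l = l.
Proof. intros e; apply (sm_idE e). Qed.

Lemma smap_str_id k l : length l = S k -> smap_str (smap_id M k) l = id2 (total l).
Proof. intros e; apply (sm_idE e). Qed.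

Lemma smap_fun_comp A B l : smap_tgt A = smap_src B -> length l = S (smap_src A) ->
  smap_fun (smap_comp A B) l = smap_fun B (smap_fun A l).
Proof. intros e el; unfold smap_fun; rewrite smap_compE by trivial; now apply sm_compE. Qed.

Lemma smap_str_comp A B l : smap_tgt A = smap_src B -> length l = S (smap_src A) ->
  smap_str (smap_comp A B) l = smap_str B (smap_fun A l) ;; (smap_str A l |> smap_ev B) ;;
    (total l <| vinv (smap_phi A B)).
Proof. intros e el; unfold smap_str; rewrite smap_compE by trivial; now apply sm_compE. Qed.

Lemma smap_fun_tens A B l s : length l = S (smap_src A) -> length s = S (smap_src B) ->
  smap_fun (smap_tens A B) (l ++ s) = smap_fun A l ++ smap_fun B s.
Proof. intros e e'; now apply (sm_tensE e e'). Qed.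

Lemma smap_str_tens A B l s : length l = S (smap_src A) -> length s = S (smap_src B) ->
  smap_str (smap_tens A B) (l ++ s) = (smap_str A l ## smap_str B s) ;;
    ((total l <| sb_braid (smap_ev A) (total s)) |> smap_ev B).
Proof. intros e e'; now apply (sm_tensE e e'). Qed.

Lemma smap_str_cell A l : length l = S (smap_src A) ->
  is_cell (smap_str A l) (total (smap_fun A l)) (total l # smap_ev A).
Proof. apply ok_cell, proj2_sig. Qed.

Lemma smap_length A l : length l = S (smap_src A) -> length (smap_fun A l) = S (smap_tgt A).
Proof. apply ok_length, proj2_sig. Qed.

Lemma smap_str_units A : smap_str A (units M (smap_src A)) = id2 (smap_ev A).
Proof. apply ok_units, proj2_sig. Qed.

Lemma strand_cell_intro A B (a : cel M) : smap_src A = smap_src B -> smap_tgt A = smap_tgt B ->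
  is_cell a (smap_ev A) (smap_ev B) ->
  exists u : cel C, is_cell u A B /\ cmor u = a.
Proof.
intros e1 e2 Ha.
exists (exist (@strand_cell_ok M) (StrandCell A B a) (conj e1 (conj e2 Ha))); repeat split.
Qed.

Lemma strand_cell_ext (u v : cel C) (A B : arr C) : is_cell u A B -> is_cell v A B ->
  cmor u = cmor v -> u = v.
Proof. intros [H1 H2] [H3 H4] E; apply scell_ext; trivial; cbn in *; congruence. Qed.

Lemma strand_vcompE (u v : cel C) : cod u = dom v -> cmor (u ;; v) = cmor u ;; cmor v.
Proof. apply scell_vcompE. Qed.

Lemma strand_hcompE (u v : cel C) : tgt (dom u) = src (dom v) ->
  cmor (u ## v) =
    smap_phi (dom u) (dom v) ;; (cmor u ## cmor v) ;; vinv (smap_phi (cod u) (cod v)).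
Proof. apply scell_hcompE. Qed.

Lemma strand_cell_inverse (u v : cel C) : is_cell v (cod u) (dom u) ->
  cmor u ;; cmor v = id2 (smap_ev (dom u)) -> cmor v ;; cmor u = id2 (smap_ev (cod u)) ->
  inverse_cells u v.
Proof.
intros Hv E1 E2; pose proof Hv as [V1 V2]; split; [exact Hv|split].
- apply (strand_cell_ext (A := dom u) (B := dom u)); trivial using is_cell_id2.
  + apply is_cell_vcomp with (cod u); trivial; now split.
  + rewrite strand_vcompE by congruence; exact E1.
- apply (strand_cell_ext (A := cod u) (B := cod u)); trivial using is_cell_id2.
  + apply is_cell_vcomp with (dom u); trivial; now split.
  + rewrite strand_vcompE by congruence; exact E2.
Qed.

Lemma strand_cell_invertible (u : cel C) : invertible_cell (cmor u) -> invertible_cell u.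
Proof.
intros I; destruct (vinv_elim (cmor_cell u) I) as (H & E1 & E2).
destruct (strand_cell_intro (A := cod u) (B := dom u) (a := vinv (cmor u))) as (v & Hv & Ev);
  [symmetry; apply scell_src|symmetry; apply scell_tgt|exact H|].
exists v; apply strand_cell_inverse; trivial; now rewrite Ev.
Qed.

(** The standard arrow of value [f] between any two objects: everything is multiplied onto the first
    strand, followed by [f], and the other strands receive units. It relies on every object having
    at least one strand. *)
Definition smap_mul (k m : nat) f : smap M.
Proof.
exists (restrict k m (fun l => (total l # f) :: repeat one m) (fun l => id2 (total l # f))).
assert (E : total ((total (units M k) # f) :: repeat one m) = f).
{ cbn [total]; rewrite total_repeat_one, total_units; now rewrite mul_1_l, mul_1_r. }
apply restrict_ok; rewrite E.
- intros l el; cbn [total length]; rewrite repeat_length, total_repeat_one, mul_1_r.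
  repeat split; trivial using dom_id2, cod_id2, invertible_id2.
- now rewrite total_units, mul_1_l.
Defined.

Lemma smap_mul_ev k m f : smap_ev (smap_mul k m f) = f.
Proof.
unfold smap_ev; cbn [smap_mul proj1_sig]; rewrite restrict_ev; cbn [total].
now rewrite total_repeat_one, total_units, mul_1_l, mul_1_r.
Qed.

Lemma smap_mulE k m f l : length l = S k ->
  smap_fun (smap_mul k m f) l = (total l # f) :: repeat one m /\
  smap_str (smap_mul k m f) l = id2 (total l # f).
Proof.
intros e; exact (restrictE m (fun l => (total l # f) :: repeat one m)
  (fun l => id2 (total l # f)) e).
Qed.

(** A 2-cell sees an arrow only through its value, so any arrow back of value [one] is a
    quasi-inverse; [smap_mul] supplies one. *)
Lemma smap_equi (A : arr C) : smap_ev A = one -> equi_arrow A.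
Proof.
assert (K : forall A B : smap M, smap_tgt A = smap_src B -> smap_tgt B = smap_src A ->
  smap_ev A = one -> smap_ev B = one ->
  exists u : cel C, is_cell u (smap_comp A B) (smap_id M (smap_src A)) /\ invertible_cell u).
{ intros A' B e1 e2 E1 E2; destruct (smap_phi_cell e1) as [H I].
  rewrite E1, E2, mul_1_l in H.
  destruct (strand_cell_intro (A := smap_comp A' B) (B := smap_id M (smap_src A'))
    (a := smap_phi A' B)) as (u & Hu & Eu).
  - now rewrite smap_src_comp.
  - now rewrite smap_tgt_comp.
  - now rewrite smap_ev_id.
  - exists u; split; trivial; apply strand_cell_invertible; now rewrite Eu. }
intros E; exists (smap_mul (smap_tgt A) (smap_src A) one).
split; [split; reflexivity|split].
- apply K; trivial; apply smap_mul_ev.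
- apply K; trivial; apply smap_mul_ev.
Qed.

Lemma tens_cmor (u v : cel C) : cmor (u ⊗₂ v) = cmor u ## cmor v.
Proof. reflexivity. Qed.

Lemma cmor_id2 (A : arr C) : cmor (id2 A) = id2 (smap_ev A).
Proof. reflexivity. Qed.

Lemma left_cmor (k : nat) (u : cel C) : cmor ((k : obj C) ⋉₂ u) = cmor u.
Proof.
rewrite tens_cmor, cmor_id2; change (smap_ev (id1 (k : obj C))) with (smap_ev (smap_id M k)).
rewrite smap_ev_id; pose proof (cmor_cell u); unfold one; pasting.
Qed.

Lemma right_cmor (k : nat) (u : cel C) : cmor (u ⋊₂ (k : obj C)) = cmor u.
Proof.
rewrite tens_cmor, cmor_id2; change (smap_ev (id1 (k : obj C))) with (smap_ev (smap_id M k)).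
rewrite smap_ev_id; pose proof (cmor_cell u); unfold one; pasting.
Qed.

Lemma left_ev (k : nat) (A : arr C) : smap_ev ((k : obj C) ⋉₁ A) = smap_ev A.
Proof.
change ((k : obj C) ⋉₁ A) with (smap_tens (smap_id M k) A).
now rewrite smap_ev_tens, smap_ev_id, mul_1_l.
Qed.

Lemma right_ev (k : nat) (A : arr C) : smap_ev (A ⋊₁ (k : obj C)) = smap_ev A.
Proof.
change (A ⋊₁ (k : obj C)) with (smap_tens A (smap_id M k)).
now rewrite smap_ev_tens, smap_ev_id, mul_1_r.
Qed.

(** Values and morphisms between values determine each hom category up to equivalence, and every
    value is attained by [smap_mul]. An endofunctor that preserves both is therefore an equivalence
    on hom categories. Every object is reached up to equi-arrow since all objects are linked by
    arrows of value [one]. *)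
Lemma strand_functor_equivalence (F : two_functor C C) :
  (forall u, cmor (fun2 F u) = cmor u) -> (forall A, smap_ev (fun1 F A) = smap_ev A) ->
  is_two_equivalence F.
Proof.
intros E2 E1; split.
- intros Y; exists 0, (smap_mul (F 0) Y one); split; [split; reflexivity|].
  apply smap_equi, smap_mul_ev.
- intros X Y; apply equivalence_intro.
  + intros A B [a Ha] [b Hb] e; apply sig_ext; simpl in *.
    apply (strand_cell_ext Ha Hb); rewrite <- (E2 a), <- (E2 b).
    exact (f_equal (@cmor M) (f_equal (@proj1_sig _ _) e)).
  + intros [A HA] [B HB] [c Hc].
    assert (Hc' : is_cell c (fun1 F A) (fun1 F B)) by exact Hc.
    assert (Mc : is_cell (cmor c) (smap_ev A) (smap_ev B)).
    { rewrite <- (E1 A), <- (E1 B); destruct Hc' as [<- <-]; apply cmor_cell. }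
    destruct (strand_cell_intro (eq_trans (proj1 HA) (eq_sym (proj1 HB)))
      (eq_trans (proj2 HA) (eq_sym (proj2 HB))) Mc) as (u & Hu & Eu).
    exists (exist (fun a : cel C => is_cell a A B) u Hu); apply sig_ext.
    apply (strand_cell_ext (is_cell_fun F Hu) Hc').
    exact (eq_trans (E2 u) Eu).
  + intros [B HB].
    assert (HA : is_arrow (smap_mul X Y (smap_ev B) : arr C) X Y) by (split; reflexivity).
    pose proof (is_arrow_fun F HA) as HFA.
    exists (exist (fun f : arr C => is_arrow f X Y) _ HA).
    assert (EE : smap_ev (fun1 F (smap_mul X Y (smap_ev B))) = smap_ev B)
      by exact (eq_trans (E1 _) (smap_mul_ev _ _ _)).
    destruct (strand_cell_intro (A := fun1 F (smap_mul X Y (smap_ev B))) (B := B)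
      (a := id2 (smap_ev B)) (eq_trans (proj1 HFA) (eq_sym (proj1 HB)))
      (eq_trans (proj2 HFA) (eq_sym (proj2 HB)))) as (u & Hu & Eu).
    { rewrite EE; apply is_cell_id2. }
    assert (Iu : invertible_cell u).
    { apply strand_cell_invertible; rewrite Eu; apply invertible_id2. }
    destruct (invertible_cell_inverse Hu Iu) as (v & Hv & V1 & V2).
    constructor; unshelve eexists (exist _ u Hu) (exist _ v Hv); apply sig_ext;
      [exact V1|exact V2].
Qed.

(** Object 0 is one strand, and its tensor square computes to object 1, which is two strands. *)
Definition strand_alpha : arr C := smap_mul 1 0 one.

Lemma strand_weak_unit : weak_unit (C := C) 0 strand_alpha.
Proof.
split; [|split; [|split]].
- apply strand_functor_equivalence; [exact (left_cmor 0)|exact (left_ev 0)].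
- apply strand_functor_equivalence; [exact (right_cmor 0)|exact (right_ev 0)].
- split; reflexivity.
- apply smap_equi, smap_mul_ev.
Qed.

(** * Computation of [A], [L], [R] and [T] on strands *)

Notation I := (0 : obj C).
Notation alpha := strand_alpha.
Let W : weak_unit (C := C) I alpha := strand_weak_unit.

(** The two reasons for which a comparison [smap_phi A B] is an identity: [B] is neutral, or [A] is
    pointed. The arrows built from [alpha] by tensoring with [I] are both. *)
Definition neutral A : Prop := smap_ev A = one /\
  forall l, length l = S (smap_src A) -> smap_str A l = id2 (total l).
Definition pointed A : Prop := smap_fun A (units M (smap_src A)) = units M (smap_tgt A).

Lemma neutral_id k : neutral (smap_id M k).
Proof. split; [apply smap_ev_id|intros l; apply smap_str_id]. Qed.

Lemma pointed_id k : pointed (smap_id M k).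
Proof. apply smap_fun_id, length_units. Qed.

Lemma neutral_tens A B : neutral A -> neutral B -> neutral (smap_tens A B).
Proof.
intros [A1 A2] [B1 B2]; split; [now rewrite smap_ev_tens, A1, B1, mul_1_l|].
intros l e; destruct (state_split (k := smap_src A) (m := smap_src B) e) as (l1 & l2 & -> & e1 & e2).
rewrite smap_str_tens, A1, B1, A2, B2, braid_one_l, total_app by trivial; unfold one; pasting.
Qed.

Lemma pointed_tens A B : pointed A -> pointed B -> pointed (smap_tens A B).
Proof.
unfold pointed; intros HA HB.
change (smap_src (smap_tens A B)) with (S (smap_src A + smap_src B)).
change (smap_tgt (smap_tens A B)) with (S (smap_tgt A + smap_tgt B)).
now rewrite !units_app, smap_fun_tens, HA, HB by apply length_units.
Qed.

Lemma alphaE x y : smap_fun alpha (x :: y :: nil) = x # y :: nil /\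
  smap_str alpha (x :: y :: nil) = id2 (x # y).
Proof.
destruct (smap_mulE (k := 1) 0 one (l := x :: y :: nil) eq_refl) as [E1 E2].
unfold strand_alpha; rewrite E1, E2; cbn [total repeat]; now rewrite !mul_1_r.
Qed.

Lemma neutral_alpha : neutral alpha.
Proof.
split; [apply smap_mul_ev|intros l e].
exact (eq_trans (proj2 (smap_mulE (k := 1) 0 one e)) (f_equal (@id2 M) (mul_1_r _))).
Qed.

Lemma pointed_alpha : pointed alpha.
Proof. exact (eq_trans (proj1 (alphaE one one)) (f_equal (fun x => x :: nil) (mul_1_l one))). Qed.

Lemma phi_neutral A B : neutral B -> smap_tgt A = smap_src B -> smap_phi A B = id2 (smap_ev A).
Proof. intros [_ HB] e; apply HB; rewrite <- e; apply smap_length, length_units. Qed.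

Lemma phi_pointed A B : pointed A -> smap_tgt A = smap_src B -> smap_phi A B = id2 (smap_ev B).
Proof.
intros HA e; change (smap_str B (smap_fun A (units M (smap_src A))) = id2 (smap_ev B)).
rewrite HA, e; apply smap_str_units.
Qed.

Lemma cmor_hcomp_neutral (u v : cel C) : tgt (dom u) = src (dom v) ->
  neutral (dom u) -> neutral (dom v) -> neutral (cod u) -> neutral (cod v) ->
  cmor u = id2 one -> cmor v = id2 one -> cmor (u ## v) = id2 one.
Proof.
intros e Nu Nv Nu' Nv' Eu Ev.
assert (e' : tgt (cod u) = src (cod v)) by now rewrite <- tgt_dom, <- src_dom.
rewrite strand_hcompE, Eu, Ev, (phi_neutral Nv e), (phi_neutral Nv' e') by trivial.
rewrite vinv_id2, (proj1 Nu), (proj1 Nu'); unfold one; pasting.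
Qed.

Lemma cmor_inverse (u v : cel C) : inverse_cells u v -> cmor u = id2 one -> cmor v = id2 one.
Proof.
intros ([H1 H2] & E & _) Eu; pose proof (f_equal (@cmor M) E) as E'.
rewrite strand_vcompE, Eu in E' by congruence.
pose proof (cmor_cell u) as Hu; rewrite Eu in Hu.
assert (e : smap_ev (dom u) = one) by (destruct Hu as [Hu _]; rewrite dom_id2 in Hu; now symmetry).
assert (e' : smap_ev (cod u) = one) by (destruct Hu as [_ Hu]; rewrite cod_id2 in Hu; now symmetry).
pose proof (cmor_cell v) as Hv.
assert (Hv' : is_cell (cmor v) one one).
{ rewrite <- e' at 1; rewrite <- e; rewrite <- H1, <- H2; exact Hv. }
rewrite (vcomp_id_left Hv') in E'; rewrite E', cmor_id2; now rewrite e.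
Qed.

(** Since [A] does not depend on the choices, [alpha] itself may serve as [lam] and [rho], with [l]
    and [r] both the 2-cell [A0] carried by the identity of [one]. All the arrows involved are
    neutral, so this same 2-cell solves the equation for [A]. *)
Lemma strand_A (D0 : unit_choices I alpha) :
  cmor (uc_A D0) = id2 one /\ cmor (uc_Ai D0) = id2 one.
Proof.
assert (N1 : neutral (I ⋉₁ alpha)) by (apply neutral_tens; [apply neutral_id|apply neutral_alpha]).
assert (N2 : neutral (alpha ⋊₁ I)) by (apply neutral_tens; [apply neutral_alpha|apply neutral_id]).
assert (N3 : neutral (I ⋉₁ (alpha ⋊₁ I))) by (apply neutral_tens; trivial; apply neutral_id).
assert (N4 : neutral ((I ⋉₁ alpha) ⋊₁ I)) by (apply neutral_tens; trivial; apply neutral_id).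
assert (N5 : neutral (I ⋉₁ (I ⋉₁ alpha))) by (apply neutral_tens; trivial; apply neutral_id).
assert (N6 : neutral ((alpha ⋊₁ I) ⋊₁ I)) by (apply neutral_tens; trivial; apply neutral_id).
destruct (strand_cell_intro (A := I ⋉₁ alpha) (B := alpha ⋊₁ I) (a := id2 one) eq_refl eq_refl)
  as (A0 & HA & EA).
{ rewrite (proj1 N1), (proj1 N2); apply is_cell_id2. }
destruct (strand_cell_intro (A := alpha ⋊₁ I) (B := I ⋉₁ alpha) (a := id2 one) eq_refl eq_refl)
  as (A1 & HA1 & EA1).
{ rewrite (proj1 N1), (proj1 N2); apply is_cell_id2. }
assert (IA : inverse_cells A0 A1).
{ pose proof HA as [D1 D2]; apply strand_cell_inverse; rewrite ?D1, ?D2, ?EA, ?EA1; trivial.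
  - rewrite (proj1 N1); apply id2_vcomp.
  - rewrite (proj1 N2); apply id2_vcomp. }
assert (Halpha : is_arrow (C := C) alpha (I ⊗₀ I) I) by (split; reflexivity).
destruct (A_composite_typed W Halpha Halpha HA HA IA IA) as [T _].
(* Every 2-cell in sight is carried by the identity of [one] between neutral arrows, so both sides
   are carried by it as well. *)
assert (E : (I ⋉₁ (alpha ⋊₁ I)) <| A0 = A_composite I A0 A1 A0 A1).
{ apply (strand_cell_ext (A := (I ⋉₁ (alpha ⋊₁ I)) # (I ⋉₁ alpha))
    (B := (I ⋉₁ (alpha ⋊₁ I)) # (alpha ⋊₁ I))); [|exact T|].
  { apply is_cell_hcomp; [apply is_cell_id2|exact HA|reflexivity]. }
  pose proof (is_cell_left I HA1) as HIA; pose proof (is_cell_right I HA1) as HAI.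
  pose proof HA as [D1 D2]; pose proof HA1 as [D3 D4].
  pose proof HIA as [D5 D6]; pose proof HAI as [D7 D8].
  transitivity (id2 one).
  - apply cmor_hcomp_neutral; rewrite ?dom_id2, ?cod_id2, ?D1, ?D2; trivial.
    rewrite cmor_id2; now rewrite (proj1 N3).
  - unfold A_composite; rewrite strand_vcompE.
    + rewrite !cmor_hcomp_neutral; rewrite ?D1, ?D2, ?D5, ?D6, ?D7, ?D8, ?left_cmor, ?right_cmor;
        trivial; symmetry; apply id2_vcomp.
    + rewrite cod_hcomp, dom_hcomp by (rewrite ?D1, ?D2, ?D5, ?D6, ?D7, ?D8; reflexivity).
      rewrite ?D1, ?D2, ?D5, ?D6, ?D7, ?D8; apply (exchange_lam_rho Halpha Halpha). }
assert (EE : uc_A D0 = A0).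
{ exact (A_unique W (uc_lam_arrow D0) (uc_rho_arrow D0) (uc_l_cell D0) (uc_r_cell D0)
    (uc_l_inv D0) (uc_r_inv D0) Halpha Halpha HA HA IA IA (uc_A_cell D0) HA (uc_A_eq D0) E). }
rewrite EE; split; trivial.
apply cmor_inverse with A0; trivial; rewrite <- EE; apply uc_A_inv.
Qed.

Lemma is_arrow_alpha : is_arrow (C := C) alpha (I ⊗₀ I) I.
Proof. split; reflexivity. Qed.

Lemma neutral_left : neutral (I ⋉₁ alpha) /\ pointed (I ⋉₁ alpha).
Proof.
split; [apply neutral_tens; [apply neutral_id|apply neutral_alpha]
  |apply pointed_tens; [apply pointed_id|apply pointed_alpha]].
Qed.

Lemma neutral_right : neutral (alpha ⋊₁ I) /\ pointed (alpha ⋊₁ I).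
Proof.
split; [apply neutral_tens; [apply neutral_alpha|apply neutral_id]
  |apply pointed_tens; [apply pointed_alpha|apply pointed_id]].
Qed.

(** In the equation for [I ⋉₂ L] the 2-cells [A] are carried by identities, and the four comparisons
    are trivial: two because their second arrow is neutral, two because their first arrow is
    pointed. *)
Lemma strand_L (D0 : unit_choices I alpha) (f : arr C) (L : cel C) :
  is_arrow f I I -> is_L D0 f L -> cmor L = id2 (smap_ev f).
Proof.
intros Hf (HL & _ & EL); destruct (strand_A D0) as [EA EAi].
pose proof (uc_A_cell D0) as HA.
destruct (inverse_cells_elim HA (uc_A_inv D0)) as (HAi & _).
destruct (exchange_end W Hf) as [X _].
pose proof (is_arrow_left I Hf) as HIf; pose proof (is_arrow_left I HIf) as HIIf.
assert (T1 : tgt (I ⋉₁ (I ⋉₁ f)) = src (I ⋉₁ alpha)) by (rewrite (proj2 HIIf); reflexivity).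
assert (T2 : tgt (alpha ⋊₁ I) = src (I ⋉₁ f)) by (rewrite (proj1 HIf); reflexivity).
destruct HA as [D1 D2], HAi as [D3 D4].
rewrite <- (left_cmor 0), EL, strand_vcompE.
2: { rewrite cod_hcomp, dom_hcomp by (rewrite ?D1, ?D2, ?D3, ?D4, ?dom_id2; trivial).
  rewrite D2, D3, cod_id2, dom_id2; exact X. }
rewrite !strand_hcompE by (rewrite ?D1, ?D2, ?D3, ?D4, ?dom_id2; trivial).
rewrite D1, D2, D3, D4, !dom_id2, !cod_id2, EA, EAi, !cmor_id2.
assert (T3 : tgt (I ⋉₁ (I ⋉₁ f)) = src (alpha ⋊₁ I)) by exact T1.
assert (T4 : tgt (I ⋉₁ alpha) = src (I ⋉₁ f)) by exact T2.
rewrite (phi_neutral (proj1 neutral_left) T1), (phi_neutral (proj1 neutral_right) T3).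
rewrite (phi_pointed (proj2 neutral_right) T2), (phi_pointed (proj2 neutral_left) T4).
rewrite !left_ev, vinv_id2; unfold one; pasting.
Qed.

Lemma strand_R (D0 : unit_choices I alpha) (f : arr C) (R : cel C) :
  is_arrow f I I -> is_R D0 f R -> cmor R = id2 (smap_ev f).
Proof.
intros Hf (HR & _ & ER); destruct (strand_A D0) as [EA EAi].
pose proof (uc_A_cell D0) as HA.
destruct (inverse_cells_elim HA (uc_A_inv D0)) as (HAi & _).
destruct (exchange_end W Hf) as [_ X].
pose proof (is_arrow_right I Hf) as HfI; pose proof (is_arrow_right I HfI) as HfII.
assert (T1 : tgt ((f ⋊₁ I) ⋊₁ I) = src (I ⋉₁ alpha)) by (rewrite (proj2 HfII); reflexivity).
assert (T2 : tgt (alpha ⋊₁ I) = src (f ⋊₁ I)) by (rewrite (proj1 HfI); reflexivity).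
destruct HA as [D1 D2], HAi as [D3 D4].
rewrite <- (right_cmor 0), ER, strand_vcompE.
2: { rewrite cod_hcomp, dom_hcomp by (rewrite ?D1, ?D2, ?D3, ?D4, ?dom_id2; trivial).
  rewrite D1, D4, cod_id2, dom_id2; exact X. }
rewrite !strand_hcompE by (rewrite ?D1, ?D2, ?D3, ?D4, ?dom_id2; trivial).
rewrite D1, D2, D3, D4, !dom_id2, !cod_id2, EA, EAi, !cmor_id2.
assert (T3 : tgt ((f ⋊₁ I) ⋊₁ I) = src (alpha ⋊₁ I)) by exact T1.
assert (T4 : tgt (I ⋉₁ alpha) = src (f ⋊₁ I)) by exact T2.
rewrite (phi_neutral (proj1 neutral_left) T1), (phi_neutral (proj1 neutral_right) T3).
rewrite (phi_pointed (proj2 neutral_right) T2), (phi_pointed (proj2 neutral_left) T4).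
rewrite !right_ev, vinv_id2; unfold one; pasting.
Qed.

Section Endomorphisms.
Variables f g : arr C.
Hypotheses (Hf : is_arrow f I I) (Hg : is_arrow g I I).

Lemma end_src (h : arr C) : is_arrow h I I -> smap_src h = 0 /\ smap_tgt h = 0.
Proof. intros H; exact H. Qed.

Lemma end_fun_one (h : arr C) : is_arrow h I I -> smap_fun h (one :: nil) = smap_ev h :: nil.
Proof.
intros [H1 H2]; change (smap_src h = 0) in H1; change (smap_tgt h = 0) in H2.
unfold smap_ev, sm_ev; change (sm_src (proj1_sig h)) with (smap_src h); rewrite H1.
change (sm_fun (proj1_sig h)) with (smap_fun h); change (units M 0) with (one :: nil).
assert (E : length (smap_fun h (one :: nil)) = 1).
{ rewrite smap_length; now rewrite ?H1, ?H2. }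
destruct (smap_fun h (one :: nil)) as [|x [|y l]]; try discriminate E.
cbn [total]; now rewrite mul_1_r.
Qed.

Lemma end_str_one (h : arr C) : is_arrow h I I -> smap_str h (one :: nil) = id2 (smap_ev h).
Proof.
intros [H1 _]; change (smap_src h = 0) in H1.
pose proof (smap_str_units h) as E; rewrite H1 in E; exact E.
Qed.

Lemma left_src (h : arr C) : is_arrow h I I -> smap_src (I ⋉₁ h) = 1 /\ smap_tgt (I ⋉₁ h) = 1.
Proof. intros H; exact (is_arrow_left I H). Qed.

Lemma right_src (h : arr C) : is_arrow h I I -> smap_src (h ⋊₁ I) = 1 /\ smap_tgt (h ⋊₁ I) = 1.
Proof. intros H; exact (is_arrow_right I H). Qed.

Lemma left_units (h : arr C) : is_arrow h I I ->
  smap_fun (I ⋉₁ h) (one :: one :: nil) = one :: smap_ev h :: nil.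
Proof.
intros Hh.
assert (E : smap_fun (smap_tens (smap_id M 0) h) ((one :: nil) ++ (one :: nil)) =
  smap_fun (smap_id M 0) (one :: nil) ++ smap_fun h (one :: nil)).
{ apply smap_fun_tens; [reflexivity|now rewrite (proj1 (end_src Hh))]. }
rewrite smap_fun_id, (end_fun_one Hh) in E by reflexivity; exact E.
Qed.

Lemma right_fun (h : arr C) x : is_arrow h I I ->
  smap_fun (h ⋊₁ I) (one :: x :: nil) = smap_ev h :: x :: nil.
Proof.
intros Hh.
assert (E : smap_fun (smap_tens h (smap_id M 0)) ((one :: nil) ++ (x :: nil)) =
  smap_fun h (one :: nil) ++ smap_fun (smap_id M 0) (x :: nil)).
{ apply smap_fun_tens; [now rewrite (proj1 (end_src Hh))|reflexivity]. }
rewrite smap_fun_id, (end_fun_one Hh) in E by reflexivity; exact E.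
Qed.

(** Here the braiding shows: the value of [h], produced on the first strand, must pass the colour
    [x] of the second. In [left_str] it is the value [one] of an identity that would have to pass,
    so no braiding arises. *)
Lemma right_str (h : arr C) x : is_arrow h I I ->
  smap_str (h ⋊₁ I) (one :: x :: nil) = sb_braid (smap_ev h) x.
Proof.
intros Hh.
assert (E : smap_str (smap_tens h (smap_id M 0)) ((one :: nil) ++ (x :: nil)) =
  (smap_str h (one :: nil) ## smap_str (smap_id M 0) (x :: nil)) ;;
  ((total (one :: nil) <| sb_braid (smap_ev h) (total (x :: nil))) |> smap_ev (smap_id M 0))).
{ apply smap_str_tens; [now rewrite (proj1 (end_src Hh))|reflexivity]. }
rewrite smap_str_id, (end_str_one Hh), smap_ev_id in E by reflexivity.
cbn [total] in E; rewrite !mul_1_r in E.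
refine (eq_trans E _); pose proof (sb_braid_cell (smap_ev h) x); unfold one; pasting.
Qed.

Lemma left_str (h : arr C) x : is_arrow h I I ->
  smap_str (I ⋉₁ h) (x :: one :: nil) = id2 (x # smap_ev h).
Proof.
intros Hh.
assert (E : smap_str (smap_tens (smap_id M 0) h) ((x :: nil) ++ (one :: nil)) =
  (smap_str (smap_id M 0) (x :: nil) ## smap_str h (one :: nil)) ;;
  ((total (x :: nil) <| sb_braid (smap_ev (smap_id M 0)) (total (one :: nil))) |> smap_ev h)).
{ apply smap_str_tens; [reflexivity|now rewrite (proj1 (end_src Hh))]. }
rewrite smap_str_id, (end_str_one Hh), smap_ev_id in E by reflexivity.
cbn [total] in E; rewrite !mul_1_r, braid_one_r in E.
refine (eq_trans E _); unfold one; pasting.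
Qed.

Lemma phi_fun A B : smap_phi A B = smap_str B (smap_fun A (units M (smap_src A))).
Proof. reflexivity. Qed.

Lemma phi_left (h : arr C) B : is_arrow h I I ->
  smap_phi (I ⋉₁ h) B = smap_str B (one :: smap_ev h :: nil).
Proof.
intros Hh; rewrite phi_fun, (proj1 (left_src Hh)).
now rewrite <- (left_units Hh).
Qed.

Lemma phi_right (h : arr C) B : is_arrow h I I ->
  smap_phi (h ⋊₁ I) B = smap_str B (smap_ev h :: one :: nil).
Proof.
intros Hh; rewrite phi_fun, (proj1 (right_src Hh)).
now rewrite <- (right_fun one Hh).
Qed.

Lemma phi_end (h : arr C) B : is_arrow h I I -> smap_phi h B = smap_str B (smap_ev h :: nil).
Proof.
intros Hh; rewrite phi_fun, (proj1 (end_src Hh)); now rewrite <- (end_fun_one Hh).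
Qed.

Lemma alpha_comp_str (h : arr C) x y : is_arrow h I I ->
  smap_str (smap_comp alpha h) (x :: y :: nil) = smap_str h (x # y :: nil).
Proof.
intros Hh; pose proof (proj1 (end_src Hh)) as e.
assert (e' : smap_tgt alpha = smap_src h) by now rewrite e.
rewrite smap_str_comp by trivial; rewrite (proj1 (alphaE x y)), (proj2 (alphaE x y)).
rewrite (phi_pointed pointed_alpha e'), vinv_id2; cbn [total]; rewrite mul_1_r.
assert (H : is_cell (smap_str h (x # y :: nil)) (total (smap_fun h (x # y :: nil)))
  (total (x # y :: nil) # smap_ev h)) by (apply smap_str_cell; now rewrite e).
cbn [total] in H; rewrite mul_1_r in H; pasting.
Qed.
End Endomorphisms.

(** These are the comparisons met in the slide equation. When [f] acts first, on the second strand,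
    [g] must afterwards cross its value, which gives the braiding. When [g] acts first, on the first
    strand, [f] has nothing to cross and the comparison is an identity. The others compare only [f]
    and [g] themselves. *)
Lemma phi_slides (f g : arr C) : is_arrow f I I -> is_arrow g I I ->
  smap_phi (I ⋉₁ f) (smap_comp (g ⋊₁ I) alpha) = sb_braid (smap_ev g) (smap_ev f) /\
  smap_phi (I ⋉₁ f) (smap_comp alpha g) = smap_phi f g /\
  smap_phi (smap_comp (I ⋉₁ f) alpha) g = smap_phi f g /\
  smap_phi (smap_comp alpha f) g = smap_phi f g /\
  smap_phi (g ⋊₁ I) (smap_comp (I ⋉₁ f) alpha) = id2 (smap_ev g # smap_ev f) /\
  smap_phi (g ⋊₁ I) (smap_comp alpha f) = smap_phi g f /\
  smap_phi (smap_comp (g ⋊₁ I) alpha) f = smap_phi g f.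
Proof.
intros Hf Hg.
destruct (left_src Hf) as [S1 S2], (right_src Hg) as [S3 S4].
destruct (end_src Hf) as [S5 S6], (end_src Hg) as [S7 S8].
assert (J1 : smap_tgt (g ⋊₁ I) = smap_src alpha) by now rewrite S4.
assert (J2 : smap_tgt (I ⋉₁ f) = smap_src alpha) by now rewrite S2.
assert (J3 : smap_tgt alpha = smap_src f) by now rewrite S5.
repeat split.
- rewrite (phi_left _ Hf), smap_str_comp by (rewrite ?S3; trivial).
  rewrite (right_fun (smap_ev f) Hg), (right_str (smap_ev f) Hg).
  rewrite (proj2 (alphaE _ _)), (proj1 neutral_alpha), (phi_neutral neutral_alpha J1), vinv_id2.
  rewrite right_ev; cbn [total]; rewrite mul_1_r, mul_1_l.
  pose proof (sb_braid_cell (smap_ev g) (smap_ev f)); unfold one; pasting.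
- now rewrite (phi_left _ Hf), (alpha_comp_str one (smap_ev f) Hg), mul_1_l, (phi_end _ Hf).
- rewrite phi_fun, smap_src_comp, S1 by trivial.
  rewrite smap_fun_comp by (rewrite ?S1; trivial).
  change (units M 1) with (one :: one :: nil).
  now rewrite (left_units Hf), (proj1 (alphaE _ _)), mul_1_l, (phi_end _ Hf).
- rewrite phi_fun, smap_src_comp by trivial.
  change (units M (smap_src alpha)) with (one :: one :: nil).
  rewrite smap_fun_comp, (proj1 (alphaE _ _)), mul_1_l, (end_fun_one Hf) by trivial.
  now rewrite (phi_end _ Hf).
- rewrite (phi_right _ Hg), smap_str_comp by (rewrite ?S1; trivial).
  rewrite (left_str (smap_ev g) Hf), (phi_neutral neutral_alpha J2), vinv_id2, left_ev.
  rewrite (proj1 neutral_alpha).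
  assert (E : smap_fun (I ⋉₁ f) (smap_ev g :: one :: nil) = smap_ev g :: smap_ev f :: nil).
  { assert (E : smap_fun (smap_tens (smap_id M 0) f) ((smap_ev g :: nil) ++ (one :: nil)) =
      smap_fun (smap_id M 0) (smap_ev g :: nil) ++ smap_fun f (one :: nil)).
    { apply smap_fun_tens; [reflexivity|now rewrite S5]. }
    rewrite smap_fun_id, (end_fun_one Hf) in E by reflexivity; exact E. }
  rewrite E, (proj2 (alphaE _ _)); cbn [total]; rewrite !mul_1_r; unfold one; pasting.
- now rewrite (phi_right _ Hg), (alpha_comp_str (smap_ev g) one Hf), mul_1_r, (phi_end _ Hg).
- rewrite phi_fun, smap_src_comp, S3 by trivial.
  rewrite smap_fun_comp by (rewrite ?S3; trivial).
  change (units M 1) with (one :: one :: nil).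
  now rewrite (right_fun one Hg), (proj1 (alphaE _ _)), mul_1_r, (phi_end _ Hg).
Qed.

(** With [L] and [R] carried by identities, the slide equation contains nothing but comparisons, the
    one braiding from [phi_slides], and [cmor t], for which it is solved. *)
Lemma strand_T (f g : arr C) (t : cel C) : is_arrow f I I -> is_arrow g I I ->
  is_T I alpha f g t ->
  cmor t = smap_phi f g ;; vinv (sb_braid (smap_ev g) (smap_ev f)) ;; vinv (smap_phi g f).
Proof.
intros Hf Hg HT; destruct (unit_choices_exist W) as [D0 _].
destruct (L_exists W D0 Hf) as [L DL], (R_exists W D0 Hg) as [R DR].
destruct (is_T_slide W Hf Hg DL DR HT) as (Ht & E & _).
pose proof (strand_L Hf DL) as EL; pose proof (strand_R Hg DR) as ER.
destruct DL as ([L1 L2] & _), DR as ([R1 R2] & _); pose proof Ht as [t1 t2].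
pose proof (is_arrow_left I Hf) as HIf; pose proof (is_arrow_right I Hg) as HgI.
pose proof is_arrow_alpha as Ha.
destruct (phi_slides Hf Hg) as (P1 & P2 & P3 & P4 & P5 & P6 & P7).
destruct (phi_slides Hg Hf) as (_ & _ & _ & P8 & _ & _ & _).
assert (HL : is_cell L ((I ⋉₁ f) # alpha) (alpha # f)) by now split.
assert (HR : is_cell R ((g ⋊₁ I) # alpha) (alpha # g)) by now split.
unfold slide_eq in E; apply (f_equal (@cmor M)) in E.
rewrite !strand_vcompE in E by boundary.
rewrite !strand_hcompE in E by boundary.
rewrite !dom_id2, !cod_id2, L1, L2, R1, R2, t1, t2, EL, ER, !cmor_id2 in E.
change (smap_phi (I ⋉₁ f) ((g ⋊₁ I) # alpha) = sb_braid (smap_ev g) (smap_ev f)) in P1.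
change (smap_phi (I ⋉₁ f) (alpha # g) = smap_phi f g) in P2.
change (smap_phi ((I ⋉₁ f) # alpha) g = smap_phi f g) in P3.
change (smap_phi (alpha # f) g = smap_phi f g) in P4.
change (smap_phi (g ⋊₁ I) ((I ⋉₁ f) # alpha) = id2 (smap_ev g # smap_ev f)) in P5.
change (smap_phi (g ⋊₁ I) (alpha # f) = smap_phi g f) in P6.
change (smap_phi ((g ⋊₁ I) # alpha) f = smap_phi g f) in P7.
change (smap_phi (alpha # g) f = smap_phi g f) in P8.
assert (P9 : forall h : arr C, is_arrow h I I -> smap_phi alpha h = id2 (smap_ev h)).
{ intros h [h1 _]; apply (phi_pointed pointed_alpha); symmetry; exact h1. }
rewrite P1, P2, P3, P4, P5, P6, P7, P8, !P9 in E by (split; boundary).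
rewrite left_ev, right_ev, (proj1 neutral_alpha), vinv_id2 in E.
clear P1 P2 P3 P4 P5 P6 P7 P8 P9 L1 L2 R1 R2 EL ER HL HR.
assert (Hfg : smap_tgt f = smap_src g) by exact (eq_trans (proj2 Hf) (eq_sym (proj1 Hg))).
assert (Hgf : smap_tgt g = smap_src f) by exact (eq_trans (proj2 Hg) (eq_sym (proj1 Hf))).
destruct (smap_phi_cell Hfg) as [C1 I1], (smap_phi_cell Hgf) as [C2 I2].
destruct (vinv_elim C1 I1) as (D1 & V1 & W1), (vinv_elim C2 I2) as (D2 & V2 & W2).
pose proof (sb_braid_cell (smap_ev g) (smap_ev f)) as C3.
destruct (vinv_elim C3 (sb_braid_invertible _ _)) as (D3 & V3 & W3).
pose proof (cmor_cell t) as Hm.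
change (cdom t) with (dom t) in Hm; change (ccod t) with (cod t) in Hm.
rewrite t1, t2 in Hm; change (f # g) with (smap_comp f g) in Hm, E.
change (g # f) with (smap_comp g f) in Hm, E.
set (p := smap_phi f g) in *; set (q := smap_phi g f) in *.
set (b := sb_braid _ _) in *; set (m := cmor t) in *.
set (x := smap_ev f) in *; set (y := smap_ev g) in *.
set (X := smap_ev (smap_comp f g)) in *; set (Y := smap_ev (smap_comp g f)) in *.
(* The slide equation after all cancellations. *)
assert (E' : b ;; vinv p ;; m = vinv q).
{ transitivity (((b ;; (id2 x |> y) ;; vinv p) ;; (p ;; (id2 x |> y) ;; vinv p) ;; id2 X ;;
    (one <| m) ;; id2 Y)).
  - transitivity (b ;; (vinv p ;; p) ;; vinv p ;; m); [rewrite W1; pasting|unfold one; pasting].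
  - rewrite E; transitivity (vinv q ;; (q ;; vinv q)); [pasting|rewrite V2; pasting]. }
rewrite <- E'; transitivity (p ;; (vinv b ;; b) ;; vinv p ;; m); [|pasting].
rewrite W3; transitivity ((p ;; vinv p) ;; m); [rewrite V1|]; pasting.
Qed.
End Unit.

(** * Strictification *)

Section Monoidal.
Variable M : monoidal_category.
Implicit Types (x y z t : M) (l m n : list M).

Lemma tens_hom_comp x x' x'' y y' y'' (f : x ⟶ x') (f' : x' ⟶ x'') (g : y ⟶ y') (g' : y' ⟶ y'') :
  (f ⨟ f') ⊠ (g ⨟ g') = (f ⊠ g) ⨟ (f' ⊠ g').
Proof.
exact (@fmap_comp _ _ (mtens M) (x, y) (x', y') (x'', y'') (f, g) (f', g')).
Qed.

Lemma tens_hom_id x y : cid x ⊠ cid y = cid (x ⊗ y).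
Proof. exact (fmap_id (mtens M) (x, y)). Qed.

Lemma tens_left_comp x y y' y'' (g : y ⟶ y') (g' : y' ⟶ y'') :
  cid x ⊠ (g ⨟ g') = (cid x ⊠ g) ⨟ (cid x ⊠ g').
Proof. rewrite <- (cid_l (cid x)) at 1; apply tens_hom_comp. Qed.

Lemma tens_right_comp x x' x'' y (f : x ⟶ x') (f' : x' ⟶ x'') :
  (f ⨟ f') ⊠ cid y = (f ⊠ cid y) ⨟ (f' ⊠ cid y).
Proof. rewrite <- (cid_l (cid y)) at 1; apply tens_hom_comp. Qed.

Lemma iso_cancel_l (A : category) (a b c : A) (i : iso a b) (f g : b ⟶ c) :
  i ⨟ f = i ⨟ g -> f = g.
Proof.
intros e; rewrite <- (cid_l f), <- (cid_l g), <- (iso_inv_hom i), <- !ccompA.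
now rewrite e.
Qed.

Lemma iso_cancel_r (A : category) (a b c : A) (i : iso b c) (f g : a ⟶ b) :
  f ⨟ i = g ⨟ i -> f = g.
Proof.
intros e; rewrite <- (cid_r f), <- (cid_r g), <- (iso_hom_inv i), !ccompA.
now rewrite e.
Qed.

Definition tens_iso x x' y y' (i : iso x x') (j : iso y y') : iso (x ⊗ y) (x' ⊗ y').
Proof.
refine (@Iso _ _ _ (i ⊠ j) (iso_inv i ⊠ iso_inv j) _ _);
rewrite <- tens_hom_comp; [rewrite !iso_hom_inv|rewrite !iso_inv_hom]; apply tens_hom_id.
Defined.

Definition id_iso (A : category) (a : A) : iso a a := Iso (cid_l (cid a)) (cid_l (cid a)).

Definition comp_iso (A : category) (a b c : A) (i : iso a b) (j : iso b c) : iso a c.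
Proof.
refine (@Iso _ _ _ (i ⨟ j) (iso_inv j ⨟ iso_inv i) _ _).
- now rewrite <- ccompA, (ccompA j), iso_hom_inv, cid_l, iso_hom_inv.
- now rewrite <- ccompA, (ccompA (iso_inv i)), iso_inv_hom, cid_l, iso_inv_hom.
Defined.

Lemma tens_unit_l_faithful x y (f g : x ⟶ y) :
  cid (munit M) ⊠ f = cid (munit M) ⊠ g -> f = g.
Proof.
intros e; apply (iso_cancel_l (i := mlunit x)); now rewrite <- !mlunit_natural, e.
Qed.

Lemma tens_unit_r_faithful x y (f g : x ⟶ y) :
  f ⊠ cid (munit M) = g ⊠ cid (munit M) -> f = g.
Proof.
intros e; apply (iso_cancel_l (i := mrunit x)); now rewrite <- !mrunit_natural, e.
Qed.

Notation e := (munit M).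

(** Kelly's consequences of the pentagon and triangle axioms. *)
Lemma massoc_lunit x y :
  massoc (munit M) x y ⨟ mlunit (x ⊗ y) = mlunit x ⊠ cid y.
Proof.
apply tens_unit_l_faithful.
apply (iso_cancel_l (i := comp_iso (tens_iso (massoc e e x) (id_iso y)) (massoc e (e ⊗ x) y))).
cbn [iso_hom comp_iso tens_iso id_iso].
pose proof (mpentagon e e x y) as P.
rewrite tens_left_comp.
transitivity (((massoc e e x ⊠ cid y) ⨟ (massoc e (e ⊗ x) y ⨟ (cid e ⊠ massoc e x y))) ⨟
  (cid e ⊠ mlunit (x ⊗ y))); [now rewrite <- !ccompA|].
rewrite <- P, <- ccompA, mtriangle, <- (tens_hom_id x y), <- massoc_natural.
now rewrite <- ccompA, <- massoc_natural, ccompA, <- tens_right_comp, mtriangle.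
Qed.

Lemma massoc_runit x y :
  massoc x y (munit M) ⨟ (cid x ⊠ mrunit y) = mrunit (x ⊗ y).
Proof.
apply tens_unit_r_faithful.
apply (iso_cancel_r (i := massoc x y e)).
pose proof (mpentagon x y e e) as P.
rewrite tens_right_comp, <- ccompA, massoc_natural, <- (mtriangle y e), tens_left_comp.
rewrite <- (mtriangle (x ⊗ y) e), <- ccompA, <- (tens_hom_id x y), massoc_natural, !ccompA.
now rewrite P, <- !ccompA.
Qed.

Lemma lunit_runit : iso_hom (mlunit (munit M)) = mrunit (munit M).
Proof.
apply tens_unit_r_faithful.
rewrite <- massoc_lunit, <- mtriangle; f_equal.
apply (iso_cancel_r (i := mlunit e)); symmetry; apply mlunit_natural.
Qed.

Fixpoint btot l : M :=
  match l with nil => munit M | x :: l => x ⊗ btot l end.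

Fixpoint list_mu l m : iso (btot l ⊗ btot m) (btot (l ++ m)) :=
  match l with
  | nil => mlunit (btot m)
  | x :: l => comp_iso (massoc x (btot l) (btot m)) (tens_iso (id_iso x) (list_mu l m))
  end.

(** Concatenation is associative and unital only up to propositional equality. Morphisms whose
    boundaries are equal lists are compared through these isomorphisms. *)
Definition transport l l' (p : l = l') : iso (btot l) (btot l') :=
  match p in _ = l' return iso (btot l) (btot l') with eq_refl => id_iso (btot l) end.

Lemma transport_refl l (p : l = l) : iso_hom (transport p) = cid (btot l).
Proof. now rewrite (proof_irrelevance _ p eq_refl). Qed.

Lemma transport_cons x l l' (p : l = l') (q : x :: l = x :: l') :
  iso_hom (transport q) = cid x ⊠ transport p.
Proof. destruct p; rewrite transport_refl; symmetry; apply tens_hom_id. Qed.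

(** Induction on [l]: the empty list is the unit coherence [massoc_lunit], and adding an object is
    the pentagon. *)
Lemma mu_assoc_list l m n (p : (l ++ m) ++ n = l ++ (m ++ n)) :
  (list_mu l m ⊠ cid (btot n)) ⨟ (list_mu (l ++ m) n ⨟ transport p) =
  massoc (btot l) (btot m) (btot n) ⨟ ((cid (btot l) ⊠ list_mu m n) ⨟ list_mu l (m ++ n)).
Proof.
induction l as [|x l IH]; simpl in *.
- rewrite transport_refl, cid_r, mlunit_natural, ccompA, massoc_lunit; reflexivity.
- assert (p' : (l ++ m) ++ n = l ++ (m ++ n)) by now injection p.
  pose proof (transport_cons p' p) as E; simpl in E; rewrite E, !ccompA, <- (tens_hom_id x (btot l)).
  rewrite <- (ccompA (massoc (x ⊗ btot l) _ _)), massoc_natural, !ccompA, mpentagon.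
  rewrite tens_right_comp, <- !ccompA; f_equal.
  rewrite ccompA, massoc_natural, <- !ccompA; f_equal.
  rewrite <- !tens_left_comp, IH, ccompA; reflexivity.
Qed.

(** Induction on [l]: the empty list needs the agreement of the two unitors at the unit, and adding
    an object is [massoc_runit]. *)
Lemma mu_nil l (p : l ++ nil = l) : list_mu l nil ⨟ transport p = mrunit (btot l).
Proof.
induction l as [|x l IH]; simpl in *.
- pose proof (transport_refl p) as E; simpl in E; now rewrite E, cid_r, lunit_runit.
- assert (p' : l ++ nil = l) by now injection p.
  pose proof (transport_cons p' p) as E; simpl in E; rewrite E, <- ccompA, <- tens_left_comp, IH; apply massoc_runit.
Qed.
End Monoidal.

(** * Lists of objects as a strict braided monoidal category *)

Section Strictify.
Variable B : braided_monoidal_category.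
Implicit Types (x y z t : B) (l m n : list B).

Record list_cell := ListCell {
  lc_dom : list B; lc_cod : list B; lc_mor : btot (M := B) lc_dom ⟶ btot lc_cod }.
Implicit Types u v w : list_cell.

Lemma list_cell_ext l l' m m' (a : btot l ⟶ btot m) (a' : btot l' ⟶ btot m')
    (p : l = l') (q : m = m') :
  a ⨟ transport q = transport p ⨟ a' -> ListCell a = ListCell a'.
Proof. destruct p, q; simpl; rewrite cid_l, cid_r; now intros ->. Qed.

(** Composability is an equality of lists of objects, decided classically; outside it the value [u]
    is junk. *)
Definition list_vcomp u v : list_cell :=
  match excluded_middle_informative (lc_cod u = lc_dom v) with
  | left e => ListCell (lc_mor u ⨟ (transport e ⨟ lc_mor v))
  | right _ => u
  end.

Lemma list_vcompE u v (e : lc_cod u = lc_dom v) :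
  list_vcomp u v = ListCell (lc_mor u ⨟ (transport e ⨟ lc_mor v)).
Proof.
unfold list_vcomp; destruct (excluded_middle_informative _) as [e'|]; [|contradiction].
now rewrite (proof_irrelevance _ e' e).
Qed.

Definition list_id l : list_cell := ListCell (cid (btot (M := B) l)).

Definition list_hcomp u v : list_cell :=
  ListCell (iso_inv (list_mu _ _) ⨟ ((lc_mor u ⊠ lc_mor v) ⨟ list_mu (lc_cod u) (lc_cod v))).

Lemma list_vcomp_same l m n (a : btot l ⟶ btot m) (b : btot m ⟶ btot n) :
  list_vcomp (ListCell a) (ListCell b) = ListCell (a ⨟ b).
Proof. rewrite (list_vcompE (u := ListCell a) (v := ListCell b) eq_refl); simpl; now rewrite cid_l. Qed.

Lemma tens_merge x x' x'' y y' y'' t (f : x ⟶ x') (f' : x' ⟶ x'') (g : y ⟶ y')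
    (g' : y' ⟶ y'') (h : x'' ⊗ y'' ⟶ t) :
  (f ⊠ g) ⨟ ((f' ⊠ g') ⨟ h) = ((f ⨟ f') ⊠ (g ⨟ g')) ⨟ h.
Proof. now rewrite ccompA, <- tens_hom_comp. Qed.

Lemma mu_iso_eq l m (X : B) (f g : btot (l ++ m) ⟶ X) :
  list_mu l m ⨟ f = list_mu l m ⨟ g -> f = g.
Proof. apply iso_cancel_l. Qed.

Lemma mu_inv l m (X : B) (f : btot l ⊗ btot m ⟶ X) : list_mu l m ⨟ (iso_inv (list_mu l m) ⨟ f) = f.
Proof. now rewrite ccompA, iso_hom_inv, cid_l. Qed.

Lemma mu2_cancel l m n (X : B) (f g : btot ((l ++ m) ++ n) ⟶ X) :
  (list_mu l m ⊠ cid (btot n)) ⨟ (list_mu (l ++ m) n ⨟ f) =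
  (list_mu l m ⊠ cid (btot n)) ⨟ (list_mu (l ++ m) n ⨟ g) -> f = g.
Proof.
rewrite !ccompA.
apply (iso_cancel_l (i := comp_iso (tens_iso (list_mu l m) (id_iso (btot n))) (list_mu (l ++ m) n))).
Qed.

Lemma mu2_assoc l m n (p : (l ++ m) ++ n = l ++ (m ++ n)) (X : B)
    (f : btot (l ++ (m ++ n)) ⟶ X) :
  (list_mu l m ⊠ cid (btot n)) ⨟ (list_mu (l ++ m) n ⨟ (transport p ⨟ f)) =
  massoc (btot l) (btot m) (btot n) ⨟ ((cid (btot l) ⊠ list_mu m n) ⨟ (list_mu l (m ++ n) ⨟ f)).
Proof.
pose proof (mu_assoc_list p) as E.
transitivity (((list_mu l m ⊠ cid (btot n)) ⨟ (list_mu (l ++ m) n ⨟ transport p)) ⨟ f);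
  [now rewrite <- !ccompA|].
now rewrite E, <- !ccompA.
Qed.

Lemma mu2_assoc_end l m n (p : (l ++ m) ++ n = l ++ (m ++ n)) :
  (list_mu l m ⊠ cid (btot n)) ⨟ (list_mu (l ++ m) n ⨟ transport p) =
  massoc (btot l) (btot m) (btot n) ⨟ ((cid (btot l) ⊠ list_mu m n) ⨟ list_mu l (m ++ n)).
Proof. apply mu_assoc_list. Qed.

Lemma list_hcomp_assoc u v w :
  list_hcomp u (list_hcomp v w) = list_hcomp (list_hcomp u v) w.
Proof.
destruct u as [l l' a], v as [m m' b], w as [n n' c]; unfold list_hcomp; simpl; symmetry.
apply (list_cell_ext (p := eq_sym (app_assoc l m n)) (q := eq_sym (app_assoc l' m' n'))).
apply mu2_cancel; rewrite mu2_assoc, !mu_inv, tens_merge, mu_inv, cid_l.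
rewrite <- !ccompA, mu_inv, tens_merge, mu_inv, cid_l.
rewrite <- (cid_r c), tens_hom_comp, <- ccompA, mu2_assoc_end, ccompA, massoc_natural.
now rewrite <- ccompA, tens_merge, !cid_r.
Qed.

Lemma list_hcomp_id_l u : list_hcomp (list_id nil) u = u.
Proof.
destruct u as [l l' a]; unfold list_hcomp, list_id; simpl; f_equal.
now rewrite mlunit_natural, ccompA, iso_inv_hom, cid_l.
Qed.

Lemma list_hcomp_id_r u : list_hcomp u (list_id nil) = u.
Proof.
destruct u as [l l' a]; unfold list_hcomp, list_id; simpl.
apply (list_cell_ext (p := app_nil_r l) (q := app_nil_r l')).
apply mu_iso_eq; rewrite (ccompA (list_mu l nil) (transport _)), mu_nil.
rewrite <- !ccompA, mu_inv, mu_nil; apply mrunit_natural.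
Qed.

Lemma list_interchange u u' v v' : lc_cod u = lc_dom u' -> lc_cod v = lc_dom v' ->
  list_hcomp (list_vcomp u u') (list_vcomp v v') =
  list_vcomp (list_hcomp u v) (list_hcomp u' v').
Proof.
destruct u as [l l' a], u' as [m m' b], v as [n n' c], v' as [k k' d]; simpl; intros <- <-.
rewrite !list_vcomp_same; unfold list_hcomp; simpl; rewrite list_vcomp_same; f_equal.
now rewrite <- !ccompA, mu_inv, tens_merge.
Qed.

Definition list_two_category : two_category.
Proof.
refine (@TwoCategory unit (list B) list_cell (fun _ => tt) (fun _ => tt) lc_dom lc_cod
  (fun _ => eq_refl) (fun _ => eq_refl) (fun _ => nil) (@app B) list_id list_vcomp list_hcomp
  _ _ (fun _ _ _ => eq_refl) (fun _ _ _ => eq_refl) (fun _ => eq_refl)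
  (@app_nil_r B) (fun l m n _ _ => app_assoc l m n) (fun _ => eq_refl) (fun _ => eq_refl)
  _ _ _ _ _ (fun _ _ _ => eq_refl) (fun _ _ _ => eq_refl)
  list_hcomp_id_l list_hcomp_id_r (fun u v w _ _ => list_hcomp_assoc u v w) _
  (fun u u' v v' e e' _ => list_interchange e e')).
- now intros [].
- now intros [].
- intros u v e; now rewrite (list_vcompE e).
- intros u v e; now rewrite (list_vcompE e).
- intros [l m a]; unfold list_id; simpl; now rewrite list_vcomp_same, cid_l.
- intros [l m a]; unfold list_id; simpl; now rewrite list_vcomp_same, cid_r.
- intros [l l' a] [m m' b] [n n' c]; simpl; intros <- <-.
  now rewrite !list_vcomp_same, ccompA.
- intros l m _; unfold list_hcomp, list_id; simpl; f_equal.
  now rewrite tens_hom_id, cid_l, iso_inv_hom.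
Defined.

Definition list_braid l m : list_cell :=
  ListCell (iso_inv (list_mu l m) ⨟ (braid (btot l) (btot m) ⨟ list_mu m l)).

Lemma list_cell_ext_sym l l' m m' (a : btot l ⟶ btot m) (a' : btot l' ⟶ btot m')
    (p : l = l') (q : m' = m) :
  a = transport p ⨟ (a' ⨟ transport q) -> ListCell a = ListCell a'.
Proof. destruct p, q; simpl; rewrite cid_l, cid_r; now intros ->. Qed.

Lemma mu2_assoc_inv l m n (p : l ++ (m ++ n) = (l ++ m) ++ n) (X : B)
    (f : btot ((l ++ m) ++ n) ⟶ X) :
  (cid (btot l) ⊠ list_mu m n) ⨟ (list_mu l (m ++ n) ⨟ (transport p ⨟ f)) =
  iso_inv (massoc (btot l) (btot m) (btot n)) ⨟
    ((list_mu l m ⊠ cid (btot n)) ⨟ (list_mu (l ++ m) n ⨟ f)).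
Proof.
apply (iso_cancel_l (i := massoc (btot l) (btot m) (btot n))).
rewrite <- (mu2_assoc (eq_sym p)), (ccompA (massoc _ _ _)), iso_hom_inv, cid_l.
do 2 f_equal; destruct p; simpl; now rewrite !cid_l.
Qed.

(** Both sides are compared after the canonical isomorphism from the bracketed product of [btot l],
    [btot m] and [btot n]. The transports then turn into associators, and what remains is the
    hexagon of [B]. *)
Lemma list_hexagon_r l m n : list_braid l (m ++ n) =
  list_vcomp (list_hcomp (list_braid l m) (list_id n)) (list_hcomp (list_id m) (list_braid l n)).
Proof.
rewrite (list_vcompE (u := list_hcomp (list_braid l m) (list_id n))
  (v := list_hcomp (list_id m) (list_braid l n)) (eq_sym (app_assoc m l n))).
unfold list_hcomp, list_braid, list_id; cbn [lc_dom lc_cod lc_mor]; symmetry.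
apply (list_cell_ext_sym (p := eq_sym (app_assoc l m n)) (q := eq_sym (app_assoc m n l))).
apply mu2_cancel; rewrite mu2_assoc, <- !ccompA, !mu_inv, tens_merge, mu_inv, cid_l.
rewrite tens_right_comp, <- ccompA, mu2_assoc, mu_inv, tens_merge, mu_inv, cid_l.
symmetry; rewrite (ccompA (_ ⊠ _) (braid _ _)), (braiding_natural (braidP B)).
rewrite <- ccompA, mu2_assoc_end, !ccompA.
pose proof (braiding_hexagon1 (braidP B) (btot l) (btot m) (btot n)) as H.
rewrite !ccompA in H; rewrite H, <- !ccompA, tens_merge; now rewrite cid_l.
Qed.

Lemma list_hexagon_l l m n : list_braid (l ++ m) n =
  list_vcomp (list_hcomp (list_id l) (list_braid m n)) (list_hcomp (list_braid l n) (list_id m)).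
Proof.
rewrite (list_vcompE (u := list_hcomp (list_id l) (list_braid m n))
  (v := list_hcomp (list_braid l n) (list_id m)) (app_assoc l n m)).
unfold list_hcomp, list_braid, list_id; cbn [lc_dom lc_cod lc_mor].
apply (list_cell_ext_sym (p := eq_sym (app_assoc l m n)) (q := eq_sym (app_assoc n l m))).
apply mu2_cancel; rewrite mu2_assoc, <- !ccompA, !mu_inv, tens_merge, mu_inv, cid_l.
rewrite (ccompA (_ ⊠ _) (braid _ _)), (braiding_natural (braidP B)), <- ccompA.
rewrite tens_left_comp, <- ccompA, mu2_assoc_inv, mu_inv, tens_merge, mu_inv, cid_l.
rewrite tens_right_comp, <- ccompA, mu2_assoc_end.
pose proof (braiding_hexagon2 (braidP B) (btot l) (btot m) (btot n)) as H.
rewrite (ccompA (iso_inv _) (_ ⊠ _)), (ccompA (cid _ ⊠ _)), <- H, !ccompA.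
rewrite iso_hom_inv, cid_l, <- (ccompA _ (iso_inv _)), iso_inv_hom, cid_r.
reflexivity.
Qed.

(** Its comparison with [B] is [btot] with the isomorphisms [list_mu]; it is not stated separately
    but enters through [end_functor] and [end_mu]. *)
Definition strictify : strict_braided.
Proof.
refine (@StrictBraided list_two_category tt _ list_braid (fun _ _ => conj eq_refl eq_refl)
  _ _ list_hexagon_r list_hexagon_l).
- now intros [] [].
- intros l m; destruct (braiding_iso (braidP B) (btot l) (btot m)) as (d & d1 & d2).
  exists (ListCell (iso_inv (list_mu m l) ⨟ (d ⨟ list_mu l m))).
  apply (inverse_cells_intro (C := list_two_category) (f := l ++ m) (g := m ++ l));
    try (split; reflexivity).
  + refine (eq_trans (list_vcomp_same _ _) _); change (id2 (l ++ m : arr list_two_category))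
      with (list_id (l ++ m)); unfold list_id; f_equal.
    now rewrite <- !ccompA, mu_inv, (ccompA (braid _ _)), d1, cid_l, iso_inv_hom.
  + refine (eq_trans (list_vcomp_same _ _) _); change (id2 (m ++ l : arr list_two_category))
      with (list_id (m ++ l)); unfold list_id; f_equal.
    now rewrite <- !ccompA, mu_inv, (ccompA d), d2, cid_l, iso_inv_hom.
- intros l l' m m' [? ? a] [? ? b] [H1 H2] [H3 H4]; simpl in H1, H2, H3, H4; subst.
  refine (eq_trans (list_vcomp_same _ _) (eq_trans _ (eq_sym (list_vcomp_same _ _)))).
  f_equal; simpl; rewrite <- !ccompA, !mu_inv; f_equal.
  now rewrite ccompA, (braiding_natural (braidP B)), <- ccompA.
Defined.
End Strictify.

(** * The reverse braiding *)

Lemma inverse_hom_unique (A : category) (x y : A) (f g : x ⟶ y) (h k : y ⟶ x) :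
  f ⨟ h = cid x -> k ⨟ g = cid y -> h = k -> f = g.
Proof. intros e e' e''; subst k; now rewrite <- (cid_r f), <- e', ccompA, e, cid_l. Qed.

(** Inverting both sides of a hexagon reverses the order of its factors and exchanges associators
    with their inverses, so each hexagon of [d] is the other hexagon of [braid], with the objects
    permuted cyclically. *)
Lemma reverse_braiding (B : braided_monoidal_category) :
  exists d : forall x y : B, x ⊗ y ⟶ y ⊗ x, is_braiding d /\
    forall x y, d x y ⨟ braid y x = cid (x ⊗ y) /\ braid y x ⨟ d x y = cid (y ⊗ x).
Proof.
assert (CD : forall x y : B, {d : x ⊗ y ⟶ y ⊗ x |
  d ⨟ braid y x = cid (x ⊗ y) /\ braid y x ⨟ d = cid (y ⊗ x)}).
{ intros x y; apply constructive_indefinite_description.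
  destruct (braiding_iso (braidP B) y x) as (d & d1 & d2); now exists d. }
pose (d := fun x y => proj1_sig (CD x y)).
assert (D1 : forall x y, d x y ⨟ braid y x = cid (x ⊗ y)) by (intros; apply (proj2_sig (CD x y))).
assert (D2 : forall x y, braid y x ⨟ d x y = cid (y ⊗ x)) by (intros; apply (proj2_sig (CD x y))).
exists d; split; [|now split].
pose (i := fun x y => @Iso _ _ _ (braid y x) (d x y) (D2 x y) (D1 x y)).
constructor.
- intros x y; exists (braid y x); now split.
- intros x x' y y' f g.
  apply (iso_cancel_l (i := i x y)); apply (iso_cancel_r (i := i x' y')); simpl.
  rewrite <- !ccompA, D1, cid_r, (ccompA (braid y x)), D2, cid_l.
  symmetry; apply (braiding_natural (braidP B)).
- intros x y z; eapply inverse_hom_unique; [| |exact (braiding_hexagon2 (braidP B) y z x)].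
  + rewrite <- !ccompA, (ccompA (massoc y z x)), iso_hom_inv, cid_l.
    now rewrite (ccompA (d x (y ⊗ z))), D1, cid_l, iso_hom_inv.
  + rewrite <- !ccompA, (ccompA (braid y x ⊠ cid z)), <- tens_hom_comp, D2, cid_l, tens_hom_id, cid_l.
    rewrite (ccompA (iso_inv _)), iso_inv_hom, cid_l, <- tens_hom_comp, D2, cid_l.
    apply tens_hom_id.
- intros x y z; eapply inverse_hom_unique; [| |exact (braiding_hexagon1 (braidP B) z x y)].
  + rewrite <- !ccompA, (ccompA (iso_inv (massoc z x y))), iso_inv_hom, cid_l.
    now rewrite (ccompA (d (x ⊗ y) z)), D1, cid_l, iso_inv_hom.
  + rewrite <- !ccompA, (ccompA (cid x ⊠ braid z y)), <- tens_hom_comp, D2, cid_l, tens_hom_id, cid_l.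
    rewrite (ccompA (massoc _ _ _ : _ ⟶ _)), iso_hom_inv, cid_l, <- tens_hom_comp, D2, cid_l.
    apply tens_hom_id.
Qed.

(** * From cells between lists to morphisms of the given category *)

Section CellMor.
Variable B : braided_monoidal_category.
Implicit Types (l m n : list B) (u v w : list_cell B).

Definition list_is_cell u l m : Prop := lc_dom u = l /\ lc_cod u = m.

(** A [list_cell] carries its own boundary. This turns it into a morphism between lists that are
    merely equal to that boundary. *)
Definition cell_mor u l m (H : list_is_cell u l m) : btot (M := B) l ⟶ btot m :=
  transport (eq_sym (proj1 H)) ⨟ (lc_mor u ⨟ transport (proj2 H)).

Lemma cell_morE u l m (H : list_is_cell u l m) : ListCell (cell_mor H) = u.
Proof.
destruct u as [l' m' a]; unfold cell_mor; pose proof H as [H1 H2]; simpl in H1, H2.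
subst l' m'; simpl; now rewrite !transport_refl, cid_l, cid_r.
Qed.

Lemma cell_mor_cell l m (a : btot l ⟶ btot m) (H : list_is_cell (ListCell a) l m) :
  cell_mor H = a.
Proof.
unfold cell_mor; simpl; now rewrite !transport_refl, cid_l, cid_r.
Qed.

Lemma cell_mor_eq u l m (a : btot l ⟶ btot m) (H : list_is_cell u l m) :
  u = ListCell a -> cell_mor H = a.
Proof. intros ->; apply cell_mor_cell. Qed.

Lemma cell_mor_inj u v l m (H : list_is_cell u l m) (H' : list_is_cell v l m) :
  cell_mor H = cell_mor H' -> u = v.
Proof. intros e; now rewrite <- (cell_morE H), <- (cell_morE H'), e. Qed.

Lemma cell_mor_id u l m (p : l = m) (H : list_is_cell u l m) :
  u = list_id l -> cell_mor H = transport p.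
Proof. intros e; destruct p; exact (cell_mor_eq H e). Qed.

Lemma list_cell_inv l l' m m' (a : btot l ⟶ btot m) (a' : btot l' ⟶ btot m') :
  ListCell a = ListCell a' -> exists (p : l = l') (q : m = m'),
    a ⨟ transport q = transport p ⨟ a'.
Proof.
intros E.
assert (H : list_is_cell (ListCell a') l m) by (rewrite <- E; now split).
pose proof (cell_mor_eq H (eq_sym E)) as E'; unfold cell_mor in E'; simpl in E'.
pose proof H as [H1 H2]; simpl in H1, H2; subst l' m'.
exists eq_refl, eq_refl; simpl; rewrite cid_l, cid_r.
rewrite !transport_refl, cid_l, cid_r in E'; now symmetry.
Qed.

(** The translation of [smap_phi_assoc] from cells to morphisms: strict associativity of
    concatenation is traded, through [list_mu], for the associator. *)
Lemma list_phi_assoc (lf lg lh lfg lgh l1 l2 : list B) (p : l1 = l2)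
    (a : btot lfg ⟶ btot (lf ++ lg)) (b : btot l1 ⟶ btot (lfg ++ lh))
    (c : btot lgh ⟶ btot (lg ++ lh)) (d : btot l2 ⟶ btot (lf ++ lgh)) :
  list_vcomp (ListCell b) (list_hcomp (ListCell a) (list_id lh)) =
  list_vcomp (ListCell d) (list_hcomp (list_id lf) (ListCell c)) ->
  (b ⨟ iso_inv (list_mu lfg lh)) ⨟ (((a ⨟ iso_inv (list_mu lf lg)) ⊠ cid (btot lh)) ⨟
    massoc (btot lf) (btot lg) (btot lh)) =
  transport p ⨟ ((d ⨟ iso_inv (list_mu lf lgh)) ⨟ (cid (btot lf) ⊠ (c ⨟ iso_inv (list_mu lg lh)))).
Proof.
unfold list_hcomp, list_id; cbn [lc_dom lc_cod lc_mor]; rewrite !list_vcomp_same; intros E.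
destruct p; simpl; rewrite cid_l.
destruct (list_cell_inv E) as (q1 & q2 & E').
rewrite transport_refl, cid_l in E'.
apply (iso_cancel_r (i := comp_iso (tens_iso (id_iso (btot lf)) (list_mu lg lh)) (list_mu lf (lg ++ lh)))).
cbn [iso_hom comp_iso tens_iso id_iso]; rewrite <- !ccompA.
rewrite <- (mu2_assoc_end q2), !tens_merge, <- !ccompA, !iso_inv_hom, !cid_l, !cid_r.
rewrite <- !ccompA in E'; exact E'.
Qed.

Lemma list_cell_transport l m n (a : btot (M := B) l ⟶ btot m) (p : l = m) :
  ListCell a = list_id n -> a = transport p.
Proof.
intros E; pose proof (f_equal (@lc_dom B) E) as e; simpl in e; subst n.
rewrite <- (cell_mor_cell (conj eq_refl eq_refl : list_is_cell (ListCell a) l m)).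
now apply cell_mor_id.
Qed.

Lemma list_cell_inj l m (a a' : btot (M := B) l ⟶ btot m) : ListCell a = ListCell a' -> a = a'.
Proof.
intros E; destruct (list_cell_inv E) as (p & q & E').
now rewrite !transport_refl, cid_l, cid_r in E'.
Qed.

Lemma list_vcomp_mor u v l m n (Hu : list_is_cell u l m) (Hv : list_is_cell v m n) :
  list_vcomp u v = ListCell (cell_mor Hu ⨟ cell_mor Hv).
Proof.
transitivity (list_vcomp (ListCell (cell_mor Hu)) (ListCell (cell_mor Hv)));
  [now rewrite !cell_morE | apply list_vcomp_same].
Qed.

Lemma list_hcomp_mor u v l l' m m' (Hu : list_is_cell u l l') (Hv : list_is_cell v m m') :
  list_hcomp u v = ListCell (iso_inv (list_mu l m) ⨟ ((cell_mor Hu ⊠ cell_mor Hv) ⨟ list_mu l' m')).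
Proof.
transitivity (list_hcomp (ListCell (cell_mor Hu)) (ListCell (cell_mor Hv)));
  [now rewrite !cell_morE | reflexivity].
Qed.

Lemma list_iso u v l m : list_is_cell u l m -> list_is_cell v m l ->
  list_vcomp u v = list_id l -> list_vcomp v u = list_id m ->
  exists i : iso (btot (M := B) l) (btot m), u = ListCell i /\ v = ListCell (iso_inv i).
Proof.
intros Hu Hv E1 E2.
assert (F1 : cell_mor Hu ⨟ cell_mor Hv = cid (btot l))
  by (apply list_cell_inj; rewrite <- list_vcomp_mor; exact E1).
assert (F2 : cell_mor Hv ⨟ cell_mor Hu = cid (btot m))
  by (apply list_cell_inj; rewrite <- list_vcomp_mor; exact E2).
exists (Iso F1 F2); simpl; now rewrite !cell_morE.
Qed.

Lemma mu_lunit_transport l0 m (p : nil = l0) (q : l0 ++ m = m) :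
  (transport p ⊠ cid (btot m)) ⨟ (list_mu l0 m ⨟ transport q) = mlunit (btot (M := B) m).
Proof.
destruct p; simpl in *; pose proof (transport_refl q) as E; simpl in E; rewrite E.
rewrite cid_r, tens_hom_id; apply cid_l.
Qed.

Lemma mu_runit_transport l0 m (p : nil = l0) (q : m ++ l0 = m) :
  (cid (btot m) ⊠ transport p) ⨟ (list_mu m l0 ⨟ transport q) = mrunit (btot (M := B) m).
Proof. destruct p; rewrite mu_nil; simpl; rewrite tens_hom_id; apply cid_l. Qed.
End CellMor.

Definition sym_iso (A : category) (x y : A) (i : iso x y) : iso y x :=
  Iso (iso_inv_hom i) (iso_hom_inv i).

(** The comparisons go from the value of a composite to the product, whereas the structure maps of a
    monoidal functor go the other way. Associativity known for the former is here inverted. *)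
Lemma inverse_square (M : monoidal_category) (x y z xy yz s s' : M)
    (i : iso (x ⊗ y) xy) (j : iso (xy ⊗ z) s) (k : iso (y ⊗ z) yz) (h : iso (x ⊗ yz) s')
    (t : s ⟶ s') :
  iso_inv j ⨟ ((iso_inv i ⊠ cid z) ⨟ massoc x y z) =
    t ⨟ (iso_inv h ⨟ (cid x ⊠ iso_inv k)) ->
  (i ⊠ cid z) ⨟ j ⨟ t = massoc x y z ⨟ (cid x ⊠ k) ⨟ h.
Proof.
intros Q.
assert (Q' : t = (iso_inv j ⨟ ((iso_inv i ⊠ cid z) ⨟ massoc x y z)) ⨟ ((cid x ⊠ k) ⨟ h)).
{ rewrite Q, <- !ccompA, (ccompA (cid x ⊠ iso_inv k)), <- tens_left_comp, iso_inv_hom.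
  now rewrite tens_hom_id, cid_l, iso_inv_hom, cid_r. }
rewrite Q', <- !ccompA, (ccompA j), iso_hom_inv, cid_l.
now rewrite (ccompA (i ⊠ cid z)), <- tens_right_comp, iso_hom_inv, tens_hom_id, cid_l.
Qed.

Lemma transport_comp (M : monoidal_category) (l m n : list M) (p : l = m) (q : m = n) (r : l = n) :
  transport p ⨟ transport q = transport r.
Proof. destruct p, q; simpl; rewrite cid_l; symmetry; apply transport_refl. Qed.

(** * The monoidal equivalence given by the value *)

Section EndFunctor.
Variable R : braided_monoidal_category.

Notation S := (strictify R).
Notation C := (strand_semimonoidal S).
Notation I := (0 : obj C).
Notation E := (end_monoidal (C := C) I).

Definition end_ev (f : E) : list R := smap_ev (proj1_sig f).

Lemma end_cell (f g : E) (a : f ⟶ g) : list_is_cell (cmor (proj1_sig a)) (end_ev f) (end_ev g).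
Proof.
destruct a as [a [Ha Ha']]; pose proof (cmor_cell a) as [H1 H2].
unfold end_ev; rewrite <- Ha, <- Ha'; exact (conj H1 H2).
Qed.

Definition end_mor (f g : E) (a : f ⟶ g) : btot (M := R) (end_ev f) ⟶ btot (end_ev g) :=
  cell_mor (end_cell a).

Lemma end_mor_id (f : E) : end_mor (cid f) = cid (btot (end_ev f)).
Proof. exact (cell_mor_eq (end_cell (cid f)) (cmor_id2 (M := S) (proj1_sig f))). Qed.

Lemma end_mor_comp (f g h : E) (a : f ⟶ g) (b : g ⟶ h) :
  end_mor (a ⨟ b) = end_mor a ⨟ end_mor b.
Proof.
apply cell_mor_eq; unfold end_mor; rewrite <- (list_vcomp_mor (end_cell a) (end_cell b)).
exact (strand_vcompE (M := S) (u := proj1_sig a) (v := proj1_sig b)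
  (eq_trans (proj2 (proj2_sig a)) (eq_sym (proj1 (proj2_sig b))))).
Qed.

Definition end_functor : functor E R :=
  @Functor E R (fun f => btot (end_ev f)) end_mor end_mor_id end_mor_comp.

Lemma end_functor_equivalence : is_equivalence end_functor.
Proof.
apply equivalence_intro.
- intros f g a b e; apply sig_ext.
  apply (strand_cell_ext (proj2_sig a) (proj2_sig b)); exact (cell_mor_inj e).
- intros f g h.
  destruct (@strand_cell_intro S (proj1_sig f) (proj1_sig g) (ListCell h)) as (u & Hu & Eu).
  + exact (eq_trans (proj1 (proj2_sig f)) (eq_sym (proj1 (proj2_sig g)))).
  + exact (eq_trans (proj2 (proj2_sig f)) (eq_sym (proj2 (proj2_sig g)))).
  + split; reflexivity.
  + exists (exist _ u Hu); exact (cell_mor_eq _ Eu).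
- intros y.
  assert (H : is_arrow (C := C) (smap_mul (M := S) 0 0 (y :: nil)) I I) by (split; reflexivity).
  pose (f := exist (fun f : arr C => is_arrow f I I) _ H : E).
  exists f; constructor.
  assert (e : end_ev f = y :: nil) by exact (smap_mul_ev (M := S) 0 0 (y :: nil)).
  (* For the list with the single entry [y], [btot] is [y] tensored with the unit; hence the right
     unitor. *)
  change (iso (btot (end_ev f)) y); rewrite e; exact (mrunit y).
Qed.

Lemma strictify_inverse (u : cel S) (l m : arr S) : is_cell u l m -> invertible_cell u ->
  exists i : iso (btot (M := R) l) (btot (M := R) m),
    u = ListCell i /\ vinv u = ListCell (iso_inv i).
Proof.
intros H I; destruct (vinv_elim H I) as (H' & E1 & E2).
exact (list_iso H H' E1 E2).
Qed.

Definition end_phi (f g : E) : list_cell R :=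
  smap_phi (M := S) (proj1_sig f) (proj1_sig g).

Lemma end_tens_map (f g : E) :
  proj1_sig (f ⊗ g) = smap_comp (M := S) (proj1_sig f) (proj1_sig g).
Proof.
transitivity (comp (t := C) (proj1_sig f) (proj1_sig g)); reflexivity.
Qed.

Lemma phi_iso_exists (f g : E) :
  exists i : iso (btot (M := R) (end_ev (f ⊗ g))) (btot (end_ev f ++ end_ev g)),
    end_phi f g = ListCell i /\ vinv (C := S) (end_phi f g) = ListCell (iso_inv i).
Proof.
destruct (@smap_phi_cell S (proj1_sig f) (proj1_sig g) (end_composable f g)) as [H1 H2].
rewrite <- (end_tens_map f g) in H1; exact (strictify_inverse H1 H2).
Qed.

Definition phi_iso (f g : E) :
    iso (btot (M := R) (end_ev (f ⊗ g))) (btot (end_ev f ++ end_ev g)) :=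
  proj1_sig (constructive_indefinite_description _ (phi_iso_exists f g)).

Lemma end_phi_cell (f g : E) : end_phi f g = ListCell (phi_iso f g).
Proof. exact (proj1 (proj2_sig (constructive_indefinite_description _ (phi_iso_exists f g)))). Qed.

Lemma end_vphi_cell (f g : E) : vinv (C := S) (end_phi f g) = ListCell (iso_inv (phi_iso f g)).
Proof. exact (proj2 (proj2_sig (constructive_indefinite_description _ (phi_iso_exists f g)))). Qed.

Definition end_mu (f g : E) :
  iso (btot (M := R) (end_ev f) ⊗ btot (end_ev g)) (btot (end_ev (f ⊗ g))) :=
  comp_iso (list_mu (end_ev f) (end_ev g)) (sym_iso (phi_iso f g)).

Lemma end_mor_hcomp (f f' g g' : E) (a : f ⟶ f') (b : g ⟶ g') :
  end_mor (a ⊠ b) = phi_iso f g ⨟ (iso_inv (list_mu (end_ev f) (end_ev g)) ⨟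
    ((end_mor a ⊠ end_mor b) ⨟ (list_mu (end_ev f') (end_ev g') ⨟ iso_inv (phi_iso f' g')))).
Proof.
apply cell_mor_eq.
assert (Ha : dom (proj1_sig a) = proj1_sig f /\ cod (proj1_sig a) = proj1_sig f')
  by exact (proj2_sig a).
assert (Hb : dom (proj1_sig b) = proj1_sig g /\ cod (proj1_sig b) = proj1_sig g')
  by exact (proj2_sig b).
destruct Ha as [a1 a2], Hb as [b1 b2].
assert (K : tgt (dom (proj1_sig a)) = src (dom (proj1_sig b)))
  by (rewrite a1, b1; apply end_composable).
pose proof (strand_hcompE (M := S) (u := proj1_sig a) (v := proj1_sig b) K) as P.
rewrite a1, a2, b1, b2 in P.
transitivity (list_vcomp (end_phi f g) (list_vcomp
  (list_hcomp (cmor (proj1_sig a)) (cmor (proj1_sig b))) (vinv (C := S) (end_phi f' g')))).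
- exact P.
- rewrite end_phi_cell, end_vphi_cell, (list_hcomp_mor (end_cell a) (end_cell b)).
  rewrite !list_vcomp_same; f_equal; unfold end_mor; now rewrite <- !ccompA.
Qed.

Lemma end_mu_natural (f f' g g' : E) (a : f ⟶ f') (b : g ⟶ g') :
  (end_mor a ⊠ end_mor b) ⨟ end_mu f' g' = end_mu f g ⨟ end_mor (a ⊠ b).
Proof.
rewrite end_mor_hcomp; cbn [end_mu comp_iso sym_iso iso_hom iso_inv].
rewrite <- !ccompA, (ccompA (iso_inv (phi_iso f g))), iso_inv_hom, cid_l.
now rewrite (ccompA (list_mu _ _) (iso_inv _)), iso_hom_inv, cid_l.
Qed.

Lemma end_mor_identity (f g : E) (e : proj1_sig f = proj1_sig g) (p : end_ev f = end_ev g) :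
  end_mor (identity_iso e) = transport p.
Proof.
exact (cell_mor_id p (end_cell (identity_iso e)) (cmor_id2 (M := S) (proj1_sig f))).
Qed.

(** [list_phi_assoc] applied to the comparisons and inverted by [inverse_square]. The associator of
    [E] is an identity 2-cell, so its image is a transport. *)
Lemma end_mu_assoc (f g h : E) :
  (end_mu f g ⊠ cid (btot (end_ev h))) ⨟ end_mu (f ⊗ g) h ⨟ end_mor (massoc f g h) =
  massoc (btot (M := R) (end_ev f)) (btot (end_ev g)) (btot (end_ev h)) ⨟
    (cid (btot (end_ev f)) ⊠ end_mu g h) ⨟ end_mu f (g ⊗ h).
Proof.
assert (p : end_ev ((f ⊗ g) ⊗ h) = end_ev (f ⊗ (g ⊗ h))).
{ exact (f_equal (@smap_ev S) (end_compA f g h)). }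
pose proof (@smap_phi_assoc S (proj1_sig f) (proj1_sig g) (proj1_sig h)
  (end_composable f g) (end_composable g h)) as P.
rewrite <- !end_tens_map in P.
assert (P' : list_vcomp (end_phi (f ⊗ g) h) (list_hcomp (end_phi f g) (list_id (end_ev h))) =
  list_vcomp (end_phi f (g ⊗ h)) (list_hcomp (list_id (end_ev f)) (end_phi g h))) by exact P.
rewrite !end_phi_cell in P'; pose proof (list_phi_assoc p P') as Q.
pose proof (end_mor_identity (end_compA f g h) p) as T.
exact (inverse_square (i := end_mu f g) (j := end_mu (f ⊗ g) h) (k := end_mu g h)
  (h := end_mu f (g ⊗ h)) (eq_trans Q (f_equal (fun t => t ⨟ _) (eq_sym T)))).
Qed.

(** The value of the identity strand map is the empty list only up to a propositional equality, so
    this is a transport. *)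
Definition end_eps : iso (munit R) (btot (end_ev (munit E))) :=
  transport (M := R) (eq_sym (smap_ev_id S 0)).

Lemma end_mu_lunit (f : E) :
  (end_eps ⊠ cid (btot (end_ev f))) ⨟ end_mu (munit E) f ⨟ end_mor (mlunit f) =
  mlunit (btot (M := R) (end_ev f)).
Proof.
assert (p : end_ev (munit E ⊗ f) = end_ev f).
{ exact (f_equal (@smap_ev S) (end_comp_id_l f)). }
assert (q : end_ev (munit E) ++ end_ev f = end_ev f).
{ exact (eq_trans (f_equal (fun l => l ++ end_ev f) (smap_ev_id S 0)) eq_refl). }
assert (r : end_ev (munit E) ++ end_ev f = end_ev (munit E ⊗ f)) by congruence.
assert (K : end_phi (munit E) f = list_id (end_ev f)).
{ exact (smap_phi_id_l (M := S) (A := proj1_sig f) (eq_sym (proj1 (proj2_sig f)))). }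
assert (K' : iso_inv (phi_iso (munit E) f) = transport r).
{ apply (list_cell_transport (n := end_ev f)); rewrite <- end_vphi_cell, K.
  exact (vinv_id2 (C := S) (end_ev f)). }
pose proof (end_mor_identity (end_comp_id_l f) p) as T.
unfold end_mu, end_eps; cbn [comp_iso sym_iso iso_hom]; rewrite K'.
transitivity ((transport (eq_sym (smap_ev_id S 0)) ⊠ cid (btot (end_ev f))) ⨟
  (list_mu (M := R) (end_ev (munit E)) (end_ev f) ⨟ transport q));
  [|exact (mu_lunit_transport (B := R) (eq_sym (smap_ev_id S 0)) q)].
f_equal; rewrite <- ccompA; f_equal.
etransitivity; [apply f_equal; exact T|apply transport_comp].
Qed.

Lemma end_mu_runit (f : E) :
  (cid (btot (end_ev f)) ⊠ end_eps) ⨟ end_mu f (munit E) ⨟ end_mor (mrunit f) =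
  mrunit (btot (M := R) (end_ev f)).
Proof.
assert (p : end_ev (f ⊗ munit E) = end_ev f).
{ exact (f_equal (@smap_ev S) (end_comp_id_r f)). }
assert (q : end_ev f ++ end_ev (munit E) = end_ev f).
{ exact (eq_trans (f_equal (fun l => end_ev f ++ l) (smap_ev_id S 0)) (app_nil_r _)). }
assert (r : end_ev f ++ end_ev (munit E) = end_ev (f ⊗ munit E)) by congruence.
assert (K : end_phi f (munit E) = list_id (end_ev f)).
{ exact (smap_phi_id_r (M := S) (A := proj1_sig f) (eq_sym (proj2 (proj2_sig f)))). }
assert (K' : iso_inv (phi_iso f (munit E)) = transport r).
{ apply (list_cell_transport (n := end_ev f)); rewrite <- end_vphi_cell, K.
  exact (vinv_id2 (C := S) (end_ev f)). }
pose proof (end_mor_identity (end_comp_id_r f) p) as T.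
unfold end_mu, end_eps; cbn [comp_iso sym_iso iso_hom]; rewrite K'.
transitivity ((cid (btot (end_ev f)) ⊠ transport (eq_sym (smap_ev_id S 0))) ⨟
  (list_mu (M := R) (end_ev f) (end_ev (munit E)) ⨟ transport q));
  [|exact (mu_runit_transport (B := R) (eq_sym (smap_ev_id S 0)) q)].
f_equal; rewrite <- ccompA; f_equal.
etransitivity; [apply f_equal; exact T|apply transport_comp].
Qed.

Definition end_monoidal_functor : monoidal_functor E R :=
  @MonoidalFunctor E R end_functor end_mu end_eps
    end_mu_natural end_mu_assoc end_mu_lunit end_mu_runit.

Lemma vinv_list_braid (l m : list R)
    (d : btot (M := R) m ⊗ btot l ⟶ btot (M := R) l ⊗ btot m) :
  d ⨟ braid (btot (M := R) l) (btot m) = cid _ -> braid (btot l) (btot m) ⨟ d = cid _ ->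
  vinv (C := S) (list_braid l m) = ListCell (iso_inv (list_mu m l) ⨟ (d ⨟ list_mu l m)).
Proof.
intros d1 d2; apply (vinv_unique (C := S) (f := l ++ m) (g := m ++ l));
  try (split; reflexivity).
- refine (eq_trans (list_vcomp_same _ _) _).
  transitivity (list_id (B := R) (l ++ m)); [unfold list_id; f_equal|reflexivity].
  now rewrite <- !ccompA, mu_inv, (ccompA (braid _ _)), d2, cid_l, iso_inv_hom.
- refine (eq_trans (list_vcomp_same _ _) _).
  transitivity (list_id (B := R) (m ++ l)); [unfold list_id; f_equal|reflexivity].
  now rewrite <- !ccompA, mu_inv, (ccompA d), d1, cid_l, iso_inv_hom.
Qed.

(** Here [d] is any inverse of the braiding of [R] with the arguments exchanged. In the application
    [R] carries the reverse of the given braiding, and [d] is the given braiding itself. *)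
Lemma end_T (f g : E) (t : f ⊗ g ⟶ g ⊗ f)
    (d : btot (M := R) (end_ev f) ⊗ btot (end_ev g) ⟶ btot (M := R) (end_ev g) ⊗ btot (end_ev f)) :
  is_T I (strand_alpha S) (proj1_sig f) (proj1_sig g) (proj1_sig t) ->
  d ⨟ braid (btot (M := R) (end_ev g)) (btot (end_ev f)) = cid _ ->
  braid (btot (end_ev g)) (btot (end_ev f)) ⨟ d = cid _ ->
  end_mu f g ⨟ end_mor t = d ⨟ end_mu g f.
Proof.
intros HT d1 d2.
pose proof (strand_T (M := S) (proj2_sig f) (proj2_sig g) HT) as P.
assert (P' : cmor (proj1_sig t) = list_vcomp (end_phi f g) (list_vcomp
  (vinv (C := S) (list_braid (end_ev g) (end_ev f))) (vinv (C := S) (end_phi g f)))) by exact P.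
rewrite end_phi_cell, end_vphi_cell, (vinv_list_braid d1 d2), !list_vcomp_same in P'.
unfold end_mor; rewrite (cell_mor_eq (end_cell t) P'); unfold end_mu.
cbn [comp_iso sym_iso iso_hom iso_inv]; rewrite <- !ccompA.
rewrite (ccompA (iso_inv (phi_iso f g))), iso_inv_hom, cid_l; apply mu_inv.
Qed.
End EndFunctor.

(** [strand_T] produces the inverse of the braiding with the arguments exchanged,
    so the construction is applied to the reverse of the given braiding. *)
Lemma braided_realisation (B : braided_monoidal_category) :
  exists (C : semimonoidal_two_category) (I : obj C) (alpha : arr C)
    (T : forall f g : end_monoidal I, f ⊗ g ⟶ g ⊗ f) (HT : is_braiding T),
    weak_unit I alpha /\ is_T_family alpha T /\
    braided_equivalent (BraidedMonoidalCategory HT) B.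
Proof.
destruct (reverse_braiding B) as (d & Hd & Hinv).
pose (R := BraidedMonoidalCategory Hd).
pose proof (strand_weak_unit (strictify R)) as W.
destruct (weak_unit_braiding W) as (T & HF & HT).
exists (strand_semimonoidal (strictify R)), 0, (strand_alpha (strictify R)), T, HT.
split; [exact W|split; [exact HF|]].
(* [R] and [B] differ only in the braiding, so this is at the same time a monoidal functor to
   [B]. *)
exists (end_monoidal_functor R); split; [|exact (end_functor_equivalence R)].
intros f g.
destruct (Hinv (btot (M := B) (end_ev g)) (btot (M := B) (end_ev f))) as [e1 e2].
exact (end_T (proj2 (HF f g _) eq_refl) e2 e1).
Qed.

Theorem mainTheorem1 :
  (forall (C : semimonoidal_two_category) (I : obj C) (alpha : arr C),
    weak_unit I alpha ->
    exists T : forall f g : end_monoidal I, f ⊗ g ⟶ g ⊗ f,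
      is_T_family alpha T /\ is_braiding T) /\
  (forall B : braided_monoidal_category,
    exists (C : semimonoidal_two_category) (I : obj C) (alpha : arr C)
      (T : forall f g : end_monoidal I, f ⊗ g ⟶ g ⊗ f) (HT : is_braiding T),
      weak_unit I alpha /\ is_T_family alpha T /\
      braided_equivalent (BraidedMonoidalCategory HT) B).
Proof.
split; [exact weak_unit_braiding | exact braided_realisation].
Qed.
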